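(* Let $G$ be a directed graph. 1. The following statements are equivalent: (1) $G$ is acyclic; (2) $\mathscr H_0(G)$ is a finitely generated $\mathbb{Z}$-module; (3) $\mathscr H_*(G)$ is a finitely generated $\mathbb{Z}$-module; (4) there is an $n\ge1$ such that $x^n\in I(G)$ for all $x\in E(G)$; (5) $\mathrm{Kdim}_{\mathbb{Z}[E(G)]}\mathscr H_0(G)=1$; (6) $\mathrm{Kdim}_{\mathbb{Q}[E(G)]}\mathscr H_0^{\mathbb{Q}}(G)=0$. 2. $\alpha(G)=\mathrm{Kdim}_{\mathbb{Q}[E(G)]}\mathscr H_0^{\mathbb{Q}}(G)\le\mathrm{Kdim}_{\mathbb{Z}[E(G)]}\mathscr H_0(G)-1\le\beta(G)$. In particular, if $G$ is planar, then $\alpha(G)=\mathrm{Kdim}_{\mathbb{Q}[E(G)]}\mathscr H_0^{\mathbb{Q}}(G)=\mathrm{Kdim}_{\mathbb{Z}[E(G)]}\mathscr H_0(G)-1=\beta(G)$.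
   Context: A directed graph $G$: finite sets $V(G)$, $E(G)$, each edge with an initial and a terminal vertex; loops and multiple edges allowed; no vertex of degree $0$. Directed cycles are closed directed paths with pairwise distinct vertices (up to circular permutation); $G$ is acyclic if it has none. $\alpha(G)$ is the maximal number of pairwise edge-disjoint directed cycles; $\beta(G)$ is the minimal number of edges whose removal destroys all directed cycles. $\mathbb{Z}[E(G)]$ is graded with every edge of degree $1$. For a vertex $v$ with outgoing edges $x_1,\dots,x_m$ and incoming edges $y_1,\dots,y_n$ (a loop appears in both lists), $k_v=\max\{m,n\}$, $\delta_{v,l}=e_l(x_1,\dots,x_m)-e_l(y_1,\dots,y_n)$ ($1\le l\le k_v$, $e_l$ the elementary symmetric polynomials). $\Delta_G$ is the list of all $\delta_{v,l}$ and $I(G)$ the ideal they generate. For a graded commutative ring $R$ and homogeneous $r$, the graded Koszul complex $C^R(r)$ is $0\to R\{\deg r\}\xrightarrow{r}R\to0$ in homological degrees $1,0$ (where $M\{l\}$ shifts the grading up by $l$); for a sequence, $C^R(r_1,\dots,r_k)=C^R(r_1)\otimes_R\cdots\otimes_R C^R(r_k)$. The Khovanov–Rozansky complex is $\mathscr C_*(G)=C^{\mathbb{Z}[E(G)]}_*(\Delta_G)$, $\mathscr H_*(G)$ its homology and $\mathscr H_0(G)$ its homological-degree-$0$ part; $\mathscr H^{\mathbb{Q}}_*(G)$ is the homology of $\mathbb{Q}\otimes_{\mathbb{Z}}\mathscr C_*(G)$. For a commutative ring $R$ and $R$-module $M$, $\mathrm{ann}_R(M)=\{r\in R: rM=0\}$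 and $\mathrm{Kdim}_R M$ is the Krull dimension of $R/\mathrm{ann}_R(M)$. *)

(* Defs.v *)
From HB Require Import structures.
From mathcomp Require Import all_boot all_order all_algebra.
(* [mpoly] must be imported before the analysis files: the opposite order
   makes their notation levels clash. *)
From mathcomp Require Import mpoly ring.
From mathcomp Require Import boolp classical_sets reals ereal.
From mathcomp Require Import topology normedtype.

Set Implicit Arguments.
Unset Strict Implicit.
Unset Printing Implicit Defensive.

Import Order.TTheory GRing.Theory Num.Theory numFieldNormedType.Exports.

Local Open Scope classical_set_scope.
Local Open Scope ring_scope.
Local Open Scope quotient_scope.

Record digraph := Digraph {
  vertex : finType;
  edge : finType;
  src : edge -> vertex;
  tgt : edge -> vertex;
  no_isolated : forall v, exists e, src e = v \/ tgt e = v
}.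

Section Cycles.
Variable G : digraph.

Definition dicycle (p : seq (edge G)) : bool :=
  [&& p != [::], cycle (fun e f => tgt e == src f) p & uniq (map (@src G) p)].

Definition acyclic : Prop := forall p, ~~ dicycle p.

(* A directed cycle up to circular permutation is the same as its edge set. *)
Definition dicycles : {set {set edge G}} :=
  [set A | `[< exists2 p, dicycle p & A = [set e in p] >]]%SET.

Definition alpha : nat :=
  \max_(F : {set {set edge G}} | (F \subset dicycles) && finset.trivIset F) #|F|.

Definition feedback (S : {set edge G}) : bool :=
  [forall A in dicycles, ~~ [disjoint A & S]].

(* The default value #|edge G| is attained: the set of all edges is feedback. *)
Definition beta : nat :=
  \big[minn/#|edge G|]_(S : {set edge G} | feedback S) #|S|.

(* A drawing in the plane: vertices are distinct points, an edge is a
   continuous arc joining its end points (a closed curve for a loop), and an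
   interior point of an arc lies on that arc only once, on no other arc, and is
   not a vertex. *)
Definition planar (R : realType) : Prop :=
  exists (pos : vertex G -> R * R) (arc : edge G -> R -> R * R),
    [/\ injective pos,
        forall e, [/\ {within `[0, 1], continuous (arc e)},
                      arc e 0 = pos (src e) & arc e 1 = pos (tgt e)],
        forall e f s t, s \in `[0, 1] -> t \in `]0, 1[ ->
          arc e s = arc f t -> e = f /\ s = t
      & forall e v t, t \in `]0, 1[ -> arc e t <> pos v].

End Cycles.

Section QuotientModule.
Variables (R : pzRingType) (V : lmodType R).

Definition submodule_pred (U : {pred V}) of submod_closed U : {pred V} := U.
HB.instance Definition _ (U : {pred V}) (subU : submod_closed U) :=
  GRing.isSubmodClosed.Build R V (submodule_pred subU) subU.

Variables (U : {pred V}) (subU : submod_closed U).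

Definition quot_mod : Type := Quotient.quot (submodule_pred subU).
HB.instance Definition _ := GRing.Zmodule.on quot_mod.

Definition quot_pi (x : V) : quot_mod :=
  \pi_(Quotient.quot (submodule_pred subU)) x.

Definition quot_repr (x : quot_mod) : V :=
  repr (x : Quotient.quot (submodule_pred subU)).

Lemma quot_piP (x y : V) : quot_pi x = quot_pi y <-> x - y \in U.
Proof.
rewrite /quot_pi; split=> [/eqP|xy].
  by rewrite -(Quotient.idealrBE (submodule_pred subU)).
by apply/eqP; rewrite -(Quotient.idealrBE (submodule_pred subU)).
Qed.

Lemma quot_reprK : cancel quot_repr quot_pi.
Proof. by move=> x; apply: reprK. Qed.

Lemma quot_piD x y : quot_pi (x + y) = quot_pi x + quot_pi y.
Proof. exact: Quotient.pi_add. Qed.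

Lemma quot_pi0 : quot_pi 0 = 0.
Proof. by apply: (addrI (quot_pi 0)); rewrite -quot_piD !addr0. Qed.

Definition quot_scale (a : R) (x : quot_mod) : quot_mod :=
  quot_pi (a *: quot_repr x).

Lemma quot_scale_pi a x : quot_scale a (quot_pi x) = quot_pi (a *: x).
Proof.
apply/quot_piP; rewrite -scalerBr.
by apply: (rpredZ (s := submodule_pred subU)); apply/quot_piP/quot_reprK.
Qed.

Lemma quot_scaleA a b x : quot_scale a (quot_scale b x) = quot_scale (a * b) x.
Proof. by rewrite -[x]quot_reprK !quot_scale_pi scalerA. Qed.

Lemma quot_scale1 : left_id 1 quot_scale.
Proof. by move=> x; rewrite -[x]quot_reprK quot_scale_pi scale1r. Qed.

Lemma quot_scaleDr : right_distributive quot_scale +%R.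
Proof.
move=> a x y; rewrite -[x]quot_reprK -[y]quot_reprK.
by rewrite -quot_piD !quot_scale_pi scalerDr quot_piD.
Qed.

Lemma quot_scaleDl x : {morph quot_scale^~ x : a b / a + b}.
Proof.
by move=> a b; rewrite -[x]quot_reprK !quot_scale_pi scalerDl quot_piD.
Qed.

HB.instance Definition _ := GRing.Zmodule_isLmodule.Build R quot_mod
  quot_scaleA quot_scale1 quot_scaleDr quot_scaleDl.

End QuotientModule.

Section Homology.
Variables (R : pzRingType) (M N L : lmodType R).
Variables (f : {linear M -> N}) (g : {linear N -> L}).

Definition ker_pred : {pred N} := fun x => g x == 0.

Lemma ker_submod : submod_closed ker_pred.
Proof.
split; first by rewrite unfold_in /ker_pred linear0.
move=> a x y; rewrite !unfold_in /ker_pred => /eqP gx /eqP gy.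
by rewrite linearP gx gy scaler0 addr0.
Qed.

Record ker := Ker { ker_val :> N; _ : ker_val \in ker_pred }.
HB.instance Definition _ := [isSub for ker_val].
HB.instance Definition _ := [Choice of ker by <:].
HB.instance Definition _ :=
  GRing.SubChoice_isSubLmodule.Build R N ker_pred ker ker_submod.

Definition im_pred : {pred ker} := fun x => `[< exists y, f y = val x >].

Lemma im_submod : submod_closed im_pred.
Proof.
split; first by apply/asboolP; exists 0; rewrite !linear0.
move=> a x y /asboolP[x' fx] /asboolP[y' fy]; apply/asboolP.
by exists (a *: x' + y'); rewrite !linearP fx fy.
Qed.

(* The subquotient ker g / im f of N *)
Definition homology_at : lmodType R := quot_mod im_submod.

End Homology.

Section Annihilator.
Variables (R : comPzRingType) (M : lmodType R).

Definition ann : {pred R^o} := fun r => `[< forall m : M, r *: m = 0 >].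

Lemma ann_submod : submod_closed ann.
Proof.
split; first by apply/asboolP => m; rewrite scale0r.
move=> a x y /asboolP xM /asboolP yM; apply/asboolP => m.
by rewrite scalerDl -scalerA xM yM scaler0 addr0.
Qed.

Definition ann_quot : Type := quot_mod ann_submod.
HB.instance Definition _ := GRing.Zmodule.on ann_quot.

Definition ann_pi (r : R) : ann_quot := quot_pi ann_submod r.
Definition ann_repr (x : ann_quot) : R := quot_repr x.
Definition ann_mul (x y : ann_quot) : ann_quot :=
  ann_pi (ann_repr x * ann_repr y).

Lemma ann_reprK : cancel ann_repr ann_pi.
Proof. exact: quot_reprK. Qed.

Lemma ann_piD x y : ann_pi (x + y) = ann_pi x + ann_pi y.
Proof. exact: quot_piD. Qed.

Lemma ann_mul_pi x y : ann_mul (ann_pi x) (ann_pi y) = ann_pi (x * y).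
Proof.
have annP z : ann_repr (ann_pi z) - z \in ann.
  by apply/(quot_piP ann_submod); apply: ann_reprK.
apply/quot_piP; set x' := ann_repr _; set y' := ann_repr _.
have -> : x' * y' - x * y = y' * (x' - x) + x * (y' - y).
  by rewrite !mulrBr [y' * x']mulrC [y' * x]mulrC addrA subrK.
by apply: (rpredD (S := submodule_pred ann_submod));
  apply: (rpredZ (s := submodule_pred ann_submod)); apply: annP.
Qed.

Lemma ann_mulA : associative ann_mul.
Proof.
move=> x y z; rewrite -[x]ann_reprK -[y]ann_reprK -[z]ann_reprK.
by rewrite !ann_mul_pi mulrA.
Qed.

Lemma ann_mulC : commutative ann_mul.
Proof. by move=> x y; rewrite /ann_mul mulrC. Qed.

Lemma ann_mul1 : left_id (ann_pi 1) ann_mul.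
Proof. by move=> x; rewrite -[x]ann_reprK ann_mul_pi mul1r. Qed.

Lemma ann_mulD : left_distributive ann_mul +%R.
Proof.
move=> x y z; rewrite -[x]ann_reprK -[y]ann_reprK -[z]ann_reprK.
by rewrite -ann_piD !ann_mul_pi mulrDl ann_piD.
Qed.

HB.instance Definition _ := GRing.Zmodule_isComPzRing.Build ann_quot
  ann_mulA ann_mulC ann_mul1 ann_mulD.

End Annihilator.

Definition prime_ideal (A : comPzRingType) (P : set A) : Prop :=
  [/\ P 0, forall x y, P x -> P y -> P (x + y), forall a x, P x -> P (a * x),
      ~ P 1 & forall x y, P (x * y) -> P x \/ P y].

(* p 0, ..., p n is a strictly increasing chain of prime ideals *)
Definition prime_chain (A : comPzRingType) (n : nat) (p : nat -> set A) : Prop :=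
  (forall i, (i <= n)%N -> prime_ideal (p i)) /\
  (forall i, (i < n)%N -> p i `<` p i.+1).

(* Valued in the extended reals: -oo for the zero ring, possibly +oo. *)
Definition krull_dim (T : realType) (A : comPzRingType) : \bar T :=
  ereal_sup [set (n%:R)%:E | n in [set n | exists p, @prime_chain A n p]].

Definition Kdim (T : realType) (R : comPzRingType) (M : lmodType R) : \bar T :=
  krull_dim T (ann_quot M).

(* A bounded complex of free modules with a finite homogeneous basis:
   [diff a b] is the coefficient of [b] in the differential of [a]. Only the
   homological grading is recorded. *)

Record complex (R : comNzRingType) := Complex {
  basis : finType;
  hdeg : basis -> int;
  diff : basis -> basis -> R;
  diff_deg : forall a b, diff a b != 0 -> hdeg a = hdeg b + 1;
  diff_diff : forall a c, \sum_b diff a b * diff b c = 0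
}.

Section Complexes.
Variable R : comNzRingType.
Implicit Types C D : complex R.

Section Chains.
Variable C : complex R.

Definition chain (P : pred int) : lmodType R :=
  {ffun {b : basis C | P (hdeg b)} -> R^o}.

(* [chain P] is the sum of the chain modules of degrees in P; [boundary P Q] is
   the component of the differential from [chain P] to [chain Q]. *)
Definition boundary (P Q : pred int) (x : chain P) : chain Q :=
  [ffun b => \sum_a x a * diff (val a) (val b)].

Lemma boundary_is_linear P Q : linear (@boundary P Q).
Proof.
move=> k x y; apply/ffunP=> b; rewrite !ffunE scaler_sumr -big_split /=.
by apply: eq_bigr => a _; rewrite !ffunE mulrDl -scalerAl.
Qed.
HB.instance Definition _ P Q := GRing.isLinear.Build R (chain P) (chain Q) _
  (@boundary P Q) (@boundary_is_linear P Q).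

Definition homology (i : int) : lmodType R :=
  homology_at (@boundary (pred1 (i + 1)) (pred1 i))
              (@boundary (pred1 i) (pred1 (i - 1))).

(* The differential is homogeneous, so the homology of the sum of all the chain
   modules is the direct sum of the [homology i]. *)
Definition total_homology : lmodType R :=
  homology_at (@boundary predT predT) (@boundary predT predT).

End Chains.

Definition unit_diff (a b : unit) : R := 0.
Lemma unit_diff_deg a b : unit_diff a b != 0 -> 0 = 0 + 1 :> int.
Proof. by rewrite eqxx. Qed.
Lemma unit_diff_diff a c : \sum_b unit_diff a b * unit_diff b c = 0.
Proof. by rewrite big1 // => b _; rewrite mul0r. Qed.

Definition unit_complex : complex R :=
  Complex unit_diff_deg unit_diff_diff.

Definition arrow_diff (r : R) (a b : bool) : R := if a && ~~ b then r else 0.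
Lemma arrow_diff_deg r a b :
  arrow_diff r a b != 0 -> (a : nat)%:Z = (b : nat)%:Z + 1.
Proof. by case: a b => [] []; rewrite /arrow_diff ?eqxx. Qed.
Lemma arrow_diff_diff r a c :
  \sum_b arrow_diff r a b * arrow_diff r b c = 0.
Proof.
rewrite big1 // => b _; rewrite /arrow_diff.
by case: a b c => [] [] []; rewrite /= ?(mulr0, mul0r).
Qed.

(* 0 -> R --r--> R -> 0 in degrees 1 (basis [true]) and 0 (basis [false]) *)
Definition arrow_complex (r : R) : complex R :=
  Complex (@arrow_diff_deg r) (@arrow_diff_diff r).

Section Tensor.
Variables C D : complex R.

Definition tensor_deg (a : basis C * basis D) : int := hdeg a.1 + hdeg a.2.

(* d (x (x) y) = d x (x) y + (-1)^(deg x) x (x) d y *)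
Definition tensor_diff (a b : basis C * basis D) : R :=
  diff a.1 b.1 * (a.2 == b.2)%:R
  + (-1) ^+ `|hdeg a.1|%N * (a.1 == b.1)%:R * diff a.2 b.2.

Lemma diff_deg0 (E : complex R) (a b : basis E) :
  hdeg a <> hdeg b + 1 -> diff a b = 0.
Proof. by move=> h; apply/eqP; apply/negPn/negP => /diff_deg. Qed.

Lemma tensor_diff_deg a b :
  tensor_diff a b != 0 -> tensor_deg a = tensor_deg b + 1.
Proof.
case: a b => [a1 a2] [b1 b2]; rewrite /tensor_diff /tensor_deg /= => h.
apply: contrapT => ab; move: h; apply/negP/negPn/eqP.
case: (eqVneq a2 b2) => [eq2|_]; last rewrite mulr0 add0r.
  rewrite (@diff_deg0 _ a1) ?mul0r ?add0r => [|e]; last first.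
    by apply: ab; rewrite e eq2 addrAC.
  case: (eqVneq a1 b1) => [eq1|_]; last by rewrite mulr0 mul0r.
  by rewrite diff_deg0 ?mulr0 // => e; apply: ab; rewrite e eq1 addrA.
case: (eqVneq a1 b1) => [eq1|_]; last by rewrite mulr0 mul0r.
by rewrite diff_deg0 ?mulr0 // => e; apply: ab; rewrite e eq1 addrA.
Qed.

Lemma sign_diff (a b : basis C) :
  (-1) ^+ `|hdeg b|%N * diff a b = - ((-1) ^+ `|hdeg a|%N * diff a b) :> R.
Proof.
have [->|/diff_deg ->] := eqVneq (diff a b) 0; first by rewrite !mulr0 oppr0.
rewrite -mulNr; congr (_ * _); case: (hdeg b) => n.
  by rewrite -PoszD absz_nat addn1 exprS mulN1r opprK.
have -> : Negz n + 1 = - n%:Z by rewrite NegzE -addn1 PoszD opprD subrK.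
by rewrite abszN /= exprS mulN1r.
Qed.

Lemma sum_diff1 (I : finType) (F : I -> R) i :
  \sum_j F j * (j == i)%:R = F i.
Proof.
rewrite (bigD1 i) //= eqxx mulr1 big1 ?addr0 // => j /negPf ->.
by rewrite mulr0.
Qed.

Lemma tensor_diff_diff a c : \sum_b tensor_diff a b * tensor_diff b c = 0.
Proof.
case: a c => [a1 a2] [c1 c2].
rewrite -(pair_bigA _ (fun b1 b2 =>
  tensor_diff (a1, a2) (b1, b2) * tensor_diff (b1, b2) (c1, c2))) /=.
rewrite /tensor_diff /=.
pose s (x : basis C) : R := (-1) ^+ `|hdeg x|%N.
transitivity (\sum_b1 \sum_b2
  (diff a1 b1 * diff b1 c1 * ((b2 == c2)%:R * (b2 == a2)%:R)
   + s b1 * diff a1 b1 * diff b2 c2 * (b2 == a2)%:R * (b1 == c1)%:R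
   + s a1 * diff b1 c1 * diff a2 b2 * (b2 == c2)%:R * (b1 == a1)%:R
   + s a1 * s b1 * (b1 == a1)%:R * (b1 == c1)%:R
     * (diff a2 b2 * diff b2 c2))).
  apply: eq_bigr => b1 _; apply: eq_bigr => b2 _.
  by rewrite -!/(s _) [a1 == b1]eq_sym [a2 == b2]eq_sym; ring.
under eq_bigr do rewrite !big_split /=.
rewrite !big_split /=.
rewrite exchange_big big1 /= => [|b2 _]; last first.
  by rewrite -mulr_suml diff_diff mul0r.
rewrite add0r [X in _ + X = _]big1 => [|b1 _]; last first.
  by rewrite -mulr_sumr diff_diff mulr0.
rewrite addr0.
under eq_bigr do rewrite -mulr_suml sum_diff1.
under [X in _ + X = _]eq_bigr do rewrite -mulr_suml sum_diff1.
by rewrite !sum_diff1 (sign_diff a1 c1) mulNr addNr.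
Qed.

Definition tensor : complex R := Complex tensor_diff_deg tensor_diff_diff.

End Tensor.

Definition koszul (s : seq R) : complex R :=
  foldr (fun r C => tensor (arrow_complex r) C) unit_complex s.

End Complexes.

Section BaseChange.
Variables (R S : comNzRingType) (f : {rmorphism R -> S}) (C : complex R).

Let diffS (a b : basis C) : S := f (diff a b).

Lemma base_change_deg a b : diffS a b != 0 -> hdeg a = hdeg b + 1.
Proof.
move=> h; apply: diff_deg; apply: contraNneq h => e.
by rewrite /diffS e rmorph0.
Qed.

Lemma base_change_diff a c : \sum_b diffS a b * diffS b c = 0.
Proof.
rewrite -[RHS](rmorph0 f) -(diff_diff a c) rmorph_sum /=.
by apply: eq_bigr => b _; rewrite rmorphM.
Qed.

Definition base_change : complex S := Complex base_change_deg base_change_diff.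

End BaseChange.

Section KhovanovRozansky.
Variable G : digraph.

Definition polyring (k : comNzRingType) : comNzRingType :=
  {mpoly k[#|edge G|]}.

Definition var (k : comNzRingType) (x : edge G) : polyring k :=
  'X_(enum_rank x).

Definition esym (S : {set edge G}) (l : nat) : polyring int :=
  \sum_(A : {set edge G} | (A \subset S) && (#|A| == l))
    \prod_(x in A) var int x.

Definition out_edges (v : vertex G) : {set edge G} :=
  [set x | src x == v]%SET.
Definition in_edges (v : vertex G) : {set edge G} :=
  [set x | tgt x == v]%SET.

Definition delta (v : vertex G) (l : nat) : polyring int :=
  esym (out_edges v) l - esym (in_edges v) l.

Definition Delta : seq (polyring int) :=
  [seq delta v l | v <- enum (vertex G),
                   l <- iota 1 (maxn #|out_edges v| #|in_edges v|)].

Definition in_ideal (A : comNzRingType) (s : seq A) (r : A) : Prop :=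
  exists c : 'I_(size s) -> A, r = \sum_i c i * s`_i.

Definition I_of (r : polyring int) : Prop := in_ideal Delta r.

Definition KR : complex (polyring int) := koszul Delta.

(* Q (x)_Z Z[E(G)] is Q[E(G)]. *)
Definition KRQ : complex (polyring rat) :=
  base_change (map_mpoly (intr : int -> rat) :
    {rmorphism polyring int -> polyring rat}) KR.

End KhovanovRozansky.

Definition fg_Zmodule (M : zmodType) : Prop :=
  exists s : seq M, forall x, exists c : 'I_(size s) -> int,
    x = \sum_(i < size s) s`_i *~ c i.

(* Main.v *)
Require Import Defs.
From HB Require Import structures.
From mathcomp Require Import all_boot all_order all_algebra.
From mathcomp Require Import mpoly ring lra zify boolp.
From mathcomp Require functions topology normedtype derive.

(* A prime P containing I(G) forces, at every vertex, the multisets of nonzero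
   residues of the outgoing and of the incoming edges to agree, so the edges of
   a given nonzero residue form a balanced subgraph and hence contain a directed
   cycle: there are at most alpha(G) nonzero residues.  The quotient by P is
   therefore generated by at most alpha(G) elements, and lexicographically
   minimal monomials of an algebraic dependence bound the chains of primes above
   P.  Disjoint cycles conversely give a surjection onto a polynomial ring in
   alpha(G) variables.  Hence the two dimensions are alpha(G) over Q and
   alpha(G) + 1 over Z.

   Elements of I(G) act on the Koszul complex by null-homotopic maps.  If all
   the x^n are in I(G), then, these being a regular sequence, a cycle with
   coefficients in the ideal they generate is a boundary, and the homology is
   determined by the finitely many coefficients of low degree.

   For planar graphs alpha = beta is the Lucchesi-Younger theorem for the dual
   digraph.  Only an algebraic dual is needed, whose potential differences are
   the circulations of G.  Such duals pass to minors; a grid on a torus has one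
   for the circulations supported away from a meridian and a parallel; and a
   sufficiently fine discretization of a plane drawing exhibits G, without its
   loops, as a minor of such a grid. *)

(** Only nonzero residues can be compared because a vertex may have different in- and out-degrees:
    brought to a common degree by a power of ['X], the characteristic polynomials of its two lists
    of edges may differ in the multiplicity of the root 0.

    Over [int] a chain of primes can also climb by a prime number [p]. Then [p] is taken as the
    witness of that step, and the powers of [p] in the coefficients of the dependence count as
    powers of this witness. This is the extra 1 in [alpha G + 1]. Over [rat] a chain is contracted
    to integral polynomials, where its members contain no nonzero integer.

    The faces of a plane graph arise algebraically. The dual vertices of the torus are its unit
    cells. Deleting a grid edge identifies the two cells beside it, and contracting one drops its
    dual edge, so faces appear as classes of cells. On the torus all incidence formulas are uniform,
    at the price of two periods; these vanish for circulations that avoid row 0 and column 0, from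
    which the discretized drawing is kept away. *)

Set Implicit Arguments.
Unset Strict Implicit.
Unset Printing Implicit Defensive.

Import Order.TTheory GRing.Theory Num.Theory.

(** * The Lucchesi-Younger theorem *)

Section LucchesiYounger.
Variables (E F : finType) (l r : E -> F).
Implicit Types (U V : {set F}) (w : E -> nat) (s : seq {set F}).

Definition outcut U : {set E} := [set e | (l e \in U) && (r e \notin U)].

Definition out_closed U := [forall e, (r e \in U) ==> (l e \in U)].

Definition dicut U := out_closed U && (outcut U != set0).

Definition cover s e := count (fun U => e \in outcut U) s.

(** [w] is a capacity: with the indicator of a set this is a disjoint packing inside the set, and
    capacity 2 on an edge amounts to doubling it. *)
Definition packs w m :=
  exists s, [/\ all dicut s, size s = m & forall e, cover s e <= w e].

(** In the last two cases uncrossing would produce a set that is no dicut, so such a pair has to be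
    left alone. *)
Definition crossfree U V :=
  [|| U \subset V, V \subset U, outcut (U :&: V) == set0
    | outcut (U :|: V) == set0].

Lemma out_closedP U e : out_closed U -> r e \in U -> l e \in U.
Proof. by move=> /forallP/(_ e)/implyP. Qed.

Lemma out_closedI U V : out_closed U -> out_closed V -> out_closed (U :&: V).
Proof.
move=> cU cV; apply/forallP => e; apply/implyP; rewrite !inE.
by move=> /andP[/(out_closedP cU)-> /(out_closedP cV)->].
Qed.

Lemma out_closedU U V : out_closed U -> out_closed V -> out_closed (U :|: V).
Proof.
move=> cU cV; apply/forallP => e; apply/implyP; rewrite !inE.
by move=> /orP[/(out_closedP cU)->|/(out_closedP cV)->]; rewrite ?orbT.
Qed.

Lemma outcutIU U V e : out_closed U -> out_closed V ->
  (e \in outcut (U :&: V)) + (e \in outcut (U :|: V))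
  = (e \in outcut U) + (e \in outcut V).
Proof.
move=> cU cV; rewrite !inE.
have /implyP := @out_closedP _ e cU; have /implyP := @out_closedP _ e cV.
by case: (r e \in U); case: (l e \in U); case: (r e \in V); case: (l e \in V).
Qed.

Lemma card_sqIU U V : ~~ (U \subset V) -> ~~ (V \subset U) ->
  #|U| ^ 2 + #|V| ^ 2 < #|U :&: V| ^ 2 + #|U :|: V| ^ 2.
Proof.
move=> UV VU; have := cardsUI U V.
have : #|U :&: V| < #|U|.
  by rewrite proper_card // properEneq subsetIl andbT; apply: contraNneq UV => /setIidPl.
have : #|U :&: V| < #|V|.
  by rewrite proper_card // properEneq subsetIr andbT; apply: contraNneq VU => /setIidPr.
rewrite /= -!mulnn; move: #|_ :&: _| #|_ :|: _| #|U| #|V| => a d b c ac ab dE.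
have dbc : d = b + c - a by lia.
by rewrite dbc; nia.
Qed.

Lemma perm_two s U V : U \in s -> V \in s -> U != V ->
  exists s0, perm_eq s [:: U, V & s0].
Proof.
move=> sU sV UV; exists (rem V (rem U s)).
rewrite (perm_trans (perm_to_rem sU)) // perm_cons perm_to_rem //.
by have := perm_mem (perm_to_rem sU) V; rewrite sV inE eq_sym (negPf UV).
Qed.

(** A crossing pair is replaced by its intersection and union, which by [outcutIU] cover every edge
    equally often. The sum of the squared cardinalities grows at each replacement and is at most
    [size s * #|F| ^ 2]. *)
Lemma uncross s : all dicut s -> exists s',
  [/\ all dicut s', size s' = size s, forall e, cover s' e = cover s e
    & {in s' &, forall U V, crossfree U V}].
Proof.
have [n] := ubnP (size s * #|F| ^ 2 - \sum_(U <- s) #|U| ^ 2).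
elim: n s => // n IHn s sn sD.
have [/allrelP cf|/allPn[U sU /allPn[V sV]]] := boolP (allrel crossfree s s).
  by exists s; split.
rewrite !negb_or => /and4P[UV VU cap cup].
have [|s0 ps] := perm_two sU sV; first by apply: contraNneq UV => ->.
have sz : size s = (size s0).+2 by rewrite (perm_size ps).
move: sD; rewrite (perm_all _ ps) /= => /and3P[/andP[cU _] /andP[cV _] s0D].
case: (IHn [:: U :&: V, U :|: V & s0]) => [||s' [D' sz' cov' cf']].
- have : \sum_(W <- [:: U :&: V, U :|: V & s0]) #|W| ^ 2 <= size s * #|F| ^ 2.
    rewrite sz -[(size s0).+2]/(size [:: U :&: V, U :|: V & s0]) -sum1_size big_distrl /=.
    by apply: leq_sum => W _; rewrite mul1n leq_exp2r ?max_card.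
  have := card_sqIU UV VU; move: sn; rewrite (perm_big _ ps) /= sz !big_cons; lia.
- by rewrite /= /dicut out_closedI // out_closedU // cap cup.
exists s'; split => //; first by rewrite sz' sz.
move=> e; rewrite cov' /cover (permP ps) /= !addnA; congr (_ + _).
exact: outcutIU.
Qed.

Lemma count_odd_iota c p : count (fun k => odd (c + k)) (iota 1 p) <= uphalf p.
Proof.
elim/ltn_ind: p => -[|[|p]] IH //=; first by case: (odd _).
rewrite (iotaDl 2 1 p) count_map.
rewrite (@eq_count _ _ (fun k => odd (c + k))) => [|k /=]; last first.
  by rewrite !oddD.
by have := IH p (ltnW (ltnSn _)); rewrite !oddD; case: (odd c) => /=; lia.
Qed.

(** Here [f] numbers the elements of [S] from 1 to [#|S|], and parities alternate along such a
    numbering. *)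
Lemma count_odd_inj (I : finType) (S : {set I}) (f : I -> nat) c :
  {in S &, injective f} -> (forall i, i \in S -> 0 < f i <= #|S|) ->
  #|[set i in S | odd (c + f i)]| <= uphalf #|S|.
Proof.
move=> finj fS.
have fp : perm_eq (map f (enum S)) (iota 1 #|S|).
  apply: uniq_perm; last 1 first.
  - have us : uniq (map f (enum S)).
      by rewrite map_inj_in_uniq ?enum_uniq // => x y; rewrite !mem_enum; apply: finj.
    have sub : {subset map f (enum S) <= iota 1 #|S|}.
      by move=> k /mapP[i]; rewrite mem_enum mem_iota => /fS + ->; rewrite add1n ltnS.
    by have [] := uniq_min_size us sub; first by rewrite size_map size_iota cardE.
  - by rewrite map_inj_in_uniq ?enum_uniq // => x y; rewrite !mem_enum; apply: finj.
  - exact: iota_uniq.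
apply: leq_trans (count_odd_iota c _); rewrite -(permP fp) count_map.
rewrite cardE -size_filter; apply: uniq_leq_size (enum_uniq _) _ => i.
by rewrite mem_enum inE mem_filter mem_enum andbC.
Qed.

Lemma count_enum (I : finType) (P : pred I) :
  count P (enum I) = #|[set i | P i]|.
Proof. by rewrite -sum1_count big_enum_cond /= -sum1dep_card. Qed.

(* After uncrossing, the cuts through an edge form a chain, along which the
   level [lev] increases in steps of one: its parity splits every such chain
   evenly. *)
Lemma halving w s : all dicut s -> (forall e, cover s e <= (w e).*2) ->
  exists s', [/\ all dicut s', forall e, cover s' e <= w e & size s <= (size s').*2].
Proof.
move=> /uncross[s0 [D0 <- cov0 cf0]] cov; pose N := size s0.
pose U (i : 'I_N) := nth set0 s0 i.
have sU i : U i \in s0 by apply: mem_nth.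
have cU i : out_closed (U i) by have /andP[] := allP D0 _ (sU i).
(* Equal cuts are ordered by position, so that the cuts through an edge are linearly ordered even
   when a cut is repeated. *)
pose above (i j : 'I_N) := (U i \proper U j) || ((U i == U j) && (i <= j)).
pose lev i := #|[set j | above i j || (outcut (U i :|: U j) == set0)]|.
pose S e := [set i | e \in outcut (U i)].
have coverS e : cover s0 e = #|S e|.
  rewrite /cover -{1}[s0](mkseq_nth set0) count_map -val_enum_ord count_map.
  exact: count_enum.
pose rank e i := #|[set j in S e | above i j]|.
have abvT e : {in S e &, forall i j, i != j -> above i j || above j i}.
  move=> i j; rewrite !inE => /andP[li ri] /andP[lj rj] ij; rewrite /above.
  have := cf0 _ _ (sU i) (sU j); rewrite /crossfree !properEneq (eq_sym (U j)).
  have -> : (outcut (U i :&: U j) == set0) = false.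
    by apply/negbTE/set0Pn; exists e; rewrite !inE li lj (negPf ri).
  have -> : (outcut (U i :|: U j) == set0) = false.
    by apply/negbTE/set0Pn; exists e; rewrite !inE li (negPf ri).
  by case: eqVneq => [eU _|_] /=; [rewrite leq_total|case: (_ \subset _); case: (_ \subset _)].
have abv_trans i j k : above i j -> above j k -> above i k.
  rewrite /above => /orP[pij|/andP[/eqP eij lij]] /orP[pjk|/andP[/eqP ejk ljk]].
  - by rewrite (proper_trans pij pjk).
  - by rewrite -ejk pij.
  - by rewrite eij pjk.
  - by rewrite eij ejk eqxx (leq_trans lij ljk) orbT.
have abv_anti i j : above i j -> above j i -> i = j.
  rewrite /above => /orP[pij|/andP[/eqP eij lij]] /orP[pjk|/andP[/eqP ejk ljk]].
  - by have := proper_trans pij pjk; rewrite properxx.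
  - by move: pij; rewrite ejk properxx.
  - by move: pjk; rewrite eij properxx.
  - by apply/val_inj/eqP; rewrite eqn_leq lij ljk.
have abvxx i : above i i by rewrite /above eqxx leqnn orbT.
have rank_lt e i j : i \in S e -> i != j -> above i j -> rank e j < rank e i.
  move=> Si ij aij; apply: proper_card; apply/properP; split.
    by apply/subsetP => k; rewrite !inE => /andP[-> /(abv_trans _ _ _ aij)->].
  exists i; first by rewrite inE Si abvxx.
  by rewrite inE Si /=; apply: contraNN ij => /(abv_anti _ _ aij)->.
(* The first summand is the same for all cuts through [e], and the rank runs from 1 to [#|S e|]
   along them. Crossfreeness makes the level, which is defined without reference to [e], agree with
   this sum. *)
have levE e i : i \in S e -> lev i = #|[set j | r e \in U j]| + rank e i.
  rewrite inE inE => /andP[li ri]; rewrite /lev /rank -cardsUI.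
  rewrite [X in _ + X](_ : _ = 0) ?addn0; last first.
    by apply/eqP; rewrite cards_eq0; apply/eqP/setP => j; rewrite !inE; case: (r e \in U j); rewrite ?andbF.
  apply: eq_card => j; rewrite !inE.
  have [rj|rj] := boolP (r e \in U j).
    have lj := out_closedP (cU j) rj.
    have := cf0 _ _ (sU i) (sU j); rewrite /crossfree /above properEneq.
    have -> : (U j \subset U i) = false.
      by apply/negbTE; apply: contraNN ri => /subsetP->.
    have -> : (outcut (U i :&: U j) == set0) = false.
      by apply/negbTE/set0Pn; exists e; rewrite !inE li lj (negPf ri).
    have -> : U i != U j by apply: contraNneq ri => ->.
    by case: (_ \subset _) => //= ->; rewrite orbT.
  have -> : (outcut (U i :|: U j) == set0) = false.
    by apply/negbTE/set0Pn; exists e; rewrite !inE li (negPf ri) (negPf rj).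
  rewrite orbF andbT /above; case: (boolP (U i \subset U j)) => [/subsetP/(_ _ li)->//|nij].
  rewrite properE (negPf nij) /=; case: eqVneq nij => [->|_ _]; last by rewrite andbF.
  by rewrite subxx.
have lev_half e b : #|[set i in S e | odd (b + lev i)]| <= uphalf #|S e|.
  rewrite (_ : [set i in S e | _] =
      [set i in S e | odd (b + #|[set j | r e \in U j]| + rank e i)]); last first.
    by apply/setP => i; rewrite in_set [RHS]in_set; case ei: (i \in S e) => //=; rewrite (levE e i ei) addnA.
  apply: count_odd_inj => [i j Si Sj|i Si].
    apply: contra_eq => ij; have /orP[a|a] := abvT _ _ _ Si Sj ij.
      by rewrite gtn_eqF // (rank_lt e).
    by rewrite ltn_eqF // (rank_lt e) // eq_sym.
  apply/andP; split; first by apply/card_gt0P; exists i; rewrite inE Si abvxx.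
  by apply: subset_leq_card; apply/subsetP => j; rewrite inE => /andP[].
(* Each parity class covers [e] at most [uphalf #|S e|] times, which is at most [w e]. The larger
   class has at least half of the cuts. *)
pose part b := [seq U i | i <- enum 'I_N & odd (b + lev i)].
have part_dicut b : all dicut (part b).
  by apply/allP => _ /mapP[i _ ->]; apply: (allP D0).
have part_cover b e : cover (part b) e <= w e.
  apply: (@leq_trans (uphalf #|S e|)).
    apply: leq_trans (lev_half e b); rewrite /cover count_map count_filter count_enum.
    by apply: subset_leq_card; apply/subsetP => i; rewrite !inE.
  have := cov e; rewrite -cov0 coverS; lia.
have : size (part 0) + size (part 1) = N.
  have := count_predC (fun i => odd (lev i)) (enum 'I_N); rewrite size_enum_ord => <-.
  by rewrite !size_map !size_filter; apply/f_equal2/eq_count.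
case: (leqP N (size (part 0)).*2) => h sz.
  by exists (part 0); split => //; apply: part_cover.
by exists (part 1); split => //; rewrite -/N; lia.
Qed.

Lemma packs_le w m m' : m' <= m -> packs w m -> packs w m'.
Proof.
move=> mm [s [sD sz cov]]; exists (take m' s); split.
- by apply/allP => U /mem_take; apply: (allP sD).
- by rewrite size_takel // sz.
- move=> e; apply: leq_trans (cov e).
  by rewrite -{2}[s](cat_take_drop m') /cover count_cat leq_addr.
Qed.

(* Lovasz: doubling one edge [v] at a time, if a packing of [m + 1] cuts appeared
   then halving its union with a packing of [m] cuts avoiding [v] would give a
   packing of [m + 1] cuts before the doubling of [v]. *)
Lemma packs_double (S A : {set E}) m : packs (fun e => e \in S) m ->
  {in S, forall v, packs (fun e => e \in S :\ v) m} -> A \subset S ->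
  packs (fun e => (e \in S) + (e \in A)) m.+1 -> packs (fun e => e \in S) m.+1.
Proof.
move=> pS pv; have [n] := ubnP #|A|; elim: n A => // n IHn A An AS pA.
have [A0|[v vA]] := set_0Vmem A.
  case: pA => s [sD sz cov]; exists s; split => // e.
  by have := cov e; rewrite A0 inE addn0.
apply: (IHn (A :\ v)); [by move: An; rewrite (cardsD1 v) vA; lia| exact: subset_trans (subD1set _ _) AS|].
have [s1 [D1 sz1 cov1]] := pA; have vS := subsetP AS v vA.
have [s2 [D2 sz2 cov2]] := pv v vS.
pose w e := (e \in S) + (e \in A :\ v).
(* At [v] the first packing covers at most twice and the second not at all; elsewhere both respect
   [w]. Half of the [2 * m + 1] cuts, rounded up, is [m + 1]. *)
have [||s [sD cov sz]] := @halving w (s1 ++ s2).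
- by rewrite all_cat D1.
- move=> e; rewrite /cover count_cat; have := cov1 e; have := cov2 e.
  rewrite /cover /w !inE; case: eqVneq => [->|_] /=; first by rewrite vS vA; lia.
  by lia.
- exists (take m.+1 s); split.
  + by apply/allP => U /mem_take; apply: (allP sD).
  + by rewrite size_takel //; move: sz; rewrite size_cat sz1 sz2; lia.
  + move=> e; apply: leq_trans (cov e).
    by rewrite -{2}[s](cat_take_drop m.+1) /cover count_cat leq_addr.
Qed.

(** Restricting to cuts inside [S] amounts to contracting the other edges, which permits induction
    on [S]. If removing some [v] lowers the packing number, [v] joins the transversal found for the
    rest. Otherwise doubling all of [S] gives [m.+1 + m.+1] cuts, at least [m.+2], and
    [packs_double] removes the doubling. *)
Theorem lucchesi_younger m (S : {set E}) : ~ packs (fun e => e \in S) m.+1 ->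
  exists2 T : {set E}, #|T| <= m &
    forall U, dicut U -> outcut U \subset S -> ~~ [disjoint outcut U & T].
Proof.
have [n] := ubnP #|S|; elim: n S m => // n IHn S; elim=> [|m IHm] Sn nS.
  exists set0; rewrite ?cards0 // => U dU US; case: nS; exists [:: U].
  split; rewrite ?/= ?dU // => e; rewrite /cover /= addn0.
  by case: (boolP (e \in outcut U)) => // /(subsetP US)->.
have [pS|npS] := pselect (packs (fun e => e \in S) m.+1); last first.
  have [T Tm TU] := IHm Sn npS; exists T => //; exact: leqW.
have [[v vS nv]|pv] := pselect (exists2 v, v \in S & ~ packs (fun e => e \in S :\ v) m.+1).
  have [|T Tm TU] := IHn (S :\ v) m _ nv; first by move: Sn; rewrite (cardsD1 v) vS; lia.
  exists (v |: T) => [|U dU US].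
    by rewrite cardsU1; case: (v \in T) => /=; lia.
  rewrite -setI_eq0; have [vU|vU] := boolP (v \in outcut U).
    by apply/set0Pn; exists v; rewrite in_setI vU in_setU1 eqxx.
  have : ~~ [disjoint outcut U & T] by apply: TU => //; rewrite subsetD1 US.
  rewrite -setI_eq0 => /set0Pn[e /setIP[eU eT]]; apply/set0Pn; exists e.
  by rewrite in_setI eU in_setU1 eT orbT.
case: nS; apply: (@packs_double S S) => //.
  by move=> v vS; apply: contrapT => nv; apply: pv; exists v.
have [s [sD sz cov]] := pS; apply: (@packs_le _ (m.+1 + m.+1)); first by lia.
exists (s ++ s); split; first by rewrite all_cat sD.
  by rewrite size_cat sz.
by move=> e; rewrite /cover count_cat leq_add // cov.
Qed.

End LucchesiYounger.

(** * Directed cycles *)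

Section DirectedCycles.
Variable G : digraph.
Implicit Types (S A : {set edge G}) (p : seq (edge G)).

(** The walk is prolonged inside [S] until a source repeats, at the latest when all vertices are
    used; its final portion from the repeated source is the cycle. *)
Lemma path_dicycle (S : {set edge G}) x p :
  {in S, forall e, exists2 f, f \in S & src f = tgt e} ->
  path (fun e f => tgt e == src f) x p -> uniq (map (@src G) (x :: p)) ->
  {subset x :: p <= S} ->
  exists2 q, dicycle q & {subset q <= S}.
Proof.
move=> succS; have [n] := ubnP (#|vertex G| - size p).
elim: n x p => // n IHn x p pn xp up sp.
have [f fS fsrc] : exists2 f, f \in S & src f = tgt (last x p).
  by apply/succS/sp/mem_last.
have [|nf] := boolP (src f \in map (@src G) (x :: p)).
  move=> /mapP[a ap sfa].
  pose i := index a (x :: p); have dE : drop i (x :: p) = a :: drop i.+1 (x :: p).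
    exact: drop_index.
  exists (drop i (x :: p)); last by move=> e /mem_drop/sp.
  have lE : last a (drop i.+1 (x :: p)) = last x p.
    have := last_cat a (take i (x :: p)) (drop i (x :: p)).
    by rewrite cat_take_drop dE.
  have := drop_sorted i (xp : sorted (fun e f => tgt e == src f) (x :: p)).
  have := drop_uniq i up; rewrite -map_drop /dicycle dE => up' srt.
  by rewrite up' andbT /= rcons_path lE -fsrc sfa eqxx andbT.
have sz : size p < #|vertex G|.
  have := max_card (mem (map (@src G) (x :: p))).
  by rewrite (card_uniqP up) size_map.
apply: (IHn x (rcons p f)).
- by rewrite size_rcons; lia.
- by rewrite rcons_path xp fsrc /=.
- by rewrite -rcons_cons map_rcons rcons_uniq nf.
- by move=> e; rewrite -rcons_cons mem_rcons inE => /predU1P[->|/sp].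
Qed.

Lemma exists_dicycle S : S != finset.set0 ->
  {in S, forall e, exists2 f, f \in S & src f = tgt e} ->
  exists2 p, dicycle p & {subset p <= S}.
Proof.
move=> /finset.set0Pn[x xS] succS; apply: (@path_dicycle S x [::]) => //.
by move=> e; rewrite inE => /eqP->.
Qed.

Lemma dicycle_balanced p v : dicycle p ->
  #|[set e in p] :&: out_edges v|%SET = #|[set e in p] :&: in_edges v|%SET.
Proof.
case/and3P => _ cyc up.
have up' : uniq p := map_uniq up.
have card_count (P : pred (edge G)) : #|[set e in p] :&: [set e | P e]|%SET = count P p.
  rewrite -size_filter -(card_uniqP _) ?filter_uniq //; apply: eq_card => e.
  by rewrite !inE mem_filter andbC.
rewrite !card_count.
(* On a closed walk each target is the source of the next edge. *)
have tsE : map (@tgt G) p = rot 1 (map (@src G) p).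
  case: p cyc {up up' card_count} => // a p /=.
  rewrite rot1_cons; elim: p a {1 3}a => [|b p IHp] a c /=; first by rewrite andbT => /eqP->.
  by case/andP => /eqP-> /IHp ->.
have /permP/(_ (pred1 v)) : perm_eq (rot 1 (map (@src G) p)) (map (@src G) p) by rewrite perm_rot.
by rewrite -tsE !count_map => ->.
Qed.

Lemma mem_dicycles p : dicycle p -> [set e in p]%SET \in dicycles G.
Proof. by move=> cp; rewrite inE; apply/asboolP; exists p. Qed.

Lemma dicyclesP A : reflect (exists2 p, dicycle p & A = [set e in p]%SET) (A \in dicycles G).
Proof. by rewrite inE; apply: asboolP. Qed.

Lemma dicycle_neq0 A : A \in dicycles G -> A != finset.set0.
Proof.
move=> /dicyclesP[[|x p] //= _ ->]; apply/finset.set0Pn; exists x.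
by rewrite !inE eqxx.
Qed.

Definition balanced S := forall v, #|S :&: out_edges v|%SET = #|S :&: in_edges v|%SET.

Lemma balanced_dicycle S : balanced S -> S != finset.set0 ->
  exists2 A, A \in dicycles G & A \subset S.
Proof.
move=> bS S0; have [|p cp pS] := exists_dicycle S0.
  move=> e eS; have /card_gt0P[f] : 0 < #|S :&: out_edges (tgt e)|%SET.
    by rewrite bS; apply/card_gt0P; exists e; rewrite !inE eS eqxx.
  by rewrite !inE => /andP[fS /eqP fe]; exists f.
exists [set e in p]%SET; first exact: mem_dicycles.
by apply/fintype.subsetP => e; rewrite inE => /pS.
Qed.

Lemma card_le_alpha (I : finType) (B : I -> {set edge G}) :
  (forall i, exists2 A, A \in dicycles G & A \subset B i) ->
  (forall i j, i != j -> [disjoint B i & B j]) -> #|I| <= alpha G.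
Proof.
move=> cB dB; have [A AP] := choice (fun i => let: ex_intro2 A Ac AB := cB i in
  ex_intro (fun A => A \in dicycles G /\ A \subset B i) A (conj Ac AB)).
have Adisj i j : i != j -> [disjoint A i & A j].
  move=> ij; have [_ Ai] := AP i; have [_ Aj] := AP j.
  by apply: disjointWl Ai _; apply: disjointWr Aj _; apply: dB.
have Ainj : injective A.
  move=> i j Aij; apply: contrapT => /eqP/Adisj; rewrite Aij -setI_eq0 finset.setIid.
  by apply/negP/dicycle_neq0; case: (AP j).
rewrite -(card_imset predT Ainj) /alpha.
apply: (@leq_bigmax_cond _ _ (fun F : {set {set edge G}} => #|F|)).
apply/andP; split; first by apply/fintype.subsetP => _ /imsetP[i _ ->]; case: (AP i).
by apply/finset.trivIsetP => _ _ /imsetP[i _ ->] /imsetP[j _ ->] ij; apply: Adisj; apply: contraNneq ij => ->.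
Qed.

Lemma alpha_attained : exists F : {set {set edge G}},
  [/\ F \subset dicycles G, finset.trivIset F & #|F| = alpha G].
Proof.
pose fam := [set F : {set {set edge G}} | (F \subset dicycles G) && finset.trivIset F]%SET.
have fam0 : 0 < #|fam|.
  apply/card_gt0P; exists finset.set0; rewrite inE finset.sub0set /=.
  by apply/finset.trivIsetP => A B; rewrite inE.
have [F] := @eq_bigmax_cond _ (mem fam) (fun F => #|F|) fam0.
rewrite inE => /andP[FD tF] FE; exists F; split => //.
by rewrite -FE /alpha; apply: eq_bigl => F'; rewrite inE.
Qed.

Lemma feedbackT : feedback [set: edge G]%SET.
Proof.
apply/forallP => A; apply/implyP => /dicycle_neq0; apply: contraNN.
by rewrite -setI_eq0 finset.setIT.
Qed.

Lemma beta_attained : exists2 S : {set edge G}, feedback S & #|S| = beta G.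
Proof.
rewrite /beta; elim/big_ind: _ => [|m n [S fS <-] [T fT <-]|S fS]; last by exists S.
  by exists [set: edge G]%SET; [exact: feedbackT|rewrite cardsT].
by case: (leqP #|S| #|T|) => _; [exists S|exists T].
Qed.

Lemma beta_le S : feedback S -> beta G <= #|S|.
Proof.
rewrite /beta => fS; have := mem_index_enum S.
elim: (index_enum _) => // T r IHr; rewrite big_cons inE => /predU1P[<-|/IHr le].
  by rewrite fS geq_minl.
by case: ifP => // _; rewrite geq_min le orbT.
Qed.

Lemma alpha_le_beta : alpha G <= beta G.
Proof.
have [F [FD tF <-]] := alpha_attained; have [S fS <-] := beta_attained.
have hit A : A \in F -> exists e, e \in A :&: S.
  move=> /(fintype.subsetP FD) AD; have /forallP/(_ A) := fS; rewrite AD /= -setI_eq0.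
  by move=> /finset.set0Pn.
have [f fP] : exists f : {set edge G} -> option (edge G),
    forall A, A \in F -> exists2 e, f A = Some e & e \in A :&: S.
  exists (fun A => [pick e in A :&: S]) => A AF; case: pickP => [e eA|n]; first by exists e.
  by have [e] := hit A AF; rewrite n.
rewrite -(card_in_imset (f := f)).
  rewrite -(card_imset (mem S) Some_inj); apply: subset_leq_card.
  apply/fintype.subsetP => _ /imsetP[A /fP[e -> eAS] ->]; apply/imsetP; exists e => //.
  by move: eAS; rewrite inE => /andP[].
move=> A B AF BF fAB; have [e fA eA] := fP A AF; have [e' fB eB] := fP B BF.
move: fAB; rewrite fA fB => -[ee']; apply: contrapT => /eqP AB.
have /disjoint_setI0 := finset.trivIsetP tF A B AF BF AB.
move=> /setP/(_ e); rewrite !inE; move: eA eB; rewrite -ee' !inE.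
by move=> /andP[-> _] /andP[-> _].
Qed.

Lemma alpha_eq0 : (alpha G = 0) <-> acyclic G.
Proof.
split=> [a0 p|ac].
  apply/negP => cp; have := @card_le_alpha unit (fun=> [set e in p]%SET).
  rewrite a0 card_unit ltnn => h; suff: false by []; apply: h => [_|[] []] //.
  by exists [set e in p]%SET; rewrite ?mem_dicycles.
have [F [FD _ <-]] := alpha_attained; apply/eqP; rewrite cards_eq0 -finset.subset0.
apply/fintype.subsetP => A /(fintype.subsetP FD)/dicyclesP[p cp _].
by have := ac p; rewrite cp.
Qed.

End DirectedCycles.

(** * Abstract duals *)

Local Open Scope ring_scope.

Section Circulations.
Variables (V E : finType) (s t : E -> V).

Definition divergence (y : E -> int) (v : V) : int :=
  \sum_(e | s e == v) y e - \sum_(e | t e == v) y e.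

Definition circulation y := forall v, divergence y v = 0.

Lemma divergenceE y v :
  divergence y v = \sum_e y e * ((s e == v)%:R - (t e == v)%:R).
Proof.
rewrite /divergence big_mkcond [X in _ - X]big_mkcond -sumrB /=.
by apply: eq_bigr => e _; do 2!case: eqP => _; rewrite /=; ring.
Qed.

Lemma divergenceD y z v :
  divergence (fun e => y e + z e) v = divergence y v + divergence z v.
Proof. by rewrite !divergenceE -big_split; apply: eq_bigr => e _; rewrite mulrDl. Qed.

Lemma divergenceZ k y v : divergence (fun e => k * y e) v = k * divergence y v.
Proof. by rewrite !divergenceE mulr_sumr; apply: eq_bigr => e _; rewrite mulrA. Qed.

End Circulations.

(* The integral circulations of (V, E) are the potential differences of a second
   digraph with the same edges, running from [r e] to [l e]. *)
Definition has_dual (V E : finType) (s t : E -> V) :=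
  exists (F : finType) (l r : E -> F), forall x : E -> int,
    circulation s t x <-> exists w : F -> int, forall e, x e = w (l e) - w (r e).

Lemma has_dual_reorient (V E : finType) (s t : E -> V) (o : E -> bool) :
  has_dual (fun e => if o e then t e else s e) (fun e => if o e then s e else t e) ->
  has_dual s t.
Proof.
case=> F [l [r dual]]; exists F, (fun e => if o e then r e else l e),
  (fun e => if o e then l e else r e) => x.
pose x' e := if o e then - x e else x e.
have -> : circulation s t x <-> circulation
    (fun e => if o e then t e else s e) (fun e => if o e then s e else t e) x'.
  rewrite /circulation; split=> h v; move: (h v) => <-; rewrite !divergenceE;
  by apply: eq_bigr => e _; rewrite /x'; case: (o e); ring.
rewrite dual; split=> -[w wE]; exists w => e; have := wE e; rewrite /x'.
  by case: (o e) => // h; rewrite -[x e]opprK h opprB.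
by case: (o e) => // ->; rewrite opprB.
Qed.

(** A loop may carry any value in a circulation. Its dual edge therefore joins [None] to a vertex
    [Some (inr e)] of its own, whose potential is free. *)
Lemma has_dual_loops (V E : finType) (s t : E -> V) (E' : finType) (i : E' -> E) :
  injective i -> (forall e, reflect (exists e', e = i e') (s e != t e)) ->
  has_dual (s \o i) (t \o i) -> has_dual s t.
Proof.
move=> inj iP [F [l [r dual]]].
pose pre e := [pick e' | i e' == e].
have preK e' : pre (i e') = Some e'.
  by rewrite /pre; case: pickP => [e'' /eqP/inj->//|/(_ e')]; rewrite eqxx.
have preN e : s e = t e -> pre e = None.
  rewrite /pre; case: pickP => // e' /eqP <- st.
  have /negP[] : ~~ (s (i e') != t (i e')) by rewrite st eqxx.
  by apply/iP; exists e'.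
have nl e' : s (i e') != t (i e') by apply/iP; exists e'.
pose lf e : option (F + E) := if pre e is Some e' then Some (inl (l e')) else Some (inr e).
pose rf e : option (F + E) := if pre e is Some e' then Some (inl (r e')) else None.
exists (option (F + E))%type, lf, rf => x.
have -> : circulation s t x <-> circulation (s \o i) (t \o i) (x \o i).
  rewrite /circulation; split=> h v; move: (h v) => <-; rewrite !divergenceE;
  (rewrite [RHS](bigID (fun e => s e != t e)) || rewrite [LHS](bigID (fun e => s e != t e))); rewrite /=.
    rewrite [X in _ = _ + X]big1 ?addr0 => [|e]; last by rewrite negbK => /eqP->; rewrite subrr mulr0.
    rewrite (reindex_omap i pre) => [|e /iP[e' ->]]; last by rewrite preK.
    by apply: eq_bigl => e'; rewrite nl preK eqxx.
  rewrite [X in _ + X = _]big1 ?addr0 => [|e]; last by rewrite negbK => /eqP->; rewrite subrr mulr0.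
  rewrite [LHS](reindex_omap i pre) => [|e /iP[e' ->]]; last by rewrite preK.
  by apply: eq_bigl => e'; rewrite nl preK eqxx.
rewrite dual; split=> -[w wE].
  exists (fun f => match f with Some (inl f) => w f | Some (inr e) => x e | None => 0 end) => e.
  rewrite /lf /rf; have [st|/iP[e' ->]] := eqVneq (s e) (t e).
    by rewrite preN ?subr0.
  by rewrite preK -wE.
by exists (fun f => w (Some (inl f))) => e'; have := wE (i e'); rewrite /lf /rf preK.
Qed.

(** * Duals of minors *)

Section Minor.
Variables (V E F : finType) (s t : E -> V) (l r : E -> F).
Variables (V' E' : finType) (s' t' : E' -> V').
Variables (b : V -> option V') (c : E' -> E).

Definition inner h := (b (s h) == b (t h)) && (b (s h) != None).

(** The minor contracts the inner edges, retains the range of [c] as its own edges and deletes all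
    others. *)
Definition kept h := inner h || (h \in codom c).

Hypothesis cob_circulation :
  forall w : F -> int, circulation s t (fun h => w (l h) - w (r h)).
Hypothesis circulation_cob : forall y, circulation s t y ->
  (forall h, ~~ kept h -> y h = 0) ->
  exists w : F -> int, forall h, y h = w (l h) - w (r h).
Hypothesis c_inj : injective c.
Hypothesis bsc : forall e, b (s (c e)) = Some (s' e).
Hypothesis btc : forall e, b (t (c e)) = Some (t' e).
Hypothesis noloop : forall e, s' e != t' e.
Hypothesis branch_connected : forall p q v, b p = Some v -> b q = Some v ->
  connect (fun p q => [exists h, inner h &&
    (((s h == p) && (t h == q)) || ((s h == q) && (t h == p)))]) p q.

(** [d] is a demand at the vertices, to be met by a flow on the contracted edges alone. *)
Definition feasible (d : V -> int) := exists z : E -> int,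
  (forall h, ~~ inner h -> z h = 0) /\ forall v, divergence s t z v = d v.

Lemma feasible0 : feasible (fun=> 0).
Proof.
exists (fun=> 0); split=> // v; rewrite divergenceE big1 // => e _; by rewrite mul0r.
Qed.

Lemma feasibleD d d' : feasible d -> feasible d' -> feasible (fun v => d v + d' v).
Proof.
move=> [z [z0 zE]] [z' [z0' zE']]; exists (fun e => z e + z' e); split=> [h nh|v].
  by rewrite z0 ?z0'.
by rewrite divergenceD zE zE'.
Qed.

Lemma feasibleZ k d : feasible d -> feasible (fun v => k * d v).
Proof.
move=> [z [z0 zE]]; exists (fun e => k * z e); split=> [h nh|v].
  by rewrite z0 ?mulr0.
by rewrite divergenceZ zE.
Qed.

Lemma feasible_ext d d' : d =1 d' -> feasible d -> feasible d'.
Proof. by move=> /funext->. Qed.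

Lemma feasible_sum (I : finType) (d : I -> V -> int) :
  (forall i, feasible (d i)) -> feasible (fun v => \sum_i d i v).
Proof.
move=> dF; suff : forall r : seq I, feasible (fun v => \sum_(i <- r) d i v) by apply.
elim=> [|i u IHu]; first by apply: feasible_ext feasible0 => v; rewrite big_nil.
by apply: feasible_ext (feasibleD (dF i) IHu) => v; rewrite big_cons.
Qed.

Lemma feasible_branch p q v : b p = Some v -> b q = Some v ->
  feasible (fun u => (p == u)%:R - (q == u)%:R).
Proof.
move=> bp bq; have /connectP[u + ->] := branch_connected bp bq.
elim: u p {bp bq} => [|p' u IHu] p /=.
  by move=> _; apply: feasible_ext feasible0 => x; rewrite subrr.
case/andP => /existsP[h /andP[ih hpp]] /IHu fp'.
have fst_inner := ih.
have step : feasible (fun u => (p == u)%:R - (p' == u)%:R).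
  have fst_ : feasible (fun u => (s h == u)%:R - (t h == u)%:R).
    exists (fun k => (k == h)%:R); split=> [k|x].
      by move=> nk; have [kh|//] := eqVneq k h; rewrite kh fst_inner in nk.
    rewrite divergenceE (bigD1 h) //= eqxx mul1r big1 ?addr0 // => k /negPf->.
    by rewrite mul0r.
  case/orP: hpp => /andP[/eqP <- /eqP <-] //.
  by apply: feasible_ext (feasibleZ (-1) fst_) => x; ring.
by apply: feasible_ext (feasibleD step fp') => x; ring.
Qed.

(** Every vertex ships its demand to the representative [rep] of its branch, along inner edges since
    branches are connected. At the representative the shipments add up to the total of the branch,
    which is 0. *)
Lemma feasible_zero_sum d : (forall p, b p = None -> d p = 0) ->
  (forall v, \sum_(p | b p == Some v) d p = 0) -> feasible d.
Proof.
move=> d0 dsum.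
pose rep p := odflt p [pick q | b q == b p].
have brep p : b (rep p) = b p.
  by rewrite /rep; case: pickP => [q /eqP|//].
have rep_eq p q : b p = b q -> rep p = rep q.
  by move=> bpq; rewrite /rep bpq; case: pickP => // /(_ q); rewrite eqxx.
apply: (@feasible_ext (fun u => \sum_p d p * ((p == u)%:R - (rep p == u)%:R))) => [u|].
  under eq_bigr do rewrite mulrBr; rewrite sumrB.
  have -> : \sum_p d p * (p == u)%:R = d u.
    rewrite (bigD1 u) //= eqxx mulr1 big1 ?addr0 // => p /negPf->; by rewrite mulr0.
  suff -> : \sum_p d p * (rep p == u)%:R = 0 by rewrite subr0.
  under eq_bigr do rewrite mulr_natr mulrb; rewrite -big_mkcond /=.
  case bu : (b u) => [v|]; last first.
    by rewrite big1 // => p /eqP pu; apply: d0; rewrite -brep pu.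
  have [ru|ru] := eqVneq (rep u) u; last first.
    rewrite big_pred0 // => p; apply/negbTE; apply: contraNneq ru => pu.
    by rewrite -{2}pu; apply/eqP/rep_eq; rewrite -pu brep.
  rewrite -[RHS](dsum v); apply: eq_bigl => p; rewrite -bu.
  by apply/eqP/eqP => [<-|/rep_eq->//]; rewrite brep.
apply: feasible_sum => p; case bp : (b p) => [v|]; last first.
  by apply: feasible_ext feasible0 => u; rewrite d0 // mul0r.
by apply: feasibleZ; apply: (@feasible_branch _ _ v) => //; rewrite brep.
Qed.

Let pre h := [pick e | c e == h].
Let preK e : pre (c e) = Some e.
Proof. by rewrite /pre; case: pickP => [e' /eqP/c_inj->//|/(_ e)]; rewrite eqxx. Qed.

Lemma inner_c e : ~~ inner (c e).
Proof.
rewrite /inner bsc btc andbT; apply: contraNneq (noloop e) => -[->]; exact: eqxx.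
Qed.

(** Inner edges have both ends in one branch and cancel in the sum, so only the edges of the minor
    contribute. *)
Lemma sum_branch_divergence (y : E -> int) v : (forall h, ~~ kept h -> y h = 0) ->
  \sum_(p | b p == Some v) divergence s t y p = divergence s' t' (y \o c) v.
Proof.
move=> y0; under eq_bigr do rewrite divergenceE; rewrite exchange_big /=.
transitivity (\sum_h y h * ((b (s h) == Some v)%:R - (b (t h) == Some v)%:R)).
  apply: eq_bigr => h _; rewrite -mulr_sumr sumrB; congr (_ * (_ - _)).
    rewrite big_mkcond (bigD1 (s h)) //= eqxx big1 ?addr0 => [|p]; first by case: ifP.
    by rewrite eq_sym => /negPf->; case: ifP.
  rewrite big_mkcond (bigD1 (t h)) //= eqxx big1 ?addr0 => [|p]; first by case: ifP.
  by rewrite eq_sym => /negPf->; case: ifP.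
rewrite divergenceE (bigID (fun h => h \in codom c)) /= [X in _ + X]big1 ?addr0 => [|h hc].
  rewrite (reindex_omap c pre) => [|h /codomP[e ->]]; last by rewrite preK.
  apply: eq_big => [e|e _]; first by rewrite codom_f preK eqxx.
  by rewrite bsc btc.
have [/andP[/eqP-> _]|nh] := boolP (inner h); first by rewrite subrr mulr0.
by rewrite y0 ?mul0r // /kept (negPf nh).
Qed.

(** Deleting an edge contracts its dual edge, so [adj] merges the dual vertices on its two sides.
    The hypothesis [circulation_cob] concerns only circulations on kept edges because a torus
    carries others that have no potential. *)
Lemma minor_has_dual : has_dual s' t'.
Proof.
pose adj f g := [exists h, ~~ kept h && (((l h == f) && (r h == g)) || ((l h == g) && (r h == f)))].
have adj_sym : connect_sym adj.
  by apply: sym_connect_sym => f g; rewrite /adj; apply: eq_existsb => h; rewrite orbC.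
exists F, (fun e => fingraph.root adj (l (c e))), (fun e => fingraph.root adj (r (c e))) => x.
split=> [xc|[w wE]].
  pose y0 h : int := if pre h is Some e then x e else 0.
  have y0c e : y0 (c e) = x e by rewrite /y0 preK.
  have y0N h : h \notin codom c -> y0 h = 0.
    by rewrite /y0 /pre; case: pickP => // e /eqP <-; rewrite codom_f.
  (* A circulation of the minor is conserved only branch by branch in the host. The inner flow [z]
     restores conservation at every vertex. *)
  have [|v|z [z0 zE]] := @feasible_zero_sum (fun p => - divergence s t y0 p).
  - move=> p bp; rewrite divergenceE big1 ?oppr0 // => h _.
    have [/codomP[e ->]|/y0N->] := boolP (h \in codom c); last by rewrite mul0r.
    have -> : (s (c e) == p) = false by apply/eqP => sp; have := bsc e; rewrite sp bp.
    have -> : (t (c e) == p) = false by apply/eqP => sp; have := btc e; rewrite sp bp.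
    by rewrite subrr mulr0.
  - rewrite sumrN sum_branch_divergence => [|h]; last by rewrite negb_or => /andP[_ /y0N].
    rewrite -[RHS]oppr0 -(xc v) !divergenceE; congr (- _).
    by apply: eq_bigr => e _; rewrite /= y0c.
  have [||w wE] := @circulation_cob (fun h => y0 h + z h).
  - by move=> p; rewrite divergenceD zE subrr.
  - by move=> h; rewrite negb_or => /andP[/z0-> /y0N->].
  exists w => e; have w_adj f g : connect adj f g -> w f = w g.
    move=> /connectP[p + ->]; elim: p f => //= f' p IHp f /andP[/existsP[h /andP[kh hf]] /IHp <-].
    have := wE h; move: (kh); rewrite negb_or => /andP[/z0-> /y0N->].
    rewrite addr0 => /eqP; rewrite eq_sym subr_eq0 => /eqP.
    by case/orP: hf => /andP[/eqP-> /eqP->].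
  rewrite -(w_adj _ _ (connect_root _ _)) -(w_adj _ _ (connect_root _ _)) -wE y0c.
  by rewrite z0 ?addr0 // inner_c.
(* Conversely, a potential on the classes is pulled back to all dual vertices. Its difference
   vanishes on deleted edges, as [sum_branch_divergence] requires. *)
pose w' f := w (fingraph.root adj f).
pose y h := w' (l h) - w' (r h).
have y0 h : ~~ kept h -> y h = 0.
  move=> kh; rewrite /y /w'; have /(fingraph.rootP adj_sym)-> : connect adj (l h) (r h).
    by apply: connect1; apply/existsP; exists h; rewrite kh !eqxx.
  by rewrite subrr.
move=> v; transitivity (divergence s' t' (y \o c) v).
  by rewrite !divergenceE; apply: eq_bigr => e _; rewrite wE.
rewrite -sum_branch_divergence // big1 // => p _; exact: cob_circulation.
Qed.

End Minor.

Local Close Scope ring_scope.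

Local Open Scope ring_scope.

(** * Dicuts of the dual and directed cycles *)

Section AlphaBeta.
Variable G : digraph.

Lemma balanced_circulation (S : {set edge G}) :
  circulation (@src G) (@tgt G) (fun e => (e \in S)%:R) <-> balanced S.
Proof.
have divE v : divergence (@src G) (@tgt G) (fun e => (e \in S)%:R) v =
    #|S :&: out_edges v|%:R - #|S :&: in_edges v|%:R.
  rewrite /divergence -!sum1_card !natr_sum; congr (_ - _).
    rewrite big_mkcond [RHS]big_mkcond; apply: eq_bigr => e _; rewrite !inE.
    by case: (e \in S); case: (src e == v).
  rewrite big_mkcond [RHS]big_mkcond; apply: eq_bigr => e _; rewrite !inE.
  by case: (e \in S); case: (tgt e == v).
split=> h v; have := h v; rewrite ?divE; first by move=> /eqP; rewrite subr_eq0 eqr_nat => /eqP.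
by move=> ->; rewrite subrr.
Qed.

(** A dicut of the dual is a balanced edge set, so it contains a directed cycle and at most
    [alpha G] dicuts are disjoint. Every directed cycle in turn contains a dicut, so an edge set
    meeting all dicuts is a feedback set. *)
Lemma has_dual_alpha_beta : has_dual (@src G) (@tgt G) -> alpha G = beta G.
Proof.
case=> F [l [r dual]]; apply/eqP; rewrite eqn_leq alpha_le_beta /=.
have outcut_balanced U : out_closed l r U -> balanced (outcut l r U).
  move=> cU; apply/balanced_circulation/dual; exists (fun f => (f \in U)%:R) => e.
  rewrite inE; have := @out_closedP _ _ l r U e cU.
  by case: (l e \in U); case: (r e \in U) => //= /(_ isT).
have [|T Ta hit] := @lucchesi_younger _ _ l r (alpha G) [set: edge G].
  case=> s [sD sz cov].
  have := @card_le_alpha G 'I_(alpha G).+1 (fun i => outcut l r (nth set0 s i)).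
  rewrite card_ord ltnn => h; suff: false by []; apply: h => [i|i j ij].
    have /andP[ci ni] : dicut l r (nth set0 s i) by apply: (allP sD); rewrite mem_nth // sz.
    by apply: balanced_dicycle => //; apply: outcut_balanced.
  apply/pred0P => e /=; apply/negbTE/negP => /andP[ei ej].
  have := cov e; rewrite inE leqNgt => /negP; apply.
  rewrite /cover -{1}[s](mkseq_nth set0) count_map -val_enum_ord count_map count_enum sz.
  rewrite (cardD1 i) (cardD1 j) !inE eq_sym ij /=.
  by move: ei ej; rewrite !inE => -> ->.
apply: leq_trans (beta_le _) Ta.
apply/forallP => A; apply/implyP => AD.
have /dicyclesP[p cp AE] := AD.
have [w wE] : exists w : F -> int, forall e, (e \in A)%:R = w (l e) - w (r e).
  by apply/dual/balanced_circulation => v; rewrite AE; apply: dicycle_balanced.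
have [e0 e0A] : exists e0, e0 \in A by apply/set0Pn/dicycle_neq0.
(* The differences [w (l e) - w (r e)] are 0 or 1. Hence no edge enters this superlevel set, and an
   edge leaving it has difference 1, that is, lies in [A]. *)
pose U := [set f | w (l e0) <= w f].
have out_e0 : e0 \in outcut l r U.
  rewrite !inE lexx /= -ltNge; have := wE e0; rewrite e0A => h.
  by rewrite -subr_gt0 -h.
have cU : out_closed l r U.
  apply/forallP => e; apply/implyP; rewrite !inE => h; apply: le_trans h _.
  by rewrite -subr_ge0 -wE ler0n.
have sub : outcut l r U \subset A.
  apply/subsetP => e; rewrite !inE -ltNge => /andP[h1 h2].
  by have := lt_le_trans h2 h1; rewrite -subr_gt0 -wE; case: (e \in A).
have /hit : dicut l r U by rewrite /dicut cU; apply/set0Pn; exists e0.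
move=> /(_ (subsetT _)); apply: contraNN; exact: disjointWl.
Qed.

End AlphaBeta.

Local Close Scope ring_scope.

(** * Plane drawings are minors of a torus grid *)

Local Open Scope ring_scope.

Section Torus.
Variable m : nat.
Local Notation Z := 'I_m.+2.
Local Notation T := (Z * Z)%type.

Definition torus_edge : finType := (T * bool)%type.
Definition torus_src (h : torus_edge) : T := h.1.
Definition torus_tgt (h : torus_edge) : T :=
  if h.2 then (h.1.1, h.1.2 + 1) else (h.1.1 + 1, h.1.2).
(* The cell [p] has [p] as its lower left corner. *)
Definition torus_left (h : torus_edge) : T :=
  if h.2 then (h.1.1 - 1, h.1.2) else h.1.
Definition torus_right (h : torus_edge) : T :=
  if h.2 then h.1 else (h.1.1, h.1.2 - 1).

Lemma torus_divergence (y : torus_edge -> int) (p : T) :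
  divergence torus_src torus_tgt y p =
  y (p, false) + y (p, true) - (y ((p.1 - 1, p.2), false) + y ((p.1, p.2 - 1), true)).
Proof.
rewrite /divergence; congr (_ - _).
  rewrite (bigD1 (p, false)) /=; last by rewrite /torus_src.
  rewrite (bigD1 (p, true)) /=; last by rewrite /torus_src eqxx -pair_eqE /pair_eq /= andbF.
  rewrite big1 ?addr0 // => -[q b] /= /andP[/andP[/eqP qp]].
  by rewrite /torus_src /= in qp; rewrite qp; case: b; rewrite eqxx.
rewrite (bigD1 ((p.1 - 1, p.2), false)) /=; last first.
  by rewrite /torus_tgt /= subrK -surjective_pairing.
rewrite (bigD1 ((p.1, p.2 - 1), true)) /=; last first.
  by rewrite /torus_tgt /= subrK -surjective_pairing eqxx -pair_eqE /pair_eq /= andbF.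
rewrite big1 ?addr0 // => -[[q1 q2] b] /= /andP[/andP[]].
rewrite /torus_tgt /=; case: b => /= /eqP <- /=; rewrite addrK eqxx //=.
Qed.

Lemma torus_cob_circulation (w : T -> int) :
  circulation torus_src torus_tgt (fun h => w (torus_left h) - w (torus_right h)).
Proof.
move=> [p1 p2]; rewrite torus_divergence /torus_left /torus_right /=.
by ring.
Qed.

(** The potential [w] of a cell is the flow through the horizontal edges below it in its column,
    counted upwards from row 0. Conservation at the vertices then yields the values on the vertical
    edges. *)
Lemma torus_circulation_cob (y : torus_edge -> int) :
  circulation torus_src torus_tgt y ->
  (forall h, (torus_src h).1 = 0 \/ (torus_src h).2 = 0 \/
     (torus_tgt h).1 = 0 \/ (torus_tgt h).2 = 0 -> y h = 0) ->
  exists w : T -> int, forall h, y h = w (torus_left h) - w (torus_right h).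
Proof.
move=> yc y0.
pose w (p : T) := \sum_(k : Z | (k <= p.2)%N) y ((p.1, k), false).
have wE i j : w (i, j) = \sum_(k : Z | (k <= j)%N) y ((i, k), false) by [].
have val_m1 (j : Z) : j != 0 -> nat_of_ord (j - 1)%R = j.-1.
  move=> j0; have jp : (0 < j)%N by rewrite lt0n.
  have -> : j - 1 = inord j.-1.
    apply: (addIr 1); rewrite subrK; apply/val_inj => /=.
    have jl := ltn_ord j; rewrite inordK; last by lia.
    by rewrite (modn_small (isT : 1 < m.+2)%N) addn1 prednK // modn_small.
  by rewrite inordK //; have := ltn_ord j; lia.
have w_step (i j : Z) : j != 0 -> w (i, j) = w (i, j - 1) + y ((i, j), false).
  move=> j0; rewrite !wE (bigD1 j) // addrC; congr (_ + _); apply: eq_bigl => k.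
  rewrite val_m1 //; have jp : (0 < j)%N by rewrite lt0n.
  rewrite -val_eqE /=; lia.
have w_0 (i : Z) : w (i, 0) = 0.
  by rewrite /w big1 // => k /= k0; apply: y0; right; left; apply/val_inj/eqP; rewrite -leqn0.
have ord_ind (Q : Z -> Prop) : Q 0 -> (forall j, j != 0 -> Q (j - 1) -> Q j) -> forall j, Q j.
  move=> Q0 QS j; have [n] := ubnP (nat_of_ord j); elim: n j => // n IHn j jn.
  have [->//|j0] := eqVneq j 0; apply: QS => //; apply: IHn.
  by rewrite val_m1 //; move: jn j0; rewrite -val_eqE /=; lia.
have w_vert (i j : Z) : w (i - 1, j) - w (i, j) = y ((i, j), true).
  elim/ord_ind: j => [|j j0 IHj].
    by rewrite !w_0 subrr; apply/ssrfun.esym/y0; right; left.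
  rewrite (w_step (i - 1) j) // (w_step i j) // opprD addrACA IHj.
  have c0 : y ((i, j), false) + y ((i, j), true)
      - (y ((i - 1, j), false) + y ((i, j - 1), true)) = 0.
    by rewrite -[RHS](yc (i, j)) torus_divergence.
  rewrite -[RHS]subr0 -c0; ring.
(* This is the period around the torus. The total flow through a column of horizontal edges does not
   depend on [i], since nothing flows vertically into row 0, and it is 0 in column 0. *)
have w_top (i : Z) : w (i, - 1) = 0.
  have y_top k : y ((k, -1), true) = 0.
    by apply: y0; right; right; right; rewrite /torus_tgt /= addNr.
  elim/ord_ind: i => [|i i0 IHi].
    by rewrite /w big1 // => k _; apply: y0; left.
  have := w_vert i (- 1); rewrite y_top IHi sub0r => /eqP; rewrite oppr_eq0 => /eqP //.
exists w => -[[i j] []] /=; rewrite /torus_left /torus_right /=; first by rewrite w_vert.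
have [->|j0] := eqVneq j 0; last by rewrite [w (i, j)]w_step // addrC addKr.
rewrite w_0 !sub0r w_top oppr0; apply: y0; right; left => //.
Qed.

End Torus.

Local Close Scope ring_scope.

Definition box_near (k : nat) (g g' : nat * nat) : bool :=
  [&& g.1 <= g'.1 + k, g'.1 <= g.1 + k, g.2 <= g'.2 + k & g'.2 <= g.2 + k]%N.

(** Reflexive, so that consecutive points of a walk may coincide. *)
Definition grid_adj (g g' : nat * nat) : bool :=
  ((g.1 == g'.1) && (g.2 <= g'.2.+1) && (g'.2 <= g.2.+1)
   || (g.2 == g'.2) && (g.1 <= g'.1.+1) && (g'.1 <= g.1.+1))%N.

Lemma box_near1_adj a b : box_near 1 a b -> grid_adj a (b.1, a.2) && grid_adj (b.1, a.2) b.
Proof.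
case: a b => [a1 a2] [b1 b2]; rewrite /box_near /grid_adj /= !eqxx !addn1 /=.
by move=> /and4P[-> -> -> ->]; rewrite orbT.
Qed.

Lemma box_near_refl k g : box_near k g g.
Proof. by rewrite /box_near; lia. Qed.

Lemma box_near_sym k g h : box_near k g h -> box_near k h g.
Proof. by rewrite /box_near; lia. Qed.

Lemma box_near_trans i j g h k : box_near i g h -> box_near j h k -> box_near (i + j) g k.
Proof. by rewrite /box_near; lia. Qed.

Lemma box_near_leq i j g h : (i <= j)%N -> box_near i g h -> box_near j g h.
Proof. by rewrite /box_near; lia. Qed.

Lemma box_near1_corner a b : box_near 1 a b -> box_near 1 (b.1, a.2) b.
Proof. by rewrite /box_near /=; lia. Qed.

Definition in_box (i j : nat) (g : nat * nat) :=
  [&& i <= g.1, g.1 <= j, i <= g.2 & g.2 <= j]%N.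

Lemma in_box_near1 i j g h : box_near 1 g h -> in_box i.+1 j h -> in_box i j.+1 g.
Proof. by rewrite /box_near /in_box; lia. Qed.

Lemma in_box_leq i j i' j' g : (i' <= i)%N -> (j <= j')%N -> in_box i j g -> in_box i' j' g.
Proof. by rewrite /in_box; lia. Qed.

(* A discrete picture of a plane drawing: [P] locates the vertices and [N] is
   the set of grid points close to an edge; [K] is the radius of a square in
   which distinct edges may come close to each other. *)
Definition discrete_drawing (G : digraph) (m K : nat) (P : vertex G -> nat * nat)
    (N : edge G -> nat * nat -> Prop) : Prop :=
  [/\ (forall e, exists q : seq (nat * nat), [/\ path grid_adj (P (src e)) q, last (P (src e)) q = P (tgt e)
        & forall g, g \in P (src e) :: q -> N e g]),
      (forall x y, x != y -> ~~ box_near (2 * K + 2) (P x) (P y)),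
      (forall e x g, src e != x -> tgt e != x -> N e g -> ~~ box_near K g (P x)),
      (forall e f g, e != f -> N e g -> N f g -> exists x, box_near K g (P x)) &
      (forall e g, N e g -> in_box 1 m g) /\ (forall x, in_box K.+1 m (P x))].

(** As long as an inner point lies in [A] or [B], the path is cut there and the shorter piece still
    leads from [A] to [B]. *)
Lemma path_between (T : eqType) (r : rel T) (A B : pred T) x p :
  path r x p -> A x -> B (last x p) -> (forall z, A z -> ~~ B z) ->
  exists y q z, [/\ path r y (rcons q z), A y, B z,
    {subset rcons q z <= p} & forall u, u \in q -> ~~ A u && ~~ B u].
Proof.
move=> + + + dis; have [n] := ubnP (size p); elim: n x p => // n IHn x p pn rp Ax Bl.
case/lastP: p => [|q z] in pn rp Bl *; first by have := dis x Ax; rewrite Bl.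
rewrite last_rcons in Bl.
have [/hasP[u uq Au]|nA] := boolP (has A q).
  case/splitPr: uq => q1 q2 in pn rp *; move: rp; rewrite rcons_cat cat_path /= => /and3P[_ _ r2].
  have [||y [q' [z' [h1 h2 h3 h4 h5]]]] := IHn u (rcons q2 z) _ r2 Au; rewrite ?last_rcons //.
    by move: pn; rewrite !size_rcons size_cat /=; lia.
  exists y, q', z'; split=> // w /h4 wq; by rewrite mem_cat inE wq !orbT.
have [/hasP[u uq Bu]|nB] := boolP (has B q).
  case/splitPr: uq => q1 q2 in pn rp nA *; move: rp; rewrite rcons_cat cat_path /= => /and3P[r1 ru _].
  have [|||y [q' [z' [h1 h2 h3 h4 h5]]]] := IHn x (rcons q1 u) _ _ Ax; rewrite ?last_rcons ?rcons_path ?r1 //.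
    by move: pn; rewrite !size_rcons size_cat /=; lia.
  exists y, q', z'; split=> // w /h4; rewrite mem_cat mem_rcons !inE.
  by case/predU1P => [->|->] //; rewrite eqxx orbT.
exists x, q, z; split => // u uq.
by rewrite (hasPn nA u uq) (hasPn nB u uq).
Qed.

(** * From a discrete drawing to a dual *)

Section Branches.
Variables (G : digraph) (m K : nat) (P : vertex G -> nat * nat) (N : edge G -> nat * nat -> Prop).
Hypothesis draw : discrete_drawing m K P N.
Local Notation E' := {e : edge G | src e != tgt e}.

Let inB x : pred (nat * nat) := fun g => box_near K g (P x).

Lemma inB_disjoint x y g : inB x g -> inB y g -> x = y.
Proof.
have [_ d2 _ _ _] := draw; move=> gx gy; apply: contrapT => /eqP xy.
by have := d2 x y xy; move: gx gy; rewrite /inB /box_near; lia.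
Qed.

Lemma inB_adj x y g h : inB x g -> inB y h -> grid_adj g h -> x = y.
Proof.
have [_ d2 _ _ _] := draw; move=> gx gy gh; apply: contrapT => /eqP xy.
by have := d2 x y xy; move: gx gy gh; rewrite /inB /box_near /grid_adj; lia.
Qed.

(* [q] is the part of the walk of [e] strictly between the squares around its
   end points, and [y], [z] are the grid points just before and after it. *)
Lemma middle_part (e : E') : exists yqz : (nat * nat) * seq (nat * nat) * (nat * nat),
  let: (y, q, z) := yqz in
  [/\ path grid_adj y (rcons q z), inB (src (val e)) y, inB (tgt (val e)) z, q != [::]
    & forall u, u \in q -> N (val e) u /\ forall x, ~~ inB x u].
Proof.
have [d1 d2 d3 _ _] := draw; have [p [pp lp Np]] := d1 (val e).
have [|||y [q [z [h1 h2 h3 h4 h5]]]] := @path_between _ grid_adj (inB (src (val e))) (inB (tgt (val e))) _ _ pp.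
- by rewrite /inB /box_near; lia.
- by rewrite lp /inB /box_near; lia.
- move=> g gs; apply/negP => /(inB_disjoint gs) st; have := valP e; by rewrite st eqxx.
exists (y, q, z); split => //.
  apply: contraTneq h1 => ->; rewrite /= andbT; apply/negP => /(inB_adj h2 h3) st.
  by have := valP e; rewrite st eqxx.
move=> u uq; have Nu : N (val e) u.
  by apply: Np; rewrite inE h4 ?orbT // mem_rcons inE uq orbT.
split=> // x; have /andP[nA nB] := h5 u uq.
have [<-//|sx] := eqVneq (src (val e)) x; have [<-//|tx] := eqVneq (tgt (val e)) x.
exact: (d3 _ _ _ sx tx Nu).
Qed.

Local Notation Tor := ('I_(m + K).+2 * 'I_(m + K).+2)%type.

Definition to_torus (g : nat * nat) : Tor := (inord g.1, inord g.2).
Definition of_torus (p : Tor) : nat * nat := (val p.1, val p.2).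

Lemma of_torusK p : to_torus (of_torus p) = p.
Proof. by case: p => p1 p2; rewrite /to_torus /= !inord_val. Qed.

Lemma to_torusK g : g.1 < (m + K).+2 -> g.2 < (m + K).+2 -> of_torus (to_torus g) = g.
Proof. by case: g => g1 g2 /= h1 h2; rewrite /of_torus /= !inordK. Qed.

Lemma grid_adj_edge u z : grid_adj u z -> u <> z ->
  u.1 <= m + K -> u.2 <= m + K -> z.1 <= m + K -> z.2 <= m + K ->
  exists ho : torus_edge (m + K) * bool,
    (torus_src ho.1, torus_tgt ho.1) =
      if ho.2 then (to_torus z, to_torus u) else (to_torus u, to_torus z).
Proof.
have succ k : k <= m + K -> (inord k + 1)%R = inord k.+1 :> 'I_(m + K).+2.
  move=> km; apply/val_inj => /=; rewrite !inordK ?ltnS ?(leq_trans km) //.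
  by rewrite (modn_small (isT : 1 < (m + K).+2)) addn1 modn_small // !ltnS.
case: u z => [u1 u2] [z1 z2]; rewrite /grid_adj /= => adj uz h1 h2 h3 h4.
have ne : ~~ ((u1 == z1) && (u2 == z2)) by apply/negP => /andP[/eqP e1 /eqP e2]; apply: uz; rewrite e1 e2.
have : (u1 = z1 /\ z2 = u2.+1) \/ (u1 = z1 /\ u2 = z2.+1) \/ (u2 = z2 /\ z1 = u1.+1) \/ (u2 = z2 /\ u1 = z1.+1).
  by move: adj ne; lia.
case=> [[-> ->]|[[-> ->]|[[-> ->]|[-> ->]]]].
- by exists ((to_torus (z1, u2), true), false); rewrite /torus_src /torus_tgt /to_torus /= succ.
- by exists ((to_torus (z1, z2), true), true); rewrite /torus_src /torus_tgt /to_torus /= succ.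
- by exists ((to_torus (u1, z2), false), false); rewrite /torus_src /torus_tgt /to_torus /= succ.
- by exists ((to_torus (z1, z2), false), true); rewrite /torus_src /torus_tgt /to_torus /= succ.
Qed.

Lemma drawing_has_dual : has_dual (@src G) (@tgt G).
Proof.
have [_ d2 _ d4 [dN dP]] := draw.
have [f fP] := choice middle_part.
pose y e := (f e).1.1; pose q e := (f e).1.2; pose z e := (f e).2.
have {fP} fP e : [/\ path grid_adj (y e) (rcons (q e) (z e)), inB (src (val e)) (y e),
    inB (tgt (val e)) (z e), q e != [::]
    & forall u, u \in q e -> N (val e) u /\ forall x, ~~ inB x u].
  by have := fP e; rewrite /y /q /z; case: (f e) => [[]].
have q_disj e e' u : u \in q e -> u \in q e' -> e = e'.
  have [_ _ _ _ h] := fP e; have [_ _ _ _ h'] := fP e'.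
  move=> /h[Nu nB] /h'[Nu' _]; apply/val_inj/eqP/negPn/negP => ee'.
  by have [x] := d4 _ _ _ ee' Nu Nu'; apply/negP/nB.
(* A branch is the square around a vertex together with the middle parts of the edges leaving it, so
   that only the last step of a walk joins two branches. *)
pose b g : option (vertex G) := if [pick x | inB x g] is Some x then Some x
  else if [pick e : E' | g \in q e] is Some e then Some (src (val e)) else None.
have bB x g : inB x g -> b g = Some x.
  move=> gx; rewrite /b; case: pickP => [x' /(inB_disjoint gx)->//|/(_ x)].
  by rewrite gx.
have bq e u : u \in q e -> b u = Some (src (val e)).
  move=> uq; have [_ _ _ _ /(_ u uq) [_ nB]] := fP e.
  rewrite /b; case: pickP => [x ux|_]; first by have := nB x; rewrite ux.
  case: pickP => [e' /(q_disj _ _ _ uq)->//|/(_ e)]; by rewrite uq.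
have b_range g v : b g = Some v -> [&& 0 < g.1, g.1 <= m + K, 0 < g.2 & g.2 <= m + K].
  rewrite /b; case: pickP => [x gx _|_]; first by have := dP x; move: gx; rewrite /inB /box_near /in_box; lia.
  case: pickP => // e ge _; have [_ _ _ _ /(_ g ge) [Ng _]] := fP e.
  by have := dN _ _ Ng; rewrite /in_box; lia.
have b_torusK g v : b g = Some v -> of_torus (to_torus g) = g.
  by move=> /b_range h; apply: to_torusK; lia.
pose bT (p : Tor) := b (of_torus p).
have bTE g v : b g = Some v -> bT (to_torus g) = Some v.
  by move=> bg; rewrite /bT (b_torusK g v).
have edgeP g g' v v' : b g = Some v -> b g' = Some v' -> grid_adj g g' -> g <> g' ->
    exists ho : torus_edge (m + K) * bool, (torus_src ho.1, torus_tgt ho.1) =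
      if ho.2 then (to_torus g', to_torus g) else (to_torus g, to_torus g').
  move=> /b_range h /b_range h' gg' ne; apply: grid_adj_edge => //; lia.
pose inn := inner (@torus_src (m + K)) (@torus_tgt (m + K)) bT.
pose rel (p p' : Tor) := [exists h, inn h &&
  (((torus_src h == p) && (torus_tgt h == p')) || ((torus_src h == p') && (torus_tgt h == p)))].
have rel_sym : connect_sym rel.
  by apply: sym_connect_sym => p p'; rewrite /rel; apply: eq_existsb => h; rewrite orbC.
have conn_step g g' v : b g = Some v -> b g' = Some v -> grid_adj g g' ->
    connect rel (to_torus g) (to_torus g').
  move=> bg bg' gg'; have [->|/eqP ne] := eqVneq g g'; first exact: connect0.
  have [[h o] /= hE] := edgeP _ _ _ _ bg bg' gg' ne.
  apply: connect1; apply/existsP; exists h; move: hE; rewrite /inn /inner.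
  by case: o => -[-> ->]; rewrite (bTE _ _ bg) (bTE _ _ bg') !eqxx ?orbT.
have conn_B x g : inB x g -> connect rel (to_torus g) (to_torus (P x)).
  have [n] := ubnP ((g.1 - (P x).1) + ((P x).1 - g.1) + (g.2 - (P x).2) + ((P x).2 - g.2)).
  elim: n g => // n IHn g gn gx.
  have [->|gP] := eqVneq g (P x); first exact: connect0.
  have [g' [g'x gg' lt]] : exists g', [/\ inB x g', grid_adj g g' &
      (g'.1 - (P x).1) + ((P x).1 - g'.1) + (g'.2 - (P x).2) + ((P x).2 - g'.2) < n].
    move: gn gx gP; rewrite /inB /box_near /grid_adj; case: g (P x) => [g1 g2] [c1 c2] /= gn gx gP.
    have ne : ~~ ((g1 == c1) && (g2 == c2)) by apply/negP => /andP[/eqP e1 /eqP e2]; rewrite e1 e2 eqxx in gP.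
    have [lt1|lt1|e1] := ltngtP g1 c1.
    + by exists (g1.+1, g2); split => /=; lia.
    + by exists (g1.-1, g2); split => /=; lia.
    have [lt2|lt2|e2] := ltngtP g2 c2.
    + by exists (g1, g2.+1); split => /=; lia.
    + by exists (g1, g2.-1); split => /=; lia.
    by rewrite e1 e2 !eqxx in ne.
  exact: connect_trans (conn_step _ _ _ (bB _ _ gx) (bB _ _ g'x) gg') (IHn g' lt g'x).
have conn_q e u : u \in q e -> connect rel (to_torus (y e)) (to_torus u).
  have [pth yB _ _ _] := fP e; have by_ := bB _ _ yB.
  move: pth; rewrite rcons_path => /andP[pth _].
  have bqe : forall u, u \in q e -> b u = Some (src (val e)) by move=> u'; apply: bq.
  elim: (q e) (y e) by_ pth bqe => // w s IHs a ba /= /andP[aw ws] bs.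
  have bw : b w = Some (src (val e)) by apply: bs; rewrite mem_head.
  rewrite inE => /predU1P[->|us]; first exact: conn_step ba bw aw.
  apply: connect_trans (conn_step _ _ _ ba bw aw) (IHs w bw ws _ us).
  by move=> u' u's; apply: bs; rewrite inE u's orbT.
have conn_center p v : bT p = Some v -> connect rel p (to_torus (P v)).
  rewrite /bT -{2}[p]of_torusK; move: (of_torus p) => g; rewrite /b.
  case: pickP => [x gx [<-]|_]; first exact: conn_B.
  case: pickP => // e ge [<-]; have [_ yB _ _ _] := fP e.
  by apply: connect_trans (conn_B _ _ yB); rewrite rel_sym; apply: conn_q.
(* The grid edge representing [e] is the step from the last point [u e] of the middle part into the
   square of the target. The flag [o e] tells whether it is traversed against its direction on the
   torus. *)
pose u e := last (y e) (q e).
have uq e : u e \in q e.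
  have [_ _ _ + _] := fP e; rewrite /u; case: (q e) => // a s _ /=; exact: mem_last.
have bu e : b (u e) = Some (src (val e)) by apply: bq.
have bz e : b (z e) = Some (tgt (val e)) by have [_ _ zB _ _] := fP e; apply: bB.
have ex e : exists ho : torus_edge (m + K) * bool, (torus_src ho.1, torus_tgt ho.1) =
      if ho.2 then (to_torus (z e), to_torus (u e)) else (to_torus (u e), to_torus (z e)).
  apply: edgeP (bu e) (bz e) _ _.
    by have [pth _ _ _ _] := fP e; move: pth; rewrite rcons_path => /andP[].
  by move=> uz; have := bu e; rewrite uz bz => -[st]; have := valP e; rewrite st eqxx.
have [ho hoE] := choice ex.
pose c e := (ho e).1; pose o e := (ho e).2.
have bsc e : bT (torus_src (c e)) = Some (if o e then tgt (val e) else src (val e)).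
  have := hoE e; rewrite -/(c e) -/(o e); case: (o e) => -[-> _]; exact: bTE.
have btc e : bT (torus_tgt (c e)) = Some (if o e then src (val e) else tgt (val e)).
  have := hoE e; rewrite -/(c e) -/(o e); case: (o e) => -[_ ->]; exact: bTE.
have c_inj : injective c.
  move=> e e' ce; have := hoE e; have := hoE e'; rewrite -/(c e) -/(c e') ce => ->.
  have [_ _ zB _ _] := fP e; have [_ _ zB' _ _] := fP e'.
  have [_ _ _ _ /(_ _ (uq e)) [_ nB]] := fP e; have [_ _ _ _ /(_ _ (uq e')) [_ nB']] := fP e'.
  have inj g g' v v' : b g = Some v -> b g' = Some v' -> to_torus g = to_torus g' -> g = g'.
    by move=> bg bg' gg'; rewrite -(b_torusK _ _ bg) gg' (b_torusK _ _ bg').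
  have same : to_torus (u e') = to_torus (u e) -> e = e'.
    by move=> /(inj _ _ _ _ (bu e') (bu e)) uu; apply: (q_disj _ _ (u e)) => //; rewrite -uu.
  have diff : to_torus (u e') = to_torus (z e) -> e = e'.
    move=> /(inj _ _ _ _ (bu e') (bz e)) uz; have := nB' (tgt (val e)); by rewrite uz zB.
  case: (ho e').2 (ho e).2 => [] [] h; have /= h1 := congr1 fst h; have /= h2 := congr1 snd h.
  - exact: same.
  - exact: diff.
  - exact: diff.
  - exact: same.
apply: (@has_dual_loops _ _ (@src G) (@tgt G) E' val val_inj) => [e|].
  apply: (iffP idP) => [ne|[e' ->]]; last by case: e'.
  by exists (exist _ e ne).
apply: (@has_dual_reorient _ _ (@src G \o val) (@tgt G \o val) o).
have kept0 h : kept (@torus_src (m + K)) (@torus_tgt (m + K)) bT c h ->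
    exists v v', bT (torus_src h) = Some v /\ bT (torus_tgt h) = Some v'.
  case/orP => [/andP[/eqP <-]|/codomP[e ->]]; last by do 2!eexists; split; [exact: bsc|exact: btc].
  by case: (bT _) => // v _; exists v, v.
apply: (@minor_has_dual _ _ _ (@torus_src (m + K)) (@torus_tgt (m + K))
  (@torus_left (m + K)) (@torus_right (m + K)) _ _ _ _ bT c) => //.
- exact: torus_cob_circulation.
(* All branches have coordinates between 1 and [m + K], so no kept edge has an end in row 0 or
   column 0. *)
- move=> w wc w0; apply: torus_circulation_cob => // h seam; apply: w0; apply/negP => /kept0[v [v' [h1 h2]]].
  have := b_range _ _ h1; have := b_range _ _ h2; rewrite /of_torus /=.
  case/and4P => + _ + _ /and4P[+ _ + _].
  by case: seam => [|[|[|]]] ->.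
- by move=> e /=; case: (o e); have := valP e; rewrite // eq_sym.
- move=> p p' v bp bp'; apply: connect_trans (conn_center _ _ bp) _.
  by rewrite rel_sym; apply: conn_center.
Qed.

End Branches.

From mathcomp Require Import classical_sets reals ereal.
Require Import Defs.

(** * Discretization of plane drawings *)

Section PlaneDrawings.
Import functions topology normedtype derive numFieldNormedType.Exports.
Local Open Scope classical_set_scope.
Local Open Scope ring_scope.

Section Compactness.
Variable R : realType.

(** Retraction onto the unit interval: composed with it, an arc that is continuous only within the
    interval becomes continuous on the whole line. *)
Definition clamp (t : R) : R := Num.max 0 (Num.min t 1).

Lemma clamp_id t : 0 <= t <= 1 -> clamp t = t.
Proof. by move=> /andP[t0 t1]; rewrite /clamp min_l // max_r. Qed.

Lemma clamp_itv t : 0 <= clamp t <= 1.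
Proof. by rewrite /clamp le_max lexx /= ge_max ler01 ge_min lexx orbT. Qed.

Lemma clamp_continuous : continuous clamp.
Proof.
move=> t; have h : (fun t : R => Num.min t 1 : R^o) x @[x --> t] --> Num.min t 1.
  apply: (@continuous_min R R (fun t => t) (fun=> 1) t); [exact: cvg_id|exact: cvg_cst].
by apply: (@continuous_max R R (fun=> 0) (fun t => Num.min t 1) t); [exact: cvg_cst|exact: h].
Qed.

Lemma continuous_clamp (T : topologicalType) (f : R -> T) :
  {within `[0, 1], continuous f} -> continuous (f \o clamp).
Proof.
move=> /subspace_continuousP cf t; apply: (@cvg_comp _ _ _ clamp f (nbhs t) (within `[0, 1] (nbhs (clamp t)))).
  move=> U WU; have cc : clamp s @[s --> t] --> clamp t := @clamp_continuous t.
  have h : nbhs t (clamp @^-1` [set y | `[0, 1]%classic y -> U y]) := cc _ WU.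
  change (nbhs t (clamp @^-1` U)); apply: filterS h => s /=; apply.
  rewrite in_itv /=; exact: clamp_itv.
have A : `[0, 1]%classic (clamp t) by rewrite /= in_itv /=; exact: clamp_itv.
exact: (cf (clamp t) A).
Qed.

Lemma square_min (theta : R -> R -> R) :
  continuous (fun p : R * R => theta p.1 p.2 : R^o) ->
  exists s0 t0, [/\ 0 <= s0 <= 1, 0 <= t0 <= 1 &
    forall s t, 0 <= s <= 1 -> 0 <= t <= 1 -> theta s0 t0 <= theta s t].
Proof.
move=> ct.
have [|||c cI cmin] := @compact_EVT_min _ _ (fun p : R * R => theta p.1 p.2) (`[0, 1] `*` `[0, 1]).
- by exists (0, 0); split => /=; rewrite in_itv /= lexx ler01.
- by apply: compact_setX; apply: segment_compact.
- exact: continuous_subspaceT.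
move: cI; rewrite inE => -[] /=; rewrite !in_itv /= => c1 c2; exists c.1, c.2; split => // s t s01 t01.
by apply: (cmin (s, t)); rewrite inE /=; split; rewrite /= in_itv.
Qed.

Lemma square_lower_bound (theta : R -> R -> R) :
  continuous (fun p : R * R => theta p.1 p.2 : R^o) ->
  (forall s t, 0 <= s <= 1 -> 0 <= t <= 1 -> 0 < theta s t) ->
  exists2 d, 0 < d & forall s t, 0 <= s <= 1 -> 0 <= t <= 1 -> d <= theta s t.
Proof.
move=> /square_min[s0 [t0 [s01 t01 le]]] pos.
by exists (theta s0 t0); [apply: pos|].
Qed.

Lemma common_bound (I : finType) (Q : I -> R -> Prop) :
  (forall i d d', 0 < d' -> d' <= d -> Q i d -> Q i d') ->
  (forall i, exists2 d, 0 < d & Q i d) -> exists2 d, 0 < d & forall i, Q i d.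
Proof.
move=> mono ex.
have [f fP] := choice (fun i => let: ex_intro2 d d0 Qd := ex i in
  ex_intro (fun d => 0 < d /\ Q i d) d (conj d0 Qd)).
exists (\big[Num.min/1]_i f i).
  by elim/big_ind: _ => // [x y|i _]; [rewrite lt_min => -> ->|case: (fP i)].
move=> i; have [fi Qi] := fP i; apply: mono Qi.
  by elim/big_ind: _ => // [x y|j _]; [rewrite lt_min => -> ->|case: (fP j)].
have := mem_index_enum i; elim: (index_enum I) => // j r IHr.
rewrite big_cons inE ge_min => /predU1P[->|/IHr->]; by rewrite ?lexx ?orbT.
Qed.

Definition dist (p q : R * R) : R := Num.max `|p.1 - q.1| `|p.2 - q.2|.

Lemma dist_ltE p q c : (dist p q < c) = (`|p.1 - q.1| < c) && (`|p.2 - q.2| < c).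
Proof. by rewrite /dist gt_max. Qed.

Lemma dist_gt0 p q : p <> q -> 0 < dist p q.
Proof.
move=> pq; rewrite lt_neqAle eq_sym; apply/andP; split; last by rewrite le_max normr_ge0.
apply/eqP => d0; apply: pq; case: p q d0 => [p1 p2] [q1 q2]; rewrite /dist /= => d0.
have : Num.max `|p1 - q1| `|p2 - q2| <= 0 by rewrite d0.
by rewrite ge_max !normr_le0 !subr_eq0 => /andP[/eqP-> /eqP->].
Qed.

Lemma distxx p : dist p p = 0.
Proof. by rewrite /dist !subrr normr0 maxxx. Qed.

Lemma continuous_maxr (T : topologicalType) (g h : T -> R^o) :
  continuous g -> continuous h -> continuous (fun x => Num.max (g x) (h x) : R^o).
Proof. by move=> cg ch x; apply: (@continuous_max R T g h x); [exact: cg|exact: ch]. Qed.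

Lemma continuous_minr (T : topologicalType) (g h : T -> R^o) :
  continuous g -> continuous h -> continuous (fun x => Num.min (g x) (h x) : R^o).
Proof. by move=> cg ch x; apply: (@continuous_min R T g h x); [exact: cg|exact: ch]. Qed.

Lemma continuous_subr (T : topologicalType) (g h : T -> R^o) :
  continuous g -> continuous h -> continuous (fun x => g x - h x : R^o).
Proof. by move=> cg ch x; apply: cvgB; [exact: cg|exact: ch]. Qed.

Lemma continuous_fstc (U : topologicalType) (g : R -> U) :
  continuous g -> continuous (fun p : R * R => g p.1).
Proof.
move=> cg p; apply: (@cvg_comp _ _ _ (fun p : R * R => p.1) g _ (nbhs p.1)); [exact: cvg_fst|exact: cg].
Qed.

Lemma continuous_sndc (U : topologicalType) (g : R -> U) :
  continuous g -> continuous (fun p : R * R => g p.2).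
Proof.
move=> cg p; apply: (@cvg_comp _ _ _ (fun p : R * R => p.2) g _ (nbhs p.2)); [exact: cvg_snd|exact: cg].
Qed.

Lemma continuous_dist (T : topologicalType) (g h : T -> R * R) :
  continuous g -> continuous h -> continuous (fun x => dist (g x) (h x) : R^o).
Proof.
move=> cg ch.
have c1 (k : T -> R * R) : continuous k -> continuous (fun x => (k x).1 : R^o).
  by move=> ck x; apply: (@cvg_comp _ _ _ k (fun p : R * R => p.1) _ (nbhs (k x))); [exact: ck|exact: cvg_fst].
have c2 (k : T -> R * R) : continuous k -> continuous (fun x => (k x).2 : R^o).
  by move=> ck x; apply: (@cvg_comp _ _ _ k (fun p : R * R => p.2) _ (nbhs (k x))); [exact: ck|exact: cvg_snd].
have cn (k : T -> R^o) : continuous k -> continuous (fun x => `|k x| : R^o).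
  by move=> ck x; apply: cvg_norm; apply: ck.
by apply: continuous_maxr; apply: cn; apply: continuous_subr; do ?[exact: c1|exact: c2].
Qed.

End Compactness.

Section Cells.
Variables (R : realType) (M : R) (S : R) (L : nat).
Hypothesis M0 : 0 < M.

(** Squares of side [1 / M]. The shift by [S] makes the coordinates of bounded points nonnegative
    before truncation, and [L] leaves a margin below and to the left. *)
Definition cell (p : R * R) : nat * nat :=
  ((Num.truncn (M * (p.1 + S)) + L)%N, (Num.truncn (M * (p.2 + S)) + L)%N).

Lemma truncn_le_add (a b : R) k : 0 <= a -> 0 <= b -> a < b + k%:R ->
  (Num.truncn a <= Num.truncn b + k)%N.
Proof.
move=> /truncn_itv/andP[a1 _] /truncn_itv/andP[_ b2] ab.
by rewrite -ltnS -addSn -(ltr_nat R) natrD; lra.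
Qed.

Lemma lt_of_truncn_le (a b : R) k : 0 <= a -> 0 <= b ->
  (Num.truncn a <= Num.truncn b + k)%N -> a < b + k.+1%:R.
Proof.
move=> /truncn_itv/andP[_ a2] /truncn_itv/andP[b1 _].
rewrite -(ler_nat R) natrD => ab; move: a2; rewrite -[k.+1]addn1 -[(Num.truncn a).+1]addn1 !natrD; lra.
Qed.

Definition bounded (p : R * R) := (`|p.1| <= S) && (`|p.2| <= S).

Lemma bounded_ge0 p : bounded p -> 0 <= M * (p.1 + S) /\ 0 <= M * (p.2 + S).
Proof.
rewrite /bounded !ler_norml => /andP[/andP[h1 _] /andP[h2 _]].
by split; (apply: mulr_ge0; first exact: ltW); rewrite -lerBlDr sub0r.
Qed.

Lemma cell_near p q k : bounded p -> bounded q -> dist p q * M < k%:R ->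
  box_near k (cell p) (cell q).
Proof.
move=> /bounded_ge0[p1 p2] /bounded_ge0[q1 q2]; rewrite -ltr_pdivlMr // dist_ltE.
rewrite !ltr_pdivlMr //= => /andP[d1 d2]; rewrite /box_near /cell /= !(addnAC _ L) !leq_add2r.
have h (x y : R) : `|x - y| * M < k%:R -> M * (x + S) < M * (y + S) + k%:R /\ M * (y + S) < M * (x + S) + k%:R.
  rewrite -{1}(gtr0_norm M0) -normrM ltr_norml mulrBl !mulrDr !(mulrC M).
  by move: (x * M) (y * M) (S * M) (k%:R : R) => u v t c /andP[a b]; split; lra.
have [h1 h2] := h _ _ d1; have [h3 h4] := h _ _ d2.
by apply/and4P; split; apply: truncn_le_add.
Qed.

Lemma box_near_cell p q k : bounded p -> bounded q -> box_near k (cell p) (cell q) ->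
  dist p q * M < k.+1%:R.
Proof.
move=> /bounded_ge0[p1 p2] /bounded_ge0[q1 q2].
rewrite /box_near /cell /= !(addnAC _ L) !leq_add2r => /and4P[h1 h2 h3 h4].
rewrite -ltr_pdivlMr // dist_ltE !ltr_pdivlMr //.
have h (x y : R) : M * (x + S) < M * (y + S) + k.+1%:R -> M * (y + S) < M * (x + S) + k.+1%:R ->
    `|x - y| * M < k.+1%:R.
  rewrite -{5}(gtr0_norm M0) -normrM ltr_norml mulrBl !mulrDr !(mulrC M).
  by move: (x * M) (y * M) (S * M) (k.+1%:R : R) => u v t c a b; apply/andP; split; lra.
by apply/andP; split; apply: h; apply: lt_of_truncn_le.
Qed.

End Cells.

Section Discretize.
Variables (R : realType) (G : digraph).
Variables (pos : vertex G -> R * R) (arc : edge G -> R -> R * R).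
Hypothesis pos_inj : injective pos.
Hypothesis arcP : forall e, [/\ {within `[0, 1], continuous (arc e)},
  arc e 0 = pos (src e) & arc e 1 = pos (tgt e)].
Hypothesis arc_cross : forall e f s t, s \in `[0, 1] -> t \in `]0, 1[ ->
  arc e s = arc f t -> e = f /\ s = t.
Hypothesis arc_pos : forall e v t, t \in `]0, 1[ -> arc e t <> pos v.

Let gam e : R -> R * R := arc e \o @clamp R.

Lemma gam_continuous e : continuous (gam e).
Proof. by have [c _ _] := arcP e; apply: continuous_clamp. Qed.

Lemma gam0 e : gam e 0 = pos (src e).
Proof. by have [_ a0 _] := arcP e; rewrite /gam /= clamp_id ?lexx ?ler01. Qed.

Lemma gam1 e : gam e 1 = pos (tgt e).
Proof. by have [_ _ a1] := arcP e; rewrite /gam /= clamp_id ?lexx ?ler01. Qed.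

Lemma gam_cases e t : 0 <= t <= 1 ->
  [\/ t = 0, t = 1 | (t \in `]0, 1[) /\ gam e t = arc e t].
Proof.
move=> t01; have [->|t0] := eqVneq t 0; first by constructor 1.
have [->|t1] := eqVneq t 1; first by constructor 2.
constructor 3; split; last by rewrite /gam /= clamp_id.
by case/andP: t01 => h0 h1; rewrite in_itv /= !lt_neqAle eq_sym t0 h0 t1 h1.
Qed.

Lemma separation : exists2 eta, 0 < eta &
  (forall x y, x != y -> eta <= dist (pos x) (pos y)) /\
  (forall e x t, src e != x -> tgt e != x -> 0 <= t <= 1 -> eta <= dist (gam e t) (pos x)).
Proof.
have [|xy|d1 d10 P1] := @common_bound R (vertex G * vertex G)%type
  (fun xy d => xy.1 != xy.2 -> d <= dist (pos xy.1) (pos xy.2)).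
- by move=> xy d d' _ dd h /h; apply: le_trans.
- have [xy'|xy'] := eqVneq xy.1 xy.2; first by exists 1.
  exists (dist (pos xy.1) (pos xy.2)) => //; apply: dist_gt0 => /pos_inj.
  exact/eqP.
have [|[e x]|d2 d20 P2] := @common_bound R (edge G * vertex G)%type
  (fun ex d => src ex.1 != ex.2 -> tgt ex.1 != ex.2 -> forall t, 0 <= t <= 1 -> d <= dist (gam ex.1 t) (pos ex.2)).
- by move=> ex d d' _ dd h h1 h2 t t01; apply: le_trans dd (h h1 h2 t t01).
- have [sx|sx] := eqVneq (src e) x; first by exists 1 => //= /negP; rewrite sx eqxx.
  have [tx|tx] := eqVneq (tgt e) x; first by exists 1 => //= _ /negP; rewrite tx eqxx.
  have [||d d0 dP] := @square_lower_bound R (fun s t => dist (gam e s) (pos x)).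
  + apply: (continuous_fstc (g := fun s => dist (gam e s) (pos x))).
    by apply: continuous_dist; [exact: gam_continuous|move=> ?; exact: cvg_cst].
  + move=> s t s01 _; apply: dist_gt0.
    case: (gam_cases e s01) => [->|->|[s01' ->]]; last exact: arc_pos.
      by rewrite gam0 => /pos_inj/eqP; apply/negP.
    by rewrite gam1 => /pos_inj/eqP; apply/negP.
  by exists d => //= _ _ t t01; apply: (dP t 0); rewrite ?lexx ?ler01.
exists (Num.min d1 d2); first by rewrite lt_min d10.
split=> [x y xy|e x t h1 h2 t01].
  by rewrite ge_min (P1 (x, y)).
by rewrite ge_min (P2 (e, x)) ?orbT.
Qed.

(** The maximum of the distance and of [r - rho f t] is positive on the compact square: where the
    distance vanishes, [arc_cross] leaves only the ends of [f], and there [rho] is 0. Its minimum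
    serves as [d]. *)
Lemma clearance r : 0 < r -> exists2 d, 0 < d &
  forall e f s t, e != f -> 0 <= s <= 1 -> 0 <= t <= 1 -> dist (gam e s) (gam f t) < d ->
    dist (gam f t) (pos (src f)) < r \/ dist (gam f t) (pos (tgt f)) < r.
Proof.
move=> r0.
pose rho f t := Num.min (dist (gam f t) (pos (src f))) (dist (gam f t) (pos (tgt f))).
have [|[e f]|d d0 dP] := @common_bound R (edge G * edge G)%type
  (fun ef d => ef.1 != ef.2 -> forall s t, 0 <= s <= 1 -> 0 <= t <= 1 ->
     d <= Num.max (dist (gam ef.1 s) (gam ef.2 t)) (r - rho ef.2 t)).
- by move=> ef d d' _ dd h h1 s t s01 t01; apply: le_trans dd (h h1 s t s01 t01).
- have [ef|ef] := eqVneq e f; first by exists 1 => //= /negP; rewrite ef eqxx.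
  have [||d d0 dP] := @square_lower_bound R
      (fun s t => Num.max (dist (gam e s) (gam f t)) (r - rho f t)).
  + apply: continuous_maxr.
      by apply: continuous_dist; [apply: continuous_fstc|apply: continuous_sndc]; exact: gam_continuous.
    apply: continuous_subr; first by move=> ?; exact: cvg_cst.
    apply: (continuous_sndc (g := rho f : R -> R^o)); apply: continuous_minr; apply: continuous_dist;
      by [exact: gam_continuous|move=> ?; exact: cvg_cst].
  + move=> s t s01 t01; rewrite lt_max.
    have [E|/dist_gt0->//] := pselect (gam e s = gam f t).
    apply/orP; right; rewrite subr_gt0 /rho gt_min.
    case: (gam_cases f t01) => [->|->|[t01' tE]].
    * by rewrite gam0 distxx r0.
    * by rewrite gam1 distxx r0 orbT.
    have : arc e s = arc f t by rewrite -tE -E /gam /= clamp_id.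
    move=> /arc_cross -/(_ _ t01')[|ef' _]; first by rewrite in_itv.
    by move: ef; rewrite ef' eqxx.
  by exists d => //= _ s t; apply: dP.
exists d => // e f s t ef s01 t01 lt; have := dP (e, f) ef s t s01 t01.
rewrite le_max /= leNgt lt /= => h; have : rho f t < r by lra.
by rewrite /rho gt_min => /orP.
Qed.

Lemma gam_bounded : exists S, (forall e t, 0 <= t <= 1 -> bounded S (gam e t)) /\
  (forall x, bounded S (pos x)).
Proof.
have ex e : exists2 S, 0 < S & forall t, 0 <= t <= 1 -> dist (gam e t) (0, 0) <= S.
  have [|s0 [t0 [_ _ le]]] := @square_min R (fun s t => - dist (gam e s) (0, 0)).
    apply: (continuous_fstc (g := fun s => - dist (gam e s) (0, 0) : R^o)).
    move=> s; apply: cvgN; apply: continuous_dist; [exact: gam_continuous|move=> ?; exact: cvg_cst].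
  exists (`|dist (gam e s0) (0, 0)| + 1) => [|t t01]; first by rewrite ltr_wpDl.
  have := le t 0 t01; rewrite lexx ler01 lerN2 => /(_ isT) h.
  by apply: le_trans h _; rewrite (le_trans (ler_norm _)) // lerDl.
have [f fP] := choice (fun e => let: ex_intro2 B B0 BP := ex e in
  ex_intro (fun B => 0 < B /\ forall t, 0 <= t <= 1 -> dist (gam e t) (0, 0) <= B) B (conj B0 BP)).
have bnd e t : 0 <= t <= 1 -> bounded (\sum_e f e) (gam e t).
  move=> t01; have [f0 /(_ t t01)] := fP e.
  rewrite /dist ge_max /= !subr0 /bounded => /andP[h1 h2].
  have : f e <= \sum_e f e.
    by rewrite (bigD1 e) //= lerDl; apply: sumr_ge0 => e' _; case: (fP e') => /ltW.
  by move=> h; rewrite (le_trans h1 h) (le_trans h2 h).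
exists (\sum_e f e); split => // x; have [e [<-|<-]] := no_isolated x.
  by rewrite -gam0; apply: bnd; rewrite lexx ler01.
by rewrite -gam1; apply: bnd; rewrite lexx ler01.
Qed.

(** Uniform continuity from compactness: the maximum of [|s - t|] and
    [M^-1 - dist (gam e s) (gam e t)] has a positive lower bound [d], so parameters closer than [d]
    give points closer than [M^-1]. *)
Lemma uniform_steps e M : 0 < M -> exists n, forall s t, 0 <= s <= 1 -> 0 <= t <= 1 ->
  `|s - t| * n.+1%:R <= 1 -> dist (gam e s) (gam e t) * M < 1.
Proof.
move=> M0; have [||d d0 dP] := @square_lower_bound R
    (fun s t => Num.max `|s - t| (M^-1 - dist (gam e s) (gam e t))).
- apply: continuous_maxr.
    move=> p; apply: cvg_norm; apply: cvgB; [exact: cvg_fst|exact: cvg_snd].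
  apply: continuous_subr; first by move=> ?; exact: cvg_cst.
  by apply: continuous_dist; [apply: continuous_fstc|apply: continuous_sndc]; exact: gam_continuous.
- move=> s t _ _; rewrite lt_max; have [->|st] := eqVneq s t.
    by rewrite distxx subr0 invr_gt0 M0 orbT.
  by rewrite normr_gt0 subr_eq0 st.
exists (Num.truncn d^-1) => s t s01 t01 st; have := dP s t s01 t01.
have lt : `|s - t| < d.
  have dn : d^-1 < (Num.truncn d^-1).+1%:R by have /truncn_itv/andP[] : 0 <= d^-1 by rewrite invr_ge0 ltW.
  have n0 : 0 < (Num.truncn d^-1).+1%:R :> R by rewrite ltr0n.
  have : 1 < d * (Num.truncn d^-1).+1%:R by rewrite -ltr_pdivrMl // mulr1.
  by move=> h; rewrite -(ltr_pM2r n0); apply: le_lt_trans st h.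
rewrite le_max leNgt lt /= => h; rewrite -ltr_pdivlMr // mul1r; lra.
Qed.

Lemma discretize : exists m K P N, @discrete_drawing G m K P N.
Proof.
have [eta eta0 [sepv sepe]] := separation.
have r0 : 0 < eta / 4 by rewrite divr_gt0.
have [d d0 clr] := clearance r0; have [S [bg bp]] := gam_bounded.
(* Points whose cells are 2 apart are at distance below [3 / M], hence below [d] as [5 <= M * d].
   The bound [100 <= M * eta] absorbs rounding: [2 * K + 3] is [2 * k0 + 13], at most
   [M * eta / 2 + 13]. *)
pose M := 5 / d + 100 / eta.
have M0 : 0 < M by rewrite addr_gt0 // divr_gt0.
have Md : 5 <= M * d by rewrite mulrDl divfK ?gt_eqF // lerDl mulr_ge0 ?divr_ge0 // ltW.
have Meta : 100 <= M * eta.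
  by rewrite mulrDl [X in _ <= _ + X]divfK ?gt_eqF // lerDr mulr_ge0 ?divr_ge0 // ltW.
pose k0 := Num.truncn (eta / 4 * M).
have [k0l k0u] : k0%:R <= eta / 4 * M /\ eta / 4 * M < k0%:R + 1.
  have /truncn_itv/andP[] : 0 <= eta / 4 * M by rewrite mulr_ge0 // ltW.
  by rewrite -[(Num.truncn _).+1]addn1 natrD.
have etaM : M * eta = 4 * (eta / 4 * M) by field.
(* [k0] is the radius [eta / 4] in grid units, and [K] also covers the rounding of cells and the
   radius 1 in [N]. The margin [K.+2] keeps squares and walks off row 0 and column 0. *)
pose K := (k0 + 5)%N; pose c := cell M S K.+2.
have cnear p q k : bounded S p -> bounded S q -> dist p q * M < k%:R -> box_near k (c p) (c q).
  exact: cell_near.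
have nearc p q k : bounded S p -> bounded S q -> box_near k (c p) (c q) -> dist p q * M < k.+1%:R.
  exact: box_near_cell.
pose P x := c (pos x).
(* Radius 1 admits the corners that the grid walk passes between two samples of the arc. *)
pose N e g := exists t, 0 <= t <= 1 /\ box_near 1 g (c (gam e t)).
exists (Num.truncn (M * (S + S)) + 2 * K + 10)%N, K, P, N; split.
- move=> e; have [n step] := uniform_steps e M0; pose t_ k : R := k%:R / n.+1%:R.
  have n0 : 0 < n.+1%:R :> R by rewrite ltr0n.
  have t01 k : (k <= n.+1)%N -> 0 <= t_ k <= 1.
    by move=> kn; rewrite divr_ge0 ?ler0n //= ler_pdivrMr // mul1r ler_nat.
  suff path_to k : (k <= n.+1)%N -> exists q : seq (nat * nat),
      [/\ path grid_adj (P (src e)) q, last (P (src e)) q = c (gam e (t_ k))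
        & forall g, g \in P (src e) :: q -> N e g].
    have [q [pq lq Nq]] := path_to n.+1 (leqnn _); exists q; split => //.
    by rewrite lq /t_ divff ?gt_eqF // gam1.
  elim: k => [_|k IHk kn].
    exists [::]; split => //=; first by rewrite /t_ mul0r gam0.
    move=> g; rewrite inE => /eqP->; exists 0; rewrite lexx ler01 gam0; split => //.
    exact: box_near_refl.
  have [q [pq lq Nq]] := IHk (ltnW kn).
  have tk := t01 _ kn; have tk' := t01 _ (ltnW kn).
  have stp : box_near 1 (c (gam e (t_ k))) (c (gam e (t_ k.+1))).
    apply: cnear; [exact: bg|exact: bg|apply: step => //].
    rewrite /t_ -mulrBl -[k.+1]addn1 natrD opprD addNKr normrM normrN1 mul1r gtr0_norm ?invr_gt0 //.
    by rewrite mulVf ?gt_eqF.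
  set a := c _ in stp lq; set b := c _ in stp.
  (* Consecutive samples may lie in diagonally adjacent cells; the corner turns the diagonal into
     two grid steps. *)
  exists (q ++ [:: (b.1, a.2); b]); split.
  + have /andP[h1 h2] := box_near1_adj stp.
    have -> : path grid_adj (P (src e)) (q ++ [:: (b.1, a.2); b]) =
        path grid_adj (P (src e)) q && (grid_adj (last (P (src e)) q) (b.1, a.2)
          && (grid_adj (b.1, a.2) b && true)) by rewrite cat_path.
    by rewrite pq lq h1 h2.
  + by rewrite last_cat.
  + move=> g; rewrite -cat_cons mem_cat => /orP[/Nq//|].
    rewrite !inE => /orP[] /eqP->; exists (t_ k.+1); split => //; rewrite -/b /=.
      exact: (box_near1_corner stp).
    exact: box_near_refl.
- move=> x y xy; apply/negP => /(nearc _ _ _ (bp x) (bp y)).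
  have := sepv x y xy; rewrite -(ler_pM2r M0) => h1 h2.
  have : (2 * K + 2).+1%:R = 2 * k0%:R + 13 :> R by rewrite /K; ring.
  by move: h2 => /[swap] -> h2; lra.
- move=> e x g sx tx [t [t01 gt]]; apply/negP => gx.
  have : box_near K.+1 (c (gam e t)) (c (pos x)).
    by rewrite -add1n; apply: box_near_trans (box_near_sym gt) gx.
  move=> /(nearc _ _ _ (bg e t t01) (bp x)).
  have := sepe e x t sx tx t01; rewrite -(ler_pM2r M0) => h1 h2.
  have : K.+2%:R = k0%:R + 7 :> R by rewrite /K; ring.
  by move: h2 => /[swap] -> h2; lra.
- move=> e f g ef [s [s01 gs]] [t [t01 gt]].
  have : box_near 2 (c (gam e s)) (c (gam f t)) by exact: (box_near_trans (box_near_sym gs) gt).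
  move=> /(nearc _ _ _ (bg e s s01) (bg f t t01)) h.
  have dd : dist (gam e s) (gam f t) < d by rewrite -(ltr_pM2r M0); lra.
  have fin x : dist (gam f t) (pos x) < eta / 4 -> box_near K g (P x).
    rewrite -(ltr_pM2r M0) => lt.
    have : box_near k0.+1 (c (gam f t)) (P x).
      by apply: cnear; [exact: bg|exact: bp|rewrite -[k0.+1]addn1 natrD; lra].
    by move=> h'; apply: box_near_leq (box_near_trans gt h'); rewrite /K add1n -addn2 leq_add2l.
  by have [/fin|/fin] := clr e f s t ef s01 t01 dd; [exists (src f)|exists (tgt f)].
- have up p : bounded S p -> in_box K.+2 (Num.truncn (M * (S + S)) + 1 + K.+2) (c p).
    move=> bpp; have [p1 p2] := bounded_ge0 M0 bpp; rewrite /in_box /c /cell /= !leq_addl !leq_add2r /=.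
    move: bpp; rewrite /bounded !ler_norml => /andP[/andP[_ h1] /andP[_ h2]].
    have S0 : 0 <= M * (S + S) by apply: le_trans p1 _; rewrite ler_pM2l // lerD2r.
    by apply/andP; split; apply: truncn_le_add => //; apply: ltr_pwDr => //; rewrite ler_pM2l // lerD2r.
  move: (Num.truncn _) up => u up; split=> [e g [t [t01 gt]]|x].
    apply: in_box_leq (in_box_near1 gt (up _ (bg e t t01))) => //.
    clear; rewrite /K; lia.
  apply: in_box_leq (up _ (bp x)) => //; clear; rewrite /K; lia.
Qed.

End Discretize.

Lemma planar_discrete_drawing (R : realType) (G : digraph) : planar G R ->
  exists m K P N, @discrete_drawing G m K P N.
Proof. by case=> pos [arc [inj arcP cross avoid]]; apply: (discretize inj arcP cross avoid). Qed.

End PlaneDrawings.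

Lemma planar_alpha_beta (R : realType) (G : digraph) : planar G R -> alpha G = beta G.
Proof.
move=> /planar_discrete_drawing[m [K [P [N draw]]]].
exact: has_dual_alpha_beta (drawing_has_dual draw).
Qed.

Local Open Scope ring_scope.

(** * Prime ideals and Krull dimension *)

Section PrimeIdeals.
Variables (A : comPzRingType) (P : set A).
Hypothesis Pp : prime_ideal P.

Lemma prime0 : P 0. Proof. by case: Pp. Qed.
Lemma primeD x y : P x -> P y -> P (x + y). Proof. by case: Pp => _ + _ _ _; apply. Qed.
Lemma primeMl a x : P x -> P (a * x). Proof. by case: Pp => _ _ + _ _; apply. Qed.
Lemma primeMr a x : P x -> P (x * a). Proof. by rewrite mulrC; apply: primeMl. Qed.
Lemma primeN x : P x -> P (- x). Proof. by rewrite -mulN1r; apply: primeMl. Qed.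
Lemma primeB x y : P x -> P y -> P (x - y).
Proof. by move=> Px Py; apply: primeD => //; apply: primeN. Qed.
Lemma prime1 : ~ P 1. Proof. by case: Pp. Qed.
Lemma primeM x y : P (x * y) -> P x \/ P y. Proof. by case: Pp => _ _ _ _; apply. Qed.

Lemma prime_eqmod x y : P (x - y) -> P x <-> P y.
Proof.
move=> Pxy; split=> [Px|Py]; last by rewrite -(subrK y x); apply: primeD.
by rewrite -[y]opprK -(subKr x y) opprK; apply: primeB.
Qed.

Lemma prime_sum (I : Type) (r : seq I) (Q : pred I) (F : I -> A) :
  (forall i, Q i -> P (F i)) -> P (\sum_(i <- r | Q i) F i).
Proof. by move=> PF; elim/big_ind: _ => //; [exact: prime0|exact: primeD]. Qed.

Lemma primeX x n : P (x ^+ n) -> P x.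
Proof. by elim: n => [/prime1//|n IHn]; rewrite exprS => /primeM[]. Qed.

Lemma prime_prod (I : eqType) (r : seq I) (F : I -> A) :
  P (\prod_(i <- r) F i) -> exists2 i, i \in r & P (F i).
Proof.
elim: r => [|i r IHr]; first by rewrite big_nil => /prime1.
rewrite big_cons => /primeM[PFi|/IHr[j jr PFj]]; first by exists i; rewrite ?mem_head.
by exists j; rewrite // inE jr orbT.
Qed.

Lemma prime_chain_le n p i : @prime_chain A n p -> (i <= n)%N ->
  forall x, p 0 x -> p i x.
Proof.
case=> _ inc; elim: i => // i IHi lin x p0x.
by have [+ _] := inc i lin; apply; apply: IHi => //; apply: ltnW.
Qed.

End PrimeIdeals.

Lemma prime_ideal_comap (A B : comPzRingType) (f : {rmorphism A -> B}) (P : set B) :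
  prime_ideal P -> prime_ideal (fun x => P (f x)).
Proof.
move=> Pp; split.
- by rewrite rmorph0; apply: prime0.
- by move=> x y; rewrite rmorphD; apply: primeD.
- by move=> x y; rewrite rmorphM; apply: primeMl.
- by rewrite rmorph1; apply: prime1.
- by move=> x y; rewrite rmorphM; apply: primeM.
Qed.

Section KrullDimension.
Variable T : realType.

Lemma krull_dim_eq (A : comPzRingType) n :
  (exists p, @prime_chain A n p) ->
  (forall m p, @prime_chain A m p -> (m <= n)%N) ->
  krull_dim T A = (n%:R)%:E.
Proof.
move=> chn le; apply/eqP; rewrite eq_le; apply/andP; split.
  apply: ge_ereal_sup => _ [m [p mp] <-].
  by rewrite lee_fin ler_nat; apply: le mp.
by apply: ereal_sup_ubound; exists n.
Qed.

Variables (R : comPzRingType) (M : lmodType R).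

Lemma ann_piE r : ann_pi M r = 0 <-> r \in ann M.
Proof.
by rewrite -(quot_pi0 (ann_submod M)) /ann_pi quot_piP subr0.
Qed.

Lemma ann_piM x y : ann_pi M (x * y) = ann_pi M x * ann_pi M y.
Proof. by rewrite -ann_mul_pi. Qed.

Lemma prime_chain_ann n :
  (exists p, @prime_chain (ann_quot M) n p) <->
  (exists2 p, @prime_chain R n p & forall r, r \in ann M -> p 0 r).
Proof.
split=> [[p [pp inc]]|[p [pp inc] annp]].
  have ann_pi_rm : exists f : {rmorphism R -> ann_quot M}, f =1 ann_pi M.
    have zm : zmod_morphism (ann_pi M).
      move=> x y; apply: (addIr (ann_pi M y)); by rewrite subrK -ann_piD subrK.
    have mm : monoid_morphism (ann_pi M) by split=> // x y; rewrite -ann_mul_pi.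
    pose f1 := GRing.isZmodMorphism.Build _ _ (ann_pi M) zm.
    pose f2 := GRing.isMonoidMorphism.Build _ _ (ann_pi M) mm.
    pose f : {rmorphism R -> ann_quot M} := HB.pack (ann_pi M) f1 f2.
    by exists f.
  have [f fE] := ann_pi_rm; exists (fun i x => p i (f x)).
    split=> i lin; first exact: prime_ideal_comap (pp i lin).
    have [sub nsub] := inc i lin; split=> [x|h]; first exact: sub.
    apply: nsub => x; rewrite -[x]ann_reprK -fE; exact: h.
  by move=> r /ann_piE r0; rewrite fE r0; apply: prime0 (pp 0 _).
have repr_mod i x : (i <= n)%N -> p i (ann_repr (ann_pi M x) - x).
  move=> lin; apply: (@prime_chain_le _ n) => //; apply: annp.
  by apply/(quot_piP (ann_submod M)); apply: ann_reprK.
have pE i x : (i <= n)%N -> p i (ann_repr (ann_pi M x)) <-> p i x.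
  by move=> lin; apply: prime_eqmod (pp i lin) _ _ (repr_mod i x lin).
exists (fun i x => p i (ann_repr x)); split=> i lin.
  have ppi := pp i lin; split.
  - by rewrite -(quot_pi0 (ann_submod M)) -/(ann_pi M 0) pE //; apply: prime0.
  - move=> x y px py; rewrite -[x]ann_reprK -[y]ann_reprK -ann_piD pE //; exact: primeD.
  - move=> x y py; rewrite -[x]ann_reprK -[y]ann_reprK -ann_piM pE //; exact: primeMl.
  - rewrite -[1]/(ann_pi M 1) pE //; exact: prime1.
  - move=> x y; rewrite -{1}[x]ann_reprK -{1}[y]ann_reprK -ann_piM pE //; exact: primeM.
have [sub nsub] := inc i lin; split=> [x|h]; first exact: sub.
by apply: nsub => x /(pE i.+1 x lin).2 /h /pE; apply; apply: ltnW.
Qed.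

Lemma Kdim_eq n :
  (exists2 p, @prime_chain R n p & forall r, r \in ann M -> p 0 r) ->
  (forall m p, @prime_chain R m p -> (forall r, r \in ann M -> p 0 r) -> (m <= n)%N) ->
  Kdim T M = (n%:R)%:E.
Proof.
move=> /prime_chain_ann chn le; apply: krull_dim_eq => // m p mp.
have [q mq annq] : exists2 q, @prime_chain R m q & forall r, r \in ann M -> q 0 r.
  by apply/prime_chain_ann; exists p.
exact: le mq annq.
Qed.

End KrullDimension.

(* The lexicographically smallest monomial divides, up to a change of the
   coefficient, every other one at the step of the chain where they differ. *)
Lemma lex_chain_contra (A : comPzRingType) n (q : nat -> set A) (x : nat -> A)
    (J : finType) (D : {set J}) (c : J -> A) (ex : J -> nat -> nat) :
  prime_chain n q ->
  (forall i, (i < n)%N -> q i.+1 (x i) /\ ~ q i (x i)) ->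
  D != finset.set0 -> (forall j, j \in D -> ~ q n (c j)) ->
  {in D &, forall j k, (forall i, (i < n)%N -> ex j i = ex k i) -> j = k} ->
  ~ q 0%N (\sum_(j in D) c j * \prod_(i < n) x i ^+ ex j i).
Proof.
elim: n q x D ex => [|n IHn] q x D ex [qp inc] qx /finset.set0Pn[j0 jD] qc inj.
  rewrite (big_pred1 j0) => [|j]; first by rewrite big_ord0 mulr1; apply: qc.
  rewrite /=; apply/idP/eqP => [jD'|->//]; exact: inj.
have [k kD kmin] : exists2 k, k \in D & forall j, j \in D -> (ex k 0 <= ex j 0)%N.
  by case: (arg_minnP (fun j => ex j 0%N) jD) => k kD kmin; exists k.
pose D' := [set j in D | ex j 0%N == ex k 0%N]%SET.
have [q1x0 q0x0] := qx 0%N isT.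
have q0p : prime_ideal (q 0%N) := qp 0%N isT.
have q1p : prime_ideal (q 1%N) := qp 1%N isT.
(* The terms with a larger exponent of [x 0], after removal of the least power and of one further
   factor [x 0]. *)
pose Y := \sum_(j in D :\: D') c j * (x 0%N ^+ (ex j 0%N - ex k 0%N).-1 * \prod_(i < n) x i.+1 ^+ ex j i.+1).
have -> : \sum_(j in D) c j * \prod_(i < n.+1) x i ^+ ex j i
   = x 0%N ^+ ex k 0%N * (\sum_(j in D') c j * \prod_(i < n) x i.+1 ^+ ex j i.+1 + x 0%N * Y).
  rewrite mulrDr !mulr_sumr (bigID (fun j => ex j 0%N == ex k 0%N)) /=; congr (_ + _).
    apply: eq_big => [j|j /andP[_ /eqP ej]]; first by rewrite !inE.
    by rewrite big_ord_recl /= ej mulrCA.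
  apply: eq_big => [j|j /andP[jD' /eqP ej]]; first by rewrite !inE; case: (j \in D); rewrite ?andbF ?andbT.
  rewrite big_ord_recl /= mulrCA; have lt : (ex k 0 < ex j 0)%N.
    by rewrite ltn_neqAle kmin // andbT eq_sym; apply/eqP.
  rewrite -{1}(subnK (ltnW lt)) addnC exprD -[in LHS](prednK (n := _ - _)%N) ?subn_gt0 //.
  by rewrite exprS; set a := x 0%N ^+ _; set b := x 0%N ^+ _; set d := \prod_(_ < _) _; ring.
(* As [x 0] is outside [q 0], the cofactor of the least power lies in [q 0], hence in [q 1]. That
   prime contains [x 0 * Y], so the terms of least exponent remain and the shorter chain applies to
   them. *)
move=> /(primeM q0p)[/(primeX q0p)//|].
have [sub _] := inc 0%N isT; move=> /sub q1s.
have q1D : q 1%N (\sum_(j in D') c j * \prod_(i < n) x i.+1 ^+ ex j i.+1).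
  rewrite -[X in q _ X](addrK (x 0%N * Y)); apply: primeB => //; exact: primeMr.
apply: (IHn (fun i => q i.+1) (fun i => x i.+1) D' (fun j i => ex j i.+1)) q1D.
- by split=> i lin; [apply: qp|apply: inc].
- by move=> i lin; apply: qx.
- by apply/finset.set0Pn; exists k; rewrite inE kD eqxx.
- by move=> j; rewrite inE => /andP[/qc].
- move=> j1 j2; rewrite !inE => /andP[j1D /eqP e1] /andP[j2D /eqP e2] e12.
  by apply: inj => // -[_|i lin]; [rewrite e1 e2|apply: e12].
Qed.

(** * Multisets of nonzero residues modulo a prime ideal *)

Section CountModPrime.
Variables (A : comNzRingType) (P : set A).
Hypothesis Pp : prime_ideal P.
Implicit Types p q : {poly A}.

Let PP q := forall i, P q`_i.

Lemma PP_D p q : PP p -> PP q -> PP (p + q).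
Proof. by move=> Pp' Pq i; rewrite coefD; apply: primeD. Qed.

Lemma PP_M p q : PP q -> PP (p * q).
Proof. by move=> Pq i; rewrite coefM; apply: prime_sum => // j _; apply: primeMl. Qed.

Lemma PP_C a : P a -> PP a%:P.
Proof. by move=> Pa i; rewrite coefC; case: eqP => // _; apply: prime0. Qed.

Lemma PP_horner q z : PP q -> P q.[z].
Proof. by move=> Pq; rewrite horner_coef; apply: prime_sum => // i _; apply: primeMr. Qed.

(** The coefficient of index [i.+1] of the product gives [q]_i[modulo]P[as a multiple of]q[_i.+1];
    the descent starts above the degree. *)
Lemma PP_cancel z q : PP (('X - z%:P) * q) -> PP q.
Proof.
move=> Pq i; have [n] := ubnP (size q - i); elim: n i => // n IHn i ni.
have [si|si] := leqP (size q) i; first by rewrite nth_default //; apply: prime0.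
have := Pq i.+1; rewrite mulrBl coefB coefXM coefCM /= => Pi.
rewrite -(subrK (z * q`_i.+1) q`_i); apply: primeD => //; apply: primeMl => //.
by apply: IHn; lia.
Qed.

Let cls c := count (fun x => `[< P (x - c) >]).

Lemma perm_has (s : seq A) (Q : pred A) : has Q s -> exists x s', perm_eq s (x :: s') /\ Q x.
Proof. by move=> /hasP[x xs Qx]; exists x, (rem x s); rewrite perm_to_rem. Qed.

Lemma PsubC x y : P (x - y) -> P (y - x).
Proof. by move=> h; rewrite -opprB; apply: primeN. Qed.

Lemma Psub_trans x y z : P (x - y) -> P (y - z) -> P (x - z).
Proof. by move=> h1 h2; rewrite -(subrK y x) -addrA; apply: primeD. Qed.

(** Evaluation at a root [x] of the first product leaves the second one in [P]. Since [x] is not in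
    [P], some factor [x - y] is. *)
Lemma root_transfer (s t : seq A) a b c :
  PP ('X^a * \prod_(x <- s) ('X - x%:P) - 'X^b * \prod_(y <- t) ('X - y%:P)) ->
  ~ P c -> has (fun x => `[< P (x - c) >]) s -> exists2 y, y \in t & P (y - c).
Proof.
move=> Pst nPc /hasP[x xs /asboolP Pxc].
have nPx : ~ P x by move=> Px; apply: nPc; apply/(prime_eqmod Pp Pxc).
have := PP_horner x Pst; rewrite hornerD hornerN !hornerM !horner_prod.
rewrite [X in P (_ * X - _)](_ : _ = 0) ?mulr0 ?sub0r; last first.
  by rewrite (big_rem x xs) /= hornerXsubC subrr mul0r.
move=> /(primeN Pp); rewrite opprK => /(primeM Pp)[|/(prime_prod Pp)[y yt]].
  by rewrite hornerXn => /(primeX Pp).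
by rewrite hornerXsubC => Pxy; exists y => //; apply: Psub_trans Pxc; apply: PsubC.
Qed.

(** Congruent roots are removed in pairs: replacing [y] by [x] changes the second product by a
    polynomial with coefficients in [P], after which ['X - x%:P] cancels. The powers of ['X] leave
    the number of zero residues undetermined, whence the condition on [c]. *)
Lemma count_mod_prime (s t : seq A) a b :
  PP ('X^a * \prod_(x <- s) ('X - x%:P) - 'X^b * \prod_(y <- t) ('X - y%:P)) ->
  forall c, ~ P c -> cls c s = cls c t.
Proof.
have [n] := ubnP (size s); elim: n s t => // n IHn s t sn Pst c nPc.
have [hs|ns] := boolP (has (fun x => `[< P (x - c) >]) s); last first.
  have [ht|nt] := boolP (has (fun x => `[< P (x - c) >]) t); last first.
    by move: ns nt; rewrite !has_count -!eqn0Ngt /cls => /eqP-> /eqP->.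
  have [|x xs Pxc] := @root_transfer t s b a c _ nPc ht.
    by move=> i; rewrite -opprB coefN; apply: primeN.
  by case/negP: ns; apply/hasP; exists x => //; apply/asboolP.
have [x [s' [ps /asboolP Pxc]]] := perm_has hs.
have [y yt Pyc] := root_transfer Pst nPc hs.
have pt : perm_eq t (y :: rem y t) by exact: perm_to_rem.
set t' := rem y t in pt.
rewrite /cls (permP ps) (permP pt) /= (asboolT Pxc) (asboolT Pyc) -/(cls c s') -/(cls c t').
congr (_ + _)%N; apply: IHn nPc; first by move: sn; rewrite (perm_size ps).
apply: (@PP_cancel x); move: Pst; rewrite (perm_big _ ps) (perm_big _ pt) /= !big_cons => Pst.
have -> : ('X - x%:P) * ('X^a * \prod_(z <- s') ('X - z%:P) - 'X^b * \prod_(z <- t') ('X - z%:P))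
  = ('X^a * (('X - x%:P) * \prod_(z <- s') ('X - z%:P)) - 'X^b * (('X - y%:P) * \prod_(z <- t') ('X - z%:P)))
    + ('X^b * \prod_(z <- t') ('X - z%:P)) * (x - y)%:P.
  by rewrite polyCB; ring.
apply: PP_D => //; apply: PP_M; apply: PP_C; exact: Psub_trans Pxc (PsubC Pyc).
Qed.

End CountModPrime.

(** * Chains of primes containing I(G) *)

Lemma common_denominator (I : finType) (v : I -> rat) :
  exists2 d : int, d != 0 & exists c : I -> int, forall i, v i * d%:~R = (c i)%:~R.
Proof.
exists (\prod_i denq (v i)); first by apply/prodf_neq0 => i _; apply: denq_neq0.
exists (fun i => numq (v i) * \prod_(j | j != i) denq (v j)) => i.
rewrite (bigD1 i) //= !intrM mulrA; congr (_ * _).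
by rewrite -{1}[v i]divq_num_den divfK // intr_eq0 denq_neq0.
Qed.

Lemma mpoly_denominator n (g : {mpoly rat[n]}) :
  exists2 d : int, d != 0 &
    exists g' : {mpoly int[n]}, d%:~R * g = map_mpoly intr g'.
Proof.
have [d d0 [g' gE]] : exists2 d : int, d != 0 &
    exists g' : {mpoly int[n]}, forall m, d%:~R * g@_m = (g'@_m)%:~R.
  elim/mpolyind: g => [|c m p _ _ [d d0 [p' pE]]].
    by exists 1 => //; exists 0 => m; rewrite !mcoeff0 mulr0.
  exists (d * denq c); first by rewrite mulf_neq0 ?denq_neq0.
  exists ((d * numq c) *: 'X_[m] + (denq c) *: p') => k.
  rewrite !mcoeffD !mcoeffZ !mcoeffX mulrDr !(rmorphD, rmorphM) /= -pE rmorph_nat.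
  congr (_ + _); last by ring.
  have cE : (numq c)%:~R = c * (denq c)%:~R :> rat.
    by rewrite -{2}[c]divq_num_den divfK // intr_eq0 denq_neq0.
  by rewrite cE; ring.
exists d => //; exists g'; apply/mpolyP => m.
by rewrite mcoeff_map_mpoly /= -gE -(rmorph_int (@mpolyC n rat)) mcoeffCM.
Qed.

(** * Algebraic dependence of more polynomials than variables *)

Section Degree.
Variables (n : nat) (R : idomainType).
Implicit Types p q : {mpoly R[n]}.

Definition deg_le k p := forall m, p@_m != 0 -> (mdeg m <= k)%N.

Lemma deg_le_msize p : deg_le (msize p) p.
Proof. by move=> m; rewrite mcoeff_eq0 negbK => /msize_mdeg_lt/ltnW. Qed.

Lemma deg_leW k l p : (k <= l)%N -> deg_le k p -> deg_le l p.
Proof. by move=> kl pk m /pk/leq_trans->. Qed.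

Lemma deg_leM k l p q : deg_le k p -> deg_le l q -> deg_le (k + l) (p * q).
Proof.
move=> pk ql m; apply: contraR; rewrite -ltnNge mcoeffM => lt.
rewrite big1 // => -[b1 b2] /=; move: (bmnm b1) (bmnm b2) => m1 m2 /eqP mE.
have [->|/pk h1] := eqVneq p@_m1 0; first by rewrite mul0r.
have [->|/ql h2] := eqVneq q@_m2 0; first by rewrite mulr0.
by move: lt; rewrite mE mdegD ltnNge leq_add.
Qed.

Lemma deg_le1 : deg_le 0 (1 : {mpoly R[n]}).
Proof. by move=> m; rewrite mcoeff1; have [->|] := eqVneq m 0%MM; rewrite ?mdeg0 ?eqxx. Qed.

Lemma deg_leX k p a : deg_le k p -> deg_le (a * k) (p ^+ a).
Proof.
move=> pk; elim: a => [|a IHa]; first by rewrite expr0; apply: deg_le1.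
by rewrite exprS mulSn; apply: deg_leM.
Qed.

Lemma deg_le_prod (I : finType) (k : I -> nat) (f : I -> {mpoly R[n]}) :
  (forall i, deg_le (k i) (f i)) -> deg_le (\sum_i k i) (\prod_i f i).
Proof.
move=> fk; elim/big_ind2: _ => //; first exact: deg_le1.
by move=> ? ? ? ? ? ?; apply: deg_leM.
Qed.

End Degree.

Lemma int_dependent (I J : finType) (M : I -> J -> int) : (#|J| < #|I|)%N ->
  exists2 c : I -> int, (exists i, c i != 0) & forall j, \sum_i c i * M i j = 0.
Proof.
move=> JI; pose A : 'M[rat]_(#|I|, #|J|) := \matrix_(i, j) (M (enum_val i) (enum_val j))%:~R.
have : kermx A != 0.
  by rewrite -mxrank_eq0 mxrank_ker -lt0n subn_gt0 (leq_ltn_trans (rank_leq_col A)).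
move=> /rowV0Pn[v /sub_kermxP vA v0].
have [d d0 [c cE]] := common_denominator (fun i => v 0 (enum_rank i)).
exists c => [|j].
  move: v0 => /rV0Pn[i vi]; exists (enum_val i).
  by rewrite -(intr_eq0 rat) -cE enum_valK mulf_neq0 // intr_eq0.
apply: (@intr_inj rat); rewrite rmorph0 rmorph_sum /=.
transitivity (d%:~R * (v *m A) 0 (enum_rank j)); last by rewrite vA mxE mulr0.
rewrite mxE mulr_sumr (reindex_onto enum_rank enum_val) => [|i _]; last exact: enum_valK.
apply: eq_big => [i|i _]; first by rewrite enum_rankK eqxx.
by rewrite mxE !enum_rankK rmorphM /= -cE; ring.
Qed.

Lemma alg_dependent n (f : 'I_n.+1 -> {mpoly int[n]}) :
  exists N (c : {ffun 'I_n.+1 -> 'I_N} -> int), (exists m, c m != 0) /\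
    \sum_m c m *: \prod_i f i ^+ m i = 0.
Proof.
pose d := (\max_i msize (f i)).+1.
have fd i : deg_le d (f i).
  by apply: deg_leW _ (@deg_le_msize _ _ (f i)); rewrite /d leqW // leq_bigmax.
(* There are [N ^ n.+1] products and [W ^ n = N ^ n * D ^ n] target monomials, fewer because
   [D ^ n < N]. As [n.+1 * d < D], every exponent occurring in a product is below [W]. *)
pose D := (n.+1 * d).+1; pose N := (D ^ n).+1; pose W := (N * D)%N.
exists N.
pose mon (u : {ffun 'I_n -> 'I_W}) : 'X_{1..n} := [multinom (u i : nat) | i < n].
have [|c c0 cM] := @int_dependent {ffun 'I_n.+1 -> 'I_N} {ffun 'I_n -> 'I_W}
  (fun m u => (\prod_i f i ^+ m i)@_(mon u)).
  rewrite !card_ffun !card_ord /W expnMn expnSr ltn_mul2l expn_gt0 /=.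
  by rewrite /N ltnS leqnn.
exists c; split => //; apply/mpolyP => m; rewrite mcoeff0 raddf_sum /=.
under eq_bigr do rewrite mcoeffZ.
have [sm|] := boolP [forall i, (m i < W)%N]; last first.
  rewrite negb_forall => /existsP[i]; rewrite -leqNgt => mi; apply: big1 => g _.
  apply/eqP; rewrite mulf_eq0; apply/orP; right; apply: contraT => nz.
  have : deg_le (\sum_(j < n.+1) N * d)%N (\prod_i f i ^+ g i).
    apply: deg_le_prod => j; apply: (@deg_leW _ _ (g j * d)%N); last exact: deg_leX.
    by rewrite leq_mul2r ltnW ?orbT.
  move=> /(_ m nz); rewrite sum_nat_const card_ord mdegE (bigD1 i) //= => le.
  have : (W <= n.+1 * (N * d))%N by apply: leq_trans mi (leq_trans _ le); rewrite leq_addr.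
  by rewrite /W /D; lia.
pose u : {ffun 'I_n -> 'I_W} := [ffun i => Ordinal (forallP sm i)].
rewrite -[RHS](cM u); apply: eq_bigr => g _; congr (_ * _@__).
by apply/mnmP => i; rewrite mnmE ffunE.
Qed.

(** * Elementary symmetric functions and residue classes of edges *)

Section ElementarySymmetric.
Variables (A : comNzRingType) (E : finType) (f : E -> A).
Implicit Type S : {set E}.

Definition esum S l : A := \sum_(B : {set E} | (B \subset S) && (#|B| == l)) \prod_(x in B) f x.

Lemma esum_gt S l : (#|S| < l)%N -> esum S l = 0.
Proof.
move=> Sl; apply: big_pred0 => B; apply/negbTE/negP => /andP[/subset_leq_card BS /eqP Bl].
by move: Sl; rewrite -Bl ltnNge BS.
Qed.

Lemma esum0 S : esum S 0 = 1.
Proof.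
rewrite /esum (big_pred1 finset.set0) ?big_set0 // => B.
rewrite cards_eq0 andbC /=; case: eqVneq => //= ->; exact: finset.sub0set.
Qed.

Lemma prodD_subsets (C : comNzRingType) S (a b : E -> C) :
  \prod_(x in S) (a x + b x) =
  \sum_(B : {set E} | B \subset S) (\prod_(x in B) a x * \prod_(x in S :\: B) b x).
Proof.
transitivity (\prod_x ((if x \in S then a x else 0) + (if x \in S then b x else 1))).
  by rewrite big_mkcond; apply: eq_bigr => x _; case: ifP; rewrite ?add0r.
rewrite bigA_distr (bigID (fun B : {set E} => B \subset S)) /= [X in _ + X]big1 ?addr0.
  apply: eq_bigr => B BS; rewrite [RHS]mulrC.
  rewrite (bigID (fun x => x \in B)) /= mulrC; congr (_ * _); last first.
    by apply: eq_bigr => x xB; rewrite xB (fintype.subsetP BS).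
  rewrite big_mkcond [RHS]big_mkcond; apply: eq_bigr => x _; rewrite inE.
  by case: (x \in B); case: (x \in S).
move=> B /fintype.subsetPn[x xB xS]; rewrite (bigD1 x) //= xB (negPf xS) mul0r //.
Qed.

Lemma esum_prod1 S l : esum S l = (\prod_(x in S) (1 + f x *: 'X))`_l.
Proof.
under eq_bigr do rewrite addrC; rewrite prodD_subsets coef_sum /esum big_mkcondr /=.
apply: eq_bigr => B BS; rewrite [X in _ * X]big1 // mulr1.
rewrite scaler_prod prodr_const coefZ coefXn eq_sym.
by case: ifP => _; rewrite ?mulr1 ?mulr0.
Qed.

(** The power of [z] brings the possibly different numbers of edges leaving and entering a vertex to
    one degree [N], so that coefficients can be compared term by term. *)
Lemma prod_sub_esum S N z : (#|S| <= N)%N ->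
  z ^+ (N - #|S|) * \prod_(x in S) (z - f x) =
  \sum_(l < N.+1) (-1) ^+ l * z ^+ (N - l) * esum S l.
Proof.
move=> SN; under [X in _ * X]eq_bigr do rewrite addrC.
rewrite prodD_subsets mulr_sumr.
rewrite (partition_big (fun B : {set E} => inord #|B| : 'I_N.+1) xpredT) //=.
apply: eq_bigr => l _; rewrite /esum mulr_sumr; apply: eq_big => [B|B].
  apply: andb_id2l => BS; rewrite -val_eqE /= inordK //.
  by rewrite ltnS (leq_trans (subset_leq_card BS)).
case/andP => BS /eqP lE; have {lE} <- : #|B| = l.
  by rewrite -lE inordK // ltnS (leq_trans (subset_leq_card BS)).
rewrite prodr_const mulrCA mulrAC -prodrN prodrN.
have -> : z ^+ (N - #|B|) = z ^+ (N - #|S|) * z ^+ #|S :\: B|.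
  rewrite -exprD cardsD (finset.setIidPr BS) addnBA ?subset_leq_card //.
  by rewrite subnK.
by ring.
Qed.

End ElementarySymmetric.

Lemma esum_rmorph (A B : comNzRingType) (E : finType) (g : {rmorphism A -> B})
  (f : E -> A) S l : g (esum f S l) = esum (g \o f) S l.
Proof. by rewrite rmorph_sum; apply: eq_bigr => C _; rewrite rmorph_prod. Qed.

Section PrimesAbove.
Variable G : digraph.
Local Notation ZE := (polyring G int).
Local Notation x_ := (@var G int).

Lemma mem_DeltaP (P : ZE -> Prop) :
  P 0 -> ((forall d, d \in Delta G -> P d) <->
  forall v l, P (esum x_ (out_edges v) l - esum x_ (in_edges v) l)).
Proof.
move=> P0; split=> PD => [v l|d].
  case: l => [|l]; first by rewrite !esum0 subrr.
  have [lv|lv] := leqP l.+1 (maxn #|out_edges v| #|in_edges v|).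
    apply: (PD (delta v l.+1)); apply/allpairsPdep; exists v, l.+1.
    by rewrite mem_enum mem_iota add1n.
  move: lv; rewrite gtn_max => /andP[h1 h2].
  by rewrite !esum_gt // subrr.
by move=> /allpairsPdep[v [l [_ _ ->]]]; apply: PD.
Qed.

Variable P : set ZE.
Hypothesis Pp : prime_ideal P.
Hypothesis PDelta : forall d, d \in Delta G -> P d.

(** The generators of I(G) make the characteristic polynomials of outgoing and incoming edges
    congruent modulo [P], up to powers of ['X]; [count_mod_prime] compares their roots in the class
    of [c]. *)
Lemma balanced_class c : ~ P c -> balanced [set e | `[< P (x_ e - c) >]]%SET.
Proof.
move=> nPc v; have := (mem_DeltaP (prime0 Pp)).1 PDelta v.
set O := out_edges v; set I := in_edges v => PD.
pose N := maxn #|O| #|I|.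
pose s := [seq x_ e | e <- enum O]; pose t := [seq x_ e | e <- enum I].
have := @count_mod_prime _ P Pp s t (N - #|O|) (N - #|I|) _ c nPc.
have cnt (S : {set edge G}) : count (fun x => `[< P (x - c) >]) [seq x_ e | e <- enum S]
    = #|([set e | `[< P (x_ e - c) >]] :&: S)%SET|.
  rewrite count_map -sum1_count big_enum_cond /= -sum1_card.
  by apply: eq_bigl => e; rewrite !inE andbC.
rewrite !cnt; apply => i; rewrite /s /t !big_map !big_enum /=.
rewrite (@prod_sub_esum {poly ZE} _ (fun e => (x_ e)%:P) O N) ?leq_maxl //.
rewrite (@prod_sub_esum {poly ZE} _ (fun e => (x_ e)%:P) I N) ?leq_maxr //.
rewrite -sumrB coef_sum; apply: prime_sum => // l _.
rewrite -mulrBr; apply: (PP_M Pp) => j.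
rewrite -!(@esum_rmorph _ _ _ (@polyC ZE)) -rmorphB coefC; case: ifP => _; [exact: PD|exact: prime0].
Qed.

End PrimesAbove.

(** * Bounds on the length of chains of primes *)

Lemma prime_chain_trunc (A : comPzRingType) n m (q : nat -> set A) :
  (m <= n)%N -> prime_chain n q -> prime_chain m q.
Proof.
move=> mn [qp inc]; split=> i im; first by apply: qp; apply: leq_trans im mn.
by apply: inc; apply: leq_trans im mn.
Qed.

Lemma prime_chain_witness (A : comPzRingType) n (q : nat -> set A) :
  prime_chain n q -> exists x : nat -> A, forall i, (i < n)%N -> q i.+1 (x i) /\ ~ q i (x i).
Proof.
move=> [_ inc].
have ex i : exists x, (i < n)%N -> q i.+1 x /\ ~ q i x.
  have [lin|] := boolP (i < n)%N; last by exists 0.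
  have [sub nsub] := inc i lin; apply: contrapT => no; apply: nsub => x qx.
  by apply: contrapT => nq; apply: no; exists x.
by have [x xP] := choice ex; exists x.
Qed.

Lemma prime_int_notin (A : comPzRingType) (Q : set A) (p : nat) (c : int) :
  prime_ideal Q -> prime p -> Q p%:R -> ~~ (p %| c)%Z -> ~ Q c%:~R.
Proof.
move=> Qp pp Qpp; rewrite dvdzE /= -prime_coprime // => cop Qc.
have [u [v uv]] : exists u v : int, u * p%:Z + v * c = 1.
  have [u [v uv]] := Bezoutz p%:Z c; exists u, v; rewrite uv.
  by rewrite /gcdz /= (eqP cop).
apply: (prime1 Qp); rewrite -[1]/(1%:~R) -uv rmorphD !rmorphM /=.
by apply: primeD => //; apply: primeMl.
Qed.

Lemma prime_ideal_nat (A : comPzRingType) (Q : set A) (c : int) :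
  prime_ideal Q -> c != 0 -> Q c%:~R -> exists2 p, prime p & Q p%:R.
Proof.
move=> Qp c0 Qc.
have Qa : Q (`|c|%N%:R).
  move: Qc; case: (intP c) => [|k|k] Qc //.
  by rewrite abszN -[_%:R]opprK; apply: primeN => //; move: Qc; rewrite mulrNz.
have {Qc} : (0 < `|c|)%N by rewrite absz_gt0.
move: `|c|%N Qa => a; have [n] := ubnP a; elim: n a => // n IHn a an Qa a0.
have [a1|a1] := leqP a 1.
  have a1' : a = 1%N by lia.
  by case: (prime1 Qp); move: Qa; rewrite a1' mulr1n.
have pa := pdiv_prime a1.
have Qd : Q ((pdiv a)%:R * (a %/ pdiv a)%:R) by rewrite -natrM mulnC divnK ?pdiv_dvd.
have [Qp'|{}Qd] := primeM Qp Qd; first by exists (pdiv a).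
apply: IHn Qd _; last by rewrite divn_gt0 ?pdiv_gt0 ?pdiv_leq.
by rewrite -ltnS; apply: leq_trans an; rewrite ltnS ltn_Pdiv // prime_gt1.
Qed.

Lemma int_pfactor (p : nat) (c : int) : prime p -> c != 0 ->
  exists v c', c = p%:Z ^+ v * c' /\ ~~ (p %| c')%Z.
Proof.
move=> pp; have [n] := ubnP `|c|%N; elim: n c => // n IHn c cn c0.
have [/dvdzP[d dE]|nd] := boolP (p %| c)%Z; last by exists 0, c; rewrite mul1r.
have d0 : d != 0 by apply: contraNneq c0 => d0; rewrite dE d0 mul0r.
have [|v [c' [dE' nc']]] := IHn d _ d0.
  move: cn; rewrite dE abszM absz_nat; have := prime_gt1 pp.
  by move: d0; rewrite -absz_gt0; nia.
by exists v.+1, c'; split; rewrite // dE dE' exprS; ring.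
Qed.

Section ChainBound.
Variables (G : digraph) (K : nat).
Local Notation ZE := (polyring G int).
Variables (theta : {rmorphism ZE -> {mpoly int[K]}}) (iota : {rmorphism {mpoly int[K]} -> ZE}).

Section ModPrime.
Variable P : set ZE.
Hypothesis Pp : prime_ideal P.
Hypothesis thetaP : forall f, P (f - iota (theta f)).

(** Modulo [P] a polynomial equals [iota] of its image, so a dependence among the images in [K]
    variables lifts. Dividing by [p] while [p] divides every coefficient decreases the sum of the
    absolute values and ends with a coefficient prime to [p]. *)
Lemma dependent_mod (p : nat) (x : 'I_K.+1 -> ZE) : prime p ->
  exists N (c : {ffun 'I_K.+1 -> 'I_N} -> int), (exists m, ~~ (p %| c m)%Z) /\
    P (\sum_m (c m)%:~R * \prod_i x i ^+ m i).
Proof.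
move=> pp; have [N [c [cn0 c0]]] := alg_dependent (theta \o x).
have {c cn0 c0} [c [cp c0]] : exists c : {ffun 'I_K.+1 -> 'I_N} -> int,
    (exists m, ~~ (p %| c m)%Z) /\ \sum_m c m *: \prod_i (theta \o x) i ^+ m i = 0.
  have [n] := ubnP (\sum_m `|c m|)%N; elim: n c cn0 c0 => // n IHn c [m0 cm0] c0 cn.
  have [[m nm]|all_dvd] := pselect (exists m, ~~ (p %| c m)%Z); first by exists c; split => //; exists m.
  have dvd m : (p %| c m)%Z by apply: contrapT => /negP nm; apply: all_dvd; exists m.
  pose c' m := (c m %/ p)%Z; have cE m : c m = p%:Z * c' m by rewrite mulrC /c' divzK.
  apply: (IHn c'); first by exists m0; apply: contraNneq cm0; rewrite cE => ->; rewrite mulr0.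
    have : p%:Z%:MP * \sum_m c' m *: \prod_i (theta \o x) i ^+ m i = 0 :> {mpoly int[K]}.
      rewrite -[RHS]c0 mulr_sumr; apply: eq_bigr => m _.
      by rewrite mul_mpolyC scalerA -cE.
    move=> /eqP; rewrite mulf_eq0 mpolyC_eq0 => /orP[/eqP [p0]|/eqP//].
    by move: pp; rewrite p0.
  rewrite ltnS in cn; apply: leq_trans cn; rewrite (bigD1 m0) //= [X in (_ < X)%N](bigD1 m0) //= -addSn leq_add //.
    rewrite cE abszM absz_nat; have := prime_gt1 pp; move: cm0; rewrite cE mulf_eq0 negb_or -!absz_gt0.
    by case/andP => _; nia.
  by apply: leq_sum => m _; rewrite cE abszM absz_nat; have := prime_gt1 pp; nia.
exists N, c; split => //.
have -> : \sum_m (c m)%:~R * \prod_i x i ^+ m i =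
  \sum_m (c m)%:~R * (\prod_i x i ^+ m i) - iota 0 by rewrite rmorph0 subr0.
rewrite -c0 rmorph_sum -sumrB; apply: prime_sum => // m _.
have -> : c m *: \prod_i (theta \o x) i ^+ m i = theta ((c m)%:~R * \prod_i x i ^+ m i).
  have cE : (c m)%:MP = (c m)%:~R :> {mpoly int[K]}.
    by rewrite -(rmorph_int (@mpolyC K int)) intz.
  rewrite rmorphM /= rmorph_int -mul_mpolyC cE rmorph_prod.
  by congr (_ * _); apply: eq_bigr => i _; rewrite rmorphXn.
exact: thetaP.
Qed.

End ModPrime.

Variable q : nat -> set ZE.
Hypothesis thetaP : forall f, q 0%N (f - iota (theta f)).

Lemma lex_dependent n N (c : {ffun 'I_K.+1 -> 'I_N} -> int) (D : {set {ffun 'I_K.+1 -> 'I_N}})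
    (x : nat -> ZE) :
  n = K.+1 -> prime_chain n q -> (forall i, (i < n)%N -> q i.+1 (x i) /\ ~ q i (x i)) ->
  D != finset.set0 -> (forall m, m \in D -> ~ q n (c m)%:~R) ->
  ~ q 0%N (\sum_(m in D) (c m)%:~R * \prod_(i < K.+1) x i ^+ m i).
Proof.
move=> nK ch xP D0 Dc; rewrite nK in ch xP Dc.
have := @lex_chain_contra _ _ q x _ D (fun m => (c m)%:~R) (fun m i => m (inord i)) ch xP D0 Dc.
under eq_bigr do under eq_bigr do rewrite inord_val.
apply => m1 m2 _ _ eqm; apply/ffunP => i; apply/val_inj.
by have := eqm i (ltn_ord i); rewrite inord_val.
Qed.

Lemma chain_bound_nonzero n : prime_chain n q ->
  (forall c : int, c != 0 -> ~ q n c%:~R) -> (n <= K)%N.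
Proof.
move=> ch nz; rewrite leqNgt; apply/negP => Kn.
have ch' := prime_chain_trunc Kn ch.
have [x xP] := prime_chain_witness ch'.
(* Here the relation only has to be nontrivial; the prime 2 is an arbitrary choice. *)
have [N [c [[m0 cm0] c0]]] := dependent_mod (ch'.1 0%N isT) thetaP (fun i : 'I_K.+1 => x i) (isT : prime 2).
pose D := [set m | c m != 0]%SET.
apply: (@lex_dependent K.+1 N c D x) => //.
- by apply/finset.set0Pn; exists m0; rewrite inE; apply: contraNneq cm0 => ->.
- move=> m; rewrite inE => /nz h qc; apply: h.
  have sub : forall k, (K.+1 <= k <= n)%N -> q k (c m)%:~R.
    elim=> // k IHk /andP[]; rewrite leq_eqVlt => /predU1P[<- //|]; rewrite ltnS => Kk kn.
    by have [s _] := ch.2 k kn; apply: s; apply: IHk; rewrite Kk ltnW.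
  by apply: sub; rewrite Kn leqnn.
move: c0; rewrite (bigID (fun m => m \in D)) /= [X in _ + X]big1 ?addr0 // => m.
by rewrite inE negbK => /eqP->; rewrite mul0r.
Qed.

Lemma chain_bound_prime n (p : nat) : prime_chain n q -> prime p ->
  q 0%N p%:R -> (n <= K)%N.
Proof.
move=> ch pp qp; rewrite leqNgt; apply/negP => Kn.
have ch' := prime_chain_trunc Kn ch; have q0p := ch'.1 0%N isT.
have [x xP] := prime_chain_witness ch'.
have [N [c [[m0 cm0] c0]]] := dependent_mod (ch'.1 0%N isT) thetaP (fun i : 'I_K.+1 => x i) pp.
pose D := [set m | ~~ (p %| c m)%Z]%SET.
apply: (@lex_dependent K.+1 N c D x) => //.
- by apply/finset.set0Pn; exists m0; rewrite inE.
- move=> m; rewrite inE; apply: (prime_int_notin (ch'.1 _ (leqnn _)) pp).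
  exact: (prime_chain_le ch').
move: c0; rewrite (bigID (fun m => m \in D)) /= => c0.
rewrite -[X in q _ X](addrK (\sum_(m | m \notin D) (c m)%:~R * \prod_(i < K.+1) x i ^+ m i)).
apply: primeB => //; apply: prime_sum => // m; rewrite inE negbK => /dvdzP[d ->].
by rewrite rmorphM /= -mulrA; apply: primeMl => //; apply: primeMr => //; rewrite -pmulrn.
Qed.

(** The number [p] itself is the witness of step [a], and the [K.+1] other witnesses are dependent.
    Writing a coefficient as [p ^ v * c'] with [c'] prime to [p], the exponent [v] becomes that of
    the witness [p], while [c'] stays outside the top prime, which contains [p]. *)
Lemma chain_bound_mixed a (p : nat) : prime_chain K.+2 q -> prime p -> (a < K.+2)%N ->
  q a.+1 p%:R -> ~ q a p%:R -> False.
Proof.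
move=> ch pp aK qa1 nqa; have q0p := ch.1 0%N isT.
have [y yP] := prime_chain_witness ch.
have [N [c [[m0 cm0] c0]]] := dependent_mod (ch.1 0%N isT) thetaP (fun j : 'I_K.+1 => y (bump a j)) pp.
pose D := [set m | c m != 0]%SET.
have factor m : exists d : nat * int, c m != 0 ->
    c m = p%:Z ^+ d.1 * d.2 /\ ~~ (p %| d.2)%Z.
  have [cm|/(int_pfactor pp)[v [d vd]]] := eqVneq (c m) 0; first by exists (0%N, 0).
  by exists (v, d).
have [f fP] := choice factor.
pose v m := (f m).1; pose c' m := (f m).2.
have c'P m : c m != 0 -> c m = p%:Z ^+ v m * c' m /\ ~~ (p %| c' m)%Z := fP m.
have qpn : q K.+2 p%:R.
  have sub : forall k, (a.+1 <= k <= K.+2)%N -> q k p%:R.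
    elim=> // k IHk /andP[]; rewrite leq_eqVlt => /predU1P[<- //|]; rewrite ltnS => Kk kn.
    by have [s _] := ch.2 k kn; apply: s; apply: IHk; rewrite Kk ltnW.
  by apply: sub; rewrite aK leqnn.
pose X i : ZE := if i == a then p%:R else y i.
pose ex (m : {ffun 'I_K.+1 -> 'I_N}) i : nat := if i == a then v m else m (inord (unbump a i)).
apply: (@lex_chain_contra _ K.+2 q X _ D (fun m => (c' m)%:~R) ex) => //.
- by move=> i iK; rewrite /X; case: eqVneq => [->|_]; [split|apply: yP].
- by apply/finset.set0Pn; exists m0; rewrite inE; apply: contraNneq cm0 => ->.
- move=> m; rewrite inE => /c'P[_]; exact: (prime_int_notin (ch.1 _ (leqnn _)) pp).
- move=> m1 m2 _ _ eqm; apply/ffunP => j; apply/val_inj.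
  have := eqm (bump a j); rewrite /ex eq_sym (negPf (neq_bump _ _)) bumpK inord_val; apply.
  by rewrite /bump; case: (a <= j)%N; have := ltn_ord j; rewrite /=; lia.
have -> : \sum_(m in D) (c' m)%:~R * \prod_(i < K.+2) X i ^+ ex m i =
    \sum_m (c m)%:~R * \prod_(j < K.+1) y (bump a j) ^+ m j.
  rewrite [RHS](bigID (fun m => m \in D)) /= [X in _ + X]big1 ?addr0; last first.
    by move=> m; rewrite inE negbK => /eqP->; rewrite mul0r.
  apply: eq_bigr => m; rewrite inE => /c'P[-> _].
  rewrite (bigD1_ord (Ordinal aK)) //= /X /ex eqxx rmorphM rmorphXn /= mulrCA -mulrA.
  congr (_ * (_ * _)).
  apply: eq_bigr => j _.
  by rewrite eq_sym (negPf (neq_bump _ _)) bumpK inord_val.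
exact: c0.
Qed.

(** If the top prime of a chain of length [K.+2] contains a nonzero integer, it contains a prime
    number, and the first index where this number occurs decides between [chain_bound_prime] and
    [chain_bound_mixed]. *)
Lemma chain_bound n : prime_chain n q -> (n <= K.+1)%N.
Proof.
move=> ch; rewrite leqNgt; apply/negP => Kn; have ch' := prime_chain_trunc Kn ch.
have qKp := ch'.1 _ (leqnn K.+2).
have [nz|] := pselect (forall c : int, c != 0 -> ~ q K.+2 c%:~R).
  by have := chain_bound_nonzero ch' nz; rewrite ltnNge leqnSn.
move=> /existsNP[c /not_implyP[c0 /contrapT qc]].
have [p pp qp] := prime_ideal_nat qKp c0 qc.
have [a [qa amin]] : exists a, q a p%:R /\ forall b, (b < a)%N -> ~ q b p%:R.
  have ex : exists a, `[< q a p%:R >] by exists K.+2; apply/asboolP.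
  exists (ex_minn ex); case: ex_minnP => a /asboolP qa amin; split => // b ba qb.
  by have := amin b (asboolT qb); rewrite leqNgt ba.
have aK : (a <= K.+2)%N.
  by rewrite leqNgt; apply/negP => /amin.
case: a qa amin aK => [q0 _ _|a qa amin aK].
  by have := chain_bound_prime ch' pp q0; rewrite ltnNge leqnSn.
exact: (chain_bound_mixed ch' pp aK qa (amin a (leqnn _))).
Qed.

End ChainBound.

Section ClassReduction.
Variable G : digraph.
Local Notation ZE := (polyring G int).
Local Notation x_ := (@var G int).

Lemma mpoly_hom_mod n (P : set {mpoly int[n]}) (g : {rmorphism {mpoly int[n]} -> {mpoly int[n]}}) :
  prime_ideal P -> (forall i, P ('X_i - g 'X_i)) -> forall f, P (f - g f).
Proof.
move=> Pp Pg f.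
have PM a b : P (a - g a) -> P (b - g b) -> P (a * b - g (a * b)).
  move=> Pa Pb; rewrite rmorphM.
  have -> : a * b - g a * g b = (a - g a) * b + g a * (b - g b) by ring.
  by apply: primeD => //; [apply: primeMr|apply: primeMl].
have P1 : P (1 - g 1) by rewrite rmorph1 subrr; apply: prime0.
rewrite [f]mpolyE rmorph_sum -sumrB; apply: prime_sum => // m _.
rewrite -mul_mpolyC; apply/PM.
  have -> : (f@_m)%:MP = (f@_m)%:~R :> {mpoly int[n]}.
    by rewrite -(rmorph_int (@mpolyC n int)) intz.
  by rewrite rmorph_int subrr; apply: prime0.
rewrite mpolyXE_id; apply: (big_ind (fun f => P (f - g f)) P1 PM) => i _.
by elim: (m i) => [|k IHk]; rewrite ?expr0 // exprS; apply/PM.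
Qed.

(** [theta] sends an edge to the variable of its residue class, or to 0 for the zero class; [iota]
    sends that variable to a representative edge. The nonzero classes are disjoint and balanced, so
    [card_le_alpha] bounds their number. *)
Lemma class_reduction (P : set ZE) : prime_ideal P -> (forall d, d \in Delta G -> P d) ->
  exists K, (K <= alpha G)%N /\
    exists (theta : {rmorphism ZE -> {mpoly int[K]}}) (iota : {rmorphism {mpoly int[K]} -> ZE}),
      forall f, P (f - iota (theta f)).
Proof.
move=> Pp PD; pose rep e := odflt e [pick e' | `[< P (x_ e' - x_ e) >]].
have repP e : P (x_ (rep e) - x_ e).
  by rewrite /rep; case: pickP => [e' /asboolP|_] //=; rewrite subrr; apply: prime0.
(* Congruent edges define the same predicate, and the choice made by [pick] depends on the predicate
   alone. *)
have rep_eq e e' : P (x_ e - x_ e') -> rep e = rep e'.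
  move=> ee'; have eP : (fun e'' => `[< P (x_ e'' - x_ e) >]) =1 (fun e'' => `[< P (x_ e'' - x_ e') >]).
    move=> e''; apply/asboolP/asboolP => h; first exact: Psub_trans h ee'.
    exact: Psub_trans h (PsubC Pp ee').
  rewrite /rep (eq_pick eP); case: pickP => // /(_ e').
  by rewrite subrr asboolT //; apply: prime0.
pose J := [set e | ~~ `[< P (x_ e) >] && (rep e == e)]%SET.
exists #|J|; split.
  rewrite -[X in (X <= _)%N]card_ord.
  apply: (@card_le_alpha G _ (fun i : 'I_#|J| => [set e | `[< P (x_ e - x_ (enum_val i)) >]]%SET)).
    move=> i; have := enum_valP i; rewrite inE => /andP[/asboolPn nPi _].
    apply: balanced_dicycle; first exact: balanced_class.
    by apply/finset.set0Pn; exists (enum_val i); rewrite inE subrr asboolT //; apply: prime0.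
  move=> i j; apply: contraR => /pred0Pn[e /andP[]] /=; rewrite !inE => /asboolP/asboolP ei /asboolP/asboolP ej.
  apply/eqP/enum_val_inj.
  have := enum_valP i; rewrite inE => /andP[_ /eqP <-].
  have := enum_valP j; rewrite inE => /andP[_ /eqP <-].
  by rewrite -(rep_eq _ _ ei); apply: rep_eq.
pose idx e : option 'I_#|J| := [pick i | enum_val i == rep e].
pose h (k : 'I_#|edge G|) : {mpoly int[#|J|]} := if idx (enum_val k) is Some i then 'X_i else 0.
pose theta : {rmorphism ZE -> {mpoly int[#|J|]}} := mmap (@mpolyC #|J| int) h.
pose iota : {rmorphism {mpoly int[#|J|]} -> ZE} := mmap (@mpolyC #|edge G| int) (fun i => x_ (enum_val i)).
exists theta, iota => f.
apply: (@mpoly_hom_mod _ P (iota \o theta)) => // k /=.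
rewrite mmapX mmap1U /h; set e := enum_val k.
have -> : 'X_k = x_ e by rewrite /var enum_valK.
rewrite /idx; case: pickP => [i /eqP ei|no].
  by rewrite mmapX mmap1U ei; apply: PsubC.
rewrite rmorph0 subr0; apply: contrapT => nPe.
have rJ : rep e \in J.
  rewrite inE; apply/andP; split; last by apply/eqP/rep_eq.
  by apply/asboolPn => /(prime_eqmod Pp (repP e)).
by have := no (enum_rank_in rJ (rep e)); rewrite enum_rankK_in // eqxx.
Qed.

Lemma Delta_chain_bound n (q : nat -> set ZE) : prime_chain n q ->
  (forall d, d \in Delta G -> q 0%N d) -> (n <= (alpha G).+1)%N.
Proof.
move=> ch qD; have [K [Ka [theta [iota thetaP]]]] := class_reduction (ch.1 0%N isT) qD.
by apply: leq_trans (chain_bound thetaP ch) _.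
Qed.

Lemma Delta_chain_bound_nonzero n (q : nat -> set ZE) : prime_chain n q ->
  (forall d, d \in Delta G -> q 0%N d) -> (forall c : int, c != 0 -> ~ q n c%:~R) ->
  (n <= alpha G)%N.
Proof.
move=> ch qD nz; have [K [Ka [theta [iota thetaP]]]] := class_reduction (ch.1 0%N isT) qD.
exact: leq_trans (chain_bound_nonzero thetaP ch nz) Ka.
Qed.

End ClassReduction.

(** * Koszul complexes *)

Lemma sum_sig (M : nmodType) (I : finType) (P : pred I) (F : I -> M) :
  \sum_(a : {a | P a}) F (val a) = \sum_(a | P a) F a.
Proof.
rewrite [RHS](reindex_omap (val : {a | P a} -> I) insub) => [|a Pa]; last first.
  by rewrite (insubT P Pa).
by apply: eq_bigl => a; rewrite (valP a) valK eqxx.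
Qed.

Section DegreeZero.
Variables (R : comNzRingType) (C : complex R) (b0 : basis C).
Hypothesis deg0 : forall b : basis C, (hdeg b == 0) = (b == b0).
Hypothesis degN1 : forall b : basis C, hdeg b != -1.

Lemma hdeg_bot : hdeg b0 = 0.
Proof. by apply/eqP; rewrite deg0. Qed.

Definition bot : {b : basis C | pred1 (0 : int) (hdeg b)} :=
  exist _ b0 (etrans (deg0 b0) (eqxx b0)).

Lemma bot_unique (b : {b : basis C | pred1 (0 : int) (hdeg b)}) : b = bot.
Proof. by apply/val_inj/eqP; case: b => b /= bP; rewrite -deg0. Qed.

Lemma chain0_ker (x : chain C (pred1 0)) :
  x \in ker_pred (@boundary R C (pred1 0) (pred1 (0 - 1))).
Proof.
apply/eqP/ffunP => -[b /= bP]; exfalso.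
by have := degN1 b; rewrite (eqP bP) sub0r eqxx.
Qed.

Definition chain0 (r : R) : chain C (pred1 0) := [ffun => r].

Definition cycle0 (r : R) :
    ker (@boundary R C (pred1 0) (pred1 (0 - 1))) :=
  Ker (chain0_ker (chain0 r)).

Lemma cycle0_surj (z : ker (@boundary R C (pred1 0) (pred1 (0 - 1)))) :
  z = cycle0 (ker_val z bot).
Proof. by apply/val_inj/ffunP => b; rewrite ffunE /= (bot_unique b). Qed.

Definition class0 (r : R) : homology C 0 := quot_pi _ (cycle0 r).

Lemma class0_surj (h : homology C 0) : exists r, h = class0 r.
Proof.
exists (ker_val (quot_repr h) bot); rewrite /class0 -cycle0_surj.
by rewrite (quot_reprK h).
Qed.

Lemma class0_is_additive : {morph class0 : r r' / r - r'}.
Proof.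
move=> r r'; rewrite /class0; apply: (addIr (quot_pi _ (cycle0 r'))).
by rewrite subrK -quot_piD; congr quot_pi; apply/val_inj/ffunP => b; rewrite !ffunE subrK.
Qed.

Lemma class0Z a r : a *: class0 r = class0 (a * r).
Proof.
rewrite /class0 [LHS]quot_scale_pi; congr quot_pi.
by apply/val_inj/ffunP => b; rewrite !ffunE.
Qed.

Lemma class0_eq0 r :
  class0 r = 0 <-> exists c : basis C -> R, r = \sum_a c a * diff a b0.
Proof.
have e0 : (0 : homology C 0) = quot_pi (im_submod _ _) 0 := ssrfun.esym (quot_pi0 _).
split=> [|[c rE]]; rewrite e0.
  move=> /quot_piP; rewrite subr0 => /asboolP[y /ffunP/(_ bot)].
  rewrite !ffunE /= => <-.
  exists (fun a => if insub a is Some a' then y a' else 0).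
  rewrite [RHS](bigID (fun a => pred1 (0 + 1 : int) (hdeg a))) /= [X in _ = _ + X]big1 ?addr0.
    rewrite -(sum_sig (fun a => pred1 (0 + 1 : int) (hdeg a))).
    by apply: eq_bigr => a _; rewrite valK.
  move=> a /eqP ha; rewrite diff_deg0 ?mulr0 // => e.
  by apply: ha; rewrite e hdeg_bot.
apply/quot_piP; rewrite subr0; apply/asboolP.
exists [ffun a => c (val a)]; apply/ffunP => b; rewrite (bot_unique b) !ffunE /= rE.
rewrite [RHS](bigID (fun a => pred1 (0 + 1 : int) (hdeg a))) /= [X in _ = _ + X]big1 ?addr0.
  rewrite -(sum_sig (fun a => pred1 (0 + 1 : int) (hdeg a))).
  by apply: eq_bigr => a _; rewrite ffunE.
move=> a /eqP ha; rewrite diff_deg0 ?mulr0 // => e.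
by apply: ha; rewrite e hdeg_bot.
Qed.

(** The homology in degree 0 is cyclic, generated by the class of 1, so its annihilator is that of
    this class. *)
Lemma ann_homology0 r : r \in ann (homology C 0) <->
  exists c : basis C -> R, r = \sum_a c a * diff a b0.
Proof.
rewrite -class0_eq0; split=> [/asboolP/(_ (class0 1))|r0].
  by rewrite class0Z mulr1.
apply/asboolP => h; have [r' ->] := class0_surj h.
by rewrite class0Z mulrC -class0Z r0 scaler0.
Qed.

End DegreeZero.

Section Koszul.
Variable R : comNzRingType.
Implicit Types s : seq R.

Fixpoint kbot s : basis (koszul s) :=
  if s is r :: s' then (false, kbot s') else tt.

Lemma koszul_hdeg_ge0 s (b : basis (koszul s)) : 0 <= hdeg b.
Proof.
elim: s b => [|r s IHs] //= [b1 b2].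
by rewrite /tensor_deg /=; apply: addr_ge0 => //; apply: IHs.
Qed.

Lemma koszul_hdeg_eq0 s (b : basis (koszul s)) : (hdeg b == 0) = (b == kbot s).
Proof.
elim: s b => [[]|r s IHs] //= [b1 b2].
rewrite /tensor_deg /= paddr_eq0 ?koszul_hdeg_ge0 // IHs.
by rewrite -pair_eqE /pair_eq /=; case: b1.
Qed.

Lemma koszul_hdegN1 s (b : basis (koszul s)) : hdeg b != -1.
Proof. by apply: contraTneq (koszul_hdeg_ge0 b) => ->. Qed.

Lemma koszul_diff_kbot s (a : basis (koszul s)) :
  diff a (kbot s) = 0 \/ diff a (kbot s) \in s.
Proof.
elim: s a => [a|r s IHs [[] a]] /=; first by left.
  rewrite /tensor_diff /= !(mulr0, mul0r, addr0); case: eqVneq => _; last by rewrite mulr0; left.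
  by rewrite mulr1 mem_head; right.
rewrite /tensor_diff /= !(expr0, mul0r, mul1r, add0r); have [->|h] := IHs a; [by left|right].
by rewrite inE h orbT.
Qed.

Lemma koszul_diff_mem s r : r \in s -> exists a, diff a (kbot s) = r.
Proof.
elim: s => //= r' s IHs; rewrite inE => /predU1P[->|/IHs[a <-]].
  by exists (true, kbot s); rewrite /tensor_diff /= eqxx mulr1 !(mulr0, mul0r) addr0.
by exists (false, a); rewrite /tensor_diff /= !(expr0, mul0r, mul1r, add0r).
Qed.

(** [h] is the matrix of a homotopy from multiplication by [r] to zero; such an [r] annihilates the
    homology. *)
Definition homotopic0 (C : complex R) (r : R) :=
  exists h : basis C -> basis C -> R, forall a c,
    \sum_b h a b * diff b c + \sum_b diff a b * h b c = r * (a == c)%:R.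

Lemma homotopic0_lin (C : complex R) (I : finType) (k c : I -> R) :
  (forall i, homotopic0 C (c i)) -> homotopic0 C (\sum_i k i * c i).
Proof.
move=> /choice[h hE]; exists (fun a b => \sum_i k i * h i a b) => a c'.
under eq_bigr do rewrite mulr_suml.
under [X in _ + X]eq_bigr do rewrite mulr_sumr.
rewrite exchange_big /= [X in _ + X]exchange_big /= -big_split mulr_suml /=.
apply: eq_bigr => i _; rewrite -mulrA -hE mulrDr !mulr_sumr.
by congr (_ + _); apply: eq_bigr => b _; ring.
Qed.

(** The homotopy acts on the second factor, with the sign of the degree in the first. The two cross
    terms cancel because the differential of [C] changes that sign. *)
Lemma homotopic0_tensor (C D : complex R) r :
  homotopic0 D r -> homotopic0 (tensor C D) r.
Proof.
case=> h2 h2E; pose sg (a : basis C) : R := (-1) ^+ `|hdeg a|%N.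
have sgK a : sg a * sg a = 1 by rewrite /sg -expr2 sqrr_sign.
exists (fun a b => sg a.1 * (a.1 == b.1)%:R * h2 a.2 b.2) => -[a1 a2] [c1 c2].
have -> : \sum_b sg (a1, a2).1 * ((a1, a2).1 == b.1)%:R * h2 (a1, a2).2 b.2
      * tensor_diff b (c1, c2)
    = sg a1 * diff a1 c1 * h2 a2 c2 + (a1 == c1)%:R * \sum_b h2 a2 b * diff b c2.
  rewrite -(pair_bigA _ (fun b1 b2 => sg a1 * (a1 == b1)%:R * h2 a2 b2
    * tensor_diff (b1, b2) (c1, c2))) /= (bigD1 a1) //= [X in _ + X]big1 ?addr0 => [|b1].
    rewrite eqxx mulr1 mulr_sumr -(sum_diff1 (fun b => sg a1 * diff a1 c1 * h2 a2 b)) -big_split /=.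
    apply: eq_bigr => b _; rewrite /tensor_diff /= -/(sg a1) -[X in _ = _ + X]mul1r.
    by move: (sgK a1); move: (sg a1) (a1 == c1)%:R (b == c2)%:R => t x y <-; ring.
  by rewrite eq_sym => /negPf nb; apply: big1 => b2 _; rewrite nb mulr0 !mul0r.
have -> : \sum_b tensor_diff (a1, a2) b * (sg b.1 * (b.1 == (c1, c2).1)%:R
      * h2 b.2 (c1, c2).2)
    = sg c1 * diff a1 c1 * h2 a2 c2 + (a1 == c1)%:R * \sum_b diff a2 b * h2 b c2.
  rewrite -(pair_bigA _ (fun b1 b2 => tensor_diff (a1, a2) (b1, b2)
    * (sg b1 * (b1 == c1)%:R * h2 b2 c2))) /= (bigD1 c1) //= [X in _ + X]big1 ?addr0 => [|b1].
    rewrite eqxx mulr1 mulr_sumr -(sum_diff1 (fun b => sg c1 * diff a1 c1 * h2 b c2)) -big_split /=.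
    apply: eq_bigr => b _; rewrite /tensor_diff /= -/(sg a1) eq_sym.
    have -> : sg a1 * (a1 == c1)%:R = sg c1 * (a1 == c1)%:R.
      by case: eqVneq => [->|]; rewrite ?mulr0.
    rewrite -[X in _ = _ + X]mul1r.
    by move: (sgK c1); move: (sg c1) (a1 == c1)%:R (b == a2)%:R => t x y <-; ring.
  by move=> /negPf nb; apply: big1 => b2 _; rewrite nb mulr0 !mul0r mulr0.
rewrite (sign_diff a1 c1) -/(sg a1) addrACA mulNr subrr add0r -mulrDr h2E.
by rewrite -pair_eqE /pair_eq /= mulrCA -natrM mulnb.
Qed.

(** The homotopy goes back along the arrow, from its degree 0 end to its degree 1 end, with
    coefficient 1. *)
Lemma homotopic0_arrow r (D : complex R) : homotopic0 (tensor (arrow_complex r) D) r.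
Proof.
pose h (a b : bool * basis D) : R := (~~ a.1 && b.1)%:R * (a.2 == b.2)%:R.
exists h => -[a1 a2] [c1 c2].
have -> : \sum_b h (a1, a2) b * tensor_diff (C := arrow_complex r) b (c1, c2)
    = (~~ a1)%:R * tensor_diff (C := arrow_complex r) (true, a2) (c1, c2).
  rewrite (bigD1 (true, a2)) //= big1 ?addr0 => [|[b1 b2]]; rewrite /h /= ?eqxx ?andbT ?mulr1 //.
  rewrite -pair_eqE /pair_eq /= [b2 == _]eq_sym; case: b1 => /= [/negPf->|_].
    by rewrite mulr0 mul0r.
  by rewrite andbF !mul0r.
have -> : \sum_b tensor_diff (C := arrow_complex r) (a1, a2) b * h b (c1, c2)
    = tensor_diff (C := arrow_complex r) (a1, a2) (false, c2) * c1%:R.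
  rewrite (bigD1 (false, c2)) //= big1 ?addr0 => [|[b1 b2]]; rewrite /h /= ?eqxx ?mulr1 //.
  rewrite -pair_eqE /pair_eq /=; case: b1 => /= [_|/negPf->].
    by rewrite mul0r mulr0.
  by rewrite !mulr0.
rewrite /tensor_diff /= -pair_eqE /pair_eq /arrow_diff /=.
by case: a1 c1 => [] [] /=; rewrite ?(expr0, expr1); ring.
Qed.

Lemma koszul_homotopic0 s r : r \in s -> homotopic0 (koszul s) r.
Proof.
elim: s => //= r' s IHs; rewrite inE => /predU1P[->|/IHs].
  exact: homotopic0_arrow.
exact: homotopic0_tensor.
Qed.

End Koszul.

(** * The Krull dimensions *)

Lemma mpoly_hom_ext n (k : nzRingType) (B : nzRingType) (g h : {rmorphism {mpoly k[n]} -> B}) :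
  (forall c, g c%:MP = h c%:MP) -> (forall i, g 'X_i = h 'X_i) -> g =1 h.
Proof.
move=> ghC ghX f; elim/mpolyind: f => [|c m p _ _ IHp]; first by rewrite !rmorph0.
rewrite !rmorphD IHp -mul_mpolyC !rmorphM ghC mpolyXE_id !rmorph_prod; congr (_ * _ + _).
by apply: eq_bigr => i _; rewrite !rmorphXn ghX.
Qed.

Section LowerBound.
Variables (G : digraph) (k : idomainType).
Local Notation a := (alpha G).
Local Notation A := (polyring G k).

Definition cyc (i : 'I_a) : {set edge G} := nth finset.set0 (enum (sval (cid (alpha_attained G)))) i.

Lemma cyc_dicycle i : cyc i \in dicycles G.
Proof.
rewrite /cyc; case: cid => F /= [FD _ Fa]; apply: (fintype.subsetP FD).
by rewrite -mem_enum; apply: mem_nth; rewrite -cardE Fa.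
Qed.

Lemma cyc_disjoint i j e : e \in cyc i -> e \in cyc j -> i = j.
Proof.
rewrite /cyc; case: cid => F /= [FD tF Fa] ei ej; apply: contrapT => /eqP ij.
have sz : size (enum F) = a by rewrite -cardE Fa.
have memF l : (l < a)%N -> nth finset.set0 (enum F) l \in F.
  by move=> la; rewrite -mem_enum; apply: mem_nth; rewrite sz.
have := finset.trivIsetP tF _ _ (memF i (ltn_ord i)) (memF j (ltn_ord j)).
rewrite nth_uniq ?enum_uniq ?sz // => /(_ ij) /disjoint_setI0 /setP /(_ e).
by rewrite !inE ei ej.
Qed.

(** All edges of a cycle of the packing get the same variable, and edges off the packing get 0. The
    first [h] variables are killed, so that the kernels grow with [h]. *)
Definition cycle_var (h : nat) (e : edge G) : {mpoly k[a]} :=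
  if [pick i | e \in cyc i] is Some i then (if (h <= i)%N then 'X_i else 0) else 0.

Lemma cycle_varE h i e : e \in cyc i -> cycle_var h e = if (h <= i)%N then 'X_i else 0.
Proof.
move=> ei; rewrite /cycle_var; case: pickP => [j /(cyc_disjoint ei) <-//|/(_ i)].
by rewrite ei.
Qed.

Lemma cycle_var0 h e : (forall i, e \notin cyc i) -> cycle_var h e = 0.
Proof. by move=> ne; rewrite /cycle_var; case: pickP => // i; rewrite (negPf (ne i)). Qed.

(** In the generating polynomial of the symmetric functions each cycle contributes a power of one
    factor, and it has as many edges leaving [v] as entering it. *)
Lemma esum_cycle_var h v l :
  esum (cycle_var h) (out_edges v) l = esum (cycle_var h) (in_edges v) l.
Proof.
rewrite !esum_prod1; congr (_`_l).
pose c (i : 'I_a) : {mpoly k[a]} := if (h <= i)%N then 'X_i else 0.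
pose Q (n : 'I_a -> nat) : {poly {mpoly k[a]}} := \prod_(i < a) (1 + c i *: 'X) ^+ n i.
have split (S : {set edge G}) : \prod_(x in S) (1 + cycle_var h x *: 'X) =
    Q (fun i => #|cyc i :&: S|%SET).
  rewrite /Q.
  rewrite (bigID (fun x => [exists i, x \in cyc i])) /= [X in _ * X]big1 ?mulr1; last first.
    move=> x /andP[_ /existsPn nx]; rewrite cycle_var0 ?scale0r ?addr0 // => i; exact: nx.
  rewrite (eq_bigr (fun x => \prod_(i < a | x \in cyc i) (1 + c i *: 'X))); last first.
    move=> x /andP[_ /existsP[i xi]]; rewrite (big_pred1 i) ?(cycle_varE h xi) // => j.
    by apply/idP/eqP => [/(cyc_disjoint xi)|->].
  rewrite (exchange_big_dep xpredT) //=; apply: eq_bigr => i _.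
  rewrite -[RHS]prodr_const; apply: eq_bigl => x; rewrite !inE.
  case: (x \in S); case xi : (x \in cyc i); rewrite ?andbF //= ?andbT //.
  by apply/existsP; exists i.
rewrite !split; congr Q; apply/funext => i.
by have /dicyclesP[p cp ->] := cyc_dicycle i; apply: dicycle_balanced.
Qed.

Definition cycle_map h : {rmorphism A -> {mpoly k[a]}} :=
  mmap (@mpolyC a k) (fun i => cycle_var h (enum_val i)).

Lemma cycle_map_var h e : cycle_map h (var k e) = cycle_var h e.
Proof. by rewrite /cycle_map /= /var mmapX mmap1U enum_rankK. Qed.

Lemma cycle_map_esum h v l : cycle_map h (esum (@var G k) (out_edges v) l) = cycle_map h (esum (@var G k) (in_edges v) l).
Proof.
rewrite !esum_rmorph; have E : cycle_map h \o @var G k = cycle_var h by apply/funext => e; apply: cycle_map_var.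
by rewrite !E esum_cycle_var.
Qed.

Definition cycle_prime h : set A := fun f => cycle_map h f = 0.

Lemma ker_prime (B : comPzRingType) (D : idomainType) (f : {rmorphism B -> D}) :
  prime_ideal (fun x => f x = 0).
Proof.
split.
- exact: rmorph0.
- by move=> x y fx fy; rewrite rmorphD fx fy addr0.
- by move=> x y fy; rewrite rmorphM fy mulr0.
- by rewrite rmorph1 => /eqP; rewrite oner_eq0.
- by move=> x y; rewrite rmorphM => /eqP; rewrite mulf_eq0 => /orP[] /eqP; [left|right].
Qed.

(** The map of index [i.+1] is the map of index [i] followed by killing a variable; an edge of the
    cycle [i] lies in the larger kernel only. *)
Lemma cycle_prime_chain : prime_chain a cycle_prime.
Proof.
split=> [i _|i ia]; first exact: (@ker_prime A).
pose g : {rmorphism {mpoly k[a]} -> {mpoly k[a]}} :=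
  mmap (@mpolyC a k) (fun j : 'I_a => if (i < j)%N then 'X_j else 0).
have gE f : cycle_map i.+1 f = g (cycle_map i f).
  apply: (mpoly_hom_ext (g := cycle_map i.+1) (h := g \o cycle_map i)) => [c|e] /=.
    by rewrite !mmapC.
  rewrite -[e]enum_valK -/(var k (enum_val e)) !cycle_map_var /cycle_var.
  case: pickP => [j _|_]; last by rewrite rmorph0.
  case: (ltngtP i j) => ij; rewrite ?rmorph0 //= ?mmapX ?mmap1U ?ij //.
  by rewrite ltnn.
split=> [f fi|sub]; first by rewrite /cycle_prime gE [cycle_map i f]fi rmorph0.
have [e ei] : exists e, e \in cyc (Ordinal ia).
  by apply/finset.set0Pn/dicycle_neq0/cyc_dicycle.
have := sub (var k e); rewrite /cycle_prime !cycle_map_var !(cycle_varE _ ei) /= ltnn leqnn.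
move=> /(_ erefl) /eqP; rewrite -msupp_eq0 msuppX.
by [].
Qed.

End LowerBound.

Section KdimValues.
Variables (R : realType) (G : digraph).

Lemma ann_prime (k : comNzRingType) (f : {rmorphism polyring G int -> polyring G k})
    (p : set (polyring G k)) : prime_ideal p ->
  (forall r, r \in ann (homology (base_change f (KR G)) 0) -> p r) <->
  (forall d, d \in Delta G -> p (f d)).
Proof.
move=> pp; have annE := @ann_homology0 _ (base_change f (KR G)) (kbot (Delta G))
  (@koszul_hdeg_eq0 _ (Delta G)) (@koszul_hdegN1 _ (Delta G)).
split=> [pa d /koszul_diff_mem[a <-]|pD r /annE[c ->]].
  apply: pa; apply/annE; exists (fun b => (b == a)%:R).
  by rewrite (bigD1 a) //= eqxx mul1r big1 ?addr0 // => b /negPf->; rewrite mul0r.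
apply: prime_sum => // a _; apply: primeMl => //=.
have [->|/pD//] := koszul_diff_kbot a; rewrite rmorph0; exact: prime0.
Qed.

Lemma annZ_prime (p : set (polyring G int)) : prime_ideal p ->
  (forall r, r \in ann (homology (KR G) 0) -> p r) <->
  (forall d, d \in Delta G -> p d).
Proof.
move=> pp; have annE := @ann_homology0 _ (KR G) (kbot (Delta G))
  (@koszul_hdeg_eq0 _ (Delta G)) (@koszul_hdegN1 _ (Delta G)).
split=> [pa d /koszul_diff_mem[a <-]|pD r /annE[c ->]].
  apply: pa; apply/annE; exists (fun b => (b == a)%:R).
  by rewrite (bigD1 a) //= eqxx mul1r big1 ?addr0 // => b /negPf->; rewrite mul0r.
apply: prime_sum => // a _; apply: primeMl => //=.
have [->|/pD//] := koszul_diff_kbot a; exact: prime0.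
Qed.

(** For the upper bound a chain is contracted along [f]. Nonzero integers are units over [rat], so
    clearing denominators keeps the inclusions strict and no contracted prime contains a nonzero
    integer. *)
Lemma KdimQ : Kdim R (homology (KRQ G) 0) = ((alpha G)%:R)%:E.
Proof.
pose f : {rmorphism polyring G int -> polyring G rat} := map_mpoly (intr : int -> rat).
have fvar e : f (var int e) = var rat e by rewrite /f /= /var map_mpolyX.
apply: Kdim_eq.
  exists (@cycle_prime G rat); first exact: cycle_prime_chain.
  have p0 := (@cycle_prime_chain G rat).1 0%N isT.
  apply/(ann_prime f p0)/(mem_DeltaP (P := fun d => cycle_prime 0 (f d))).
    by rewrite rmorph0; apply: prime0.
  move=> v l; rewrite rmorphB !esum_rmorph.
  have ext : f \o @var G int = @var G rat by apply/funext => e; apply: fvar.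
  by rewrite !ext /cycle_prime rmorphB cycle_map_esum subrr.
move=> m p ch annp.
have p0 := ch.1 0%N isT; have pD := (ann_prime f p0).1 annp.
apply: (@Delta_chain_bound_nonzero G m (fun i x => p i (f x))) => //.
  split=> [i im|i im]; first exact: prime_ideal_comap (ch.1 i im).
  have [sub nsub] := ch.2 i im; split=> [x|h]; first exact: sub.
  apply: nsub => g pg; have [d d0 [g' gE]] := mpoly_denominator g.
  have pi := ch.1 i (ltnW im).
  have : p i (d%:~R * g).
    by rewrite gE; apply: h; rewrite /f /= -gE; apply: primeMl => //; exact: (ch.1 i.+1 im).
  case/(primeM pi) => // pd; case: (prime1 pi).
  have -> : 1 = ((d%:~R)^-1 : rat)%:MP * d%:~R :> polyring G rat.
    by rewrite -(rmorph_int (@mpolyC _ rat)) -mpolyCM mulVf // intr_eq0.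
  exact: primeMl.
move=> c c0; rewrite rmorph_int => pc; have pm := ch.1 m (leqnn m); apply: (prime1 pm).
have -> : 1 = ((c%:~R)^-1 : rat)%:MP * c%:~R :> polyring G rat.
  by rewrite -(rmorph_int (@mpolyC _ rat)) -mpolyCM mulVf // intr_eq0.
exact: primeMl.
Qed.

Lemma KdimZ : Kdim R (homology (KR G) 0) = (((alpha G).+1)%:R)%:E.
Proof.
apply: Kdim_eq; last first.
  move=> m p ch annp; apply: (Delta_chain_bound ch).
  exact: (annZ_prime (ch.1 0%N isT)).1 annp.
have chZ := @cycle_prime_chain G int; pose a := alpha G.
(* The chain of length [a] ends with the kernel of evaluation at 0, whose quotient is [int].
   Reduction modulo 2 adds the last step. *)
pose ev : {rmorphism polyring G int -> int} := meval (fun=> 0).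
pose red : {rmorphism polyring G int -> 'F_2} := intr \o ev.
have topE f : cycle_prime a f <-> ev f = 0.
  have mapE : cycle_map G int a f = (ev f)%:MP.
    apply: (mpoly_hom_ext (g := @cycle_map G int a) (h := @mpolyC _ int \o ev)) => [c|e] /=.
      by rewrite mmapC mevalC.
    rewrite mevalXU mpolyC0 -[e]enum_valK -/(var int (enum_val e)) cycle_map_var /cycle_var.
    by case: pickP => // j _; rewrite leqNgt ltn_ord.
  by rewrite /cycle_prime mapE; split=> [/eqP|->]; rewrite ?mpolyC_eq0 ?mpolyC0 // => /eqP.
exists (fun i => if (i <= a)%N then cycle_prime i else fun f => red f = 0).
  split=> [i _|i ia1]; first by case: ifP => [/chZ.1//|_]; exact: (ker_prime red).
  have /predU1P[ia|ia] : (i == a) || (i < a)%N by rewrite -leq_eqVlt -ltnS.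
    rewrite ia /= leqnn ltnn; split=> [f /topE fa|sub]; first by rewrite /red /= fa.
    have /topE : cycle_prime a (2%:R : polyring G int) by apply: sub; rewrite rmorph_nat; apply/val_inj.
    by rewrite rmorph_nat.
  by rewrite /= ia (ltnW ia); apply: chZ.2.
move=> r; rewrite leq0n; have p0 := chZ.1 0%N isT; move: r.
apply/(annZ_prime p0)/(mem_DeltaP (P := cycle_prime 0)); first exact: prime0.
by move=> v l; rewrite /cycle_prime rmorphB cycle_map_esum subrr.
Qed.

End KdimValues.

(** * Finite generation *)

(* Subgroups of Z^N are finitely generated, for the image of [S] under [tau]. *)
Lemma subgroup_fg (M : zmodType) (tau : seq (M -> int)) (S : M -> Prop) :
  (forall t, List.In t tau -> forall x y, t (x - y) = t x - t y) ->
  S 0 -> (forall x y, S x -> S y -> S (x - y)) ->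
  exists2 s : seq M, (forall x, List.In x s -> S x) &
    forall x, S x -> exists c : 'I_(size s) -> int,
      S (x - \sum_(i < size s) s`_i *~ c i) /\
      forall t, List.In t tau -> t (x - \sum_(i < size s) s`_i *~ c i) = 0.
Proof.
elim: tau S => [|t tau IH] S addt S0 SB.
  exists [::] => // x Sx; exists (fun=> 0); split=> //.
  by rewrite big_ord0 subr0.
have SN x : S x -> S (- x) by move=> Sx; rewrite -sub0r; apply: SB.
have SD x y : S x -> S y -> S (x + y) by move=> Sx Sy; rewrite -[y]opprK; apply: SB => //; apply: SN.
have SZ x (n : int) : S x -> S (x *~ n).
  have SM k : S x -> S (x *+ k) by move=> Sx; elim: k => [|k IHk]; rewrite ?mulr0n // mulrS; apply: SD.
  by case: n => k Sx; [exact: SM|rewrite NegzE mulrNz; apply/SN/SM].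
have tB x y : t (x - y) = t x - t y by apply: addt; left.
have t0 : t 0 = 0 by rewrite -(subrr 0) tB subrr.
have tN x : t (- x) = - t x by rewrite -sub0r tB t0 sub0r.
have tD x y : t (x + y) = t x + t y by rewrite -{1}[y]opprK tB tN opprK.
have tZ x (n : int) : t (x *~ n) = t x * n.
  have tM k : t (x *+ k) = t x *+ k by elim: k => [|k IHk]; rewrite ?mulr0n // !mulrS tD IHk.
  rewrite -mulrzz; case: n => k; first exact: tM.
  by rewrite !NegzE !mulrNz tN; congr (- _); apply: tM.
have [|||s sS sP] := IH (fun x => S x /\ t x = 0) => //.
- by move=> u h; apply: addt; right.
- by move=> x y [Sx tx] [Sy ty]; split; [apply: SB|rewrite tB tx ty subrr].
(* The values of [t] on [S] form a subgroup of the integers, generated by the value at [g].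
   Subtracting a multiple of [g] leads into the kernel of [t], where the induction applies. *)
have [g [Sg gP]] : exists g, S g /\ forall x, S x -> (t g %| t x)%Z.
  have [z|nz] := pselect (forall x, S x -> t x = 0); first by exists 0; split => // x /z->; rewrite dvdz0.
  have ex : exists n, `[< (0 < n)%N /\ exists2 x, S x & t x = n%:Z >].
    move: nz => /existsNP[x /not_implyP[Sx /eqP tx]]; exists `|t x|%N; apply/asboolP; split; first by rewrite absz_gt0.
    have [tx0|tx0] := leP 0 (t x); first by exists x; rewrite // gez0_abs.
    by exists (- x); [exact: SN|rewrite tN ltz0_abs].
  case: (ex_minnP ex) => n /asboolP[n0 [g Sg gn]] nmin; exists g; split => // x Sx.
  rewrite gn; apply/dvdz_mod0P; apply: contrapT => /eqP mod0.
  pose x' := x - g *~ (t x %/ n)%Z.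
  have tx' : t x' = (t x %% n)%Z by rewrite tB tZ gn /modz mulrC.
  have mod_ge : (0 <= t x %% n)%Z by rewrite modz_ge0 // gt_eqF.
  have := nmin `|(t x %% n)%Z|%N; rewrite asboolT; last first.
    split; first by rewrite absz_gt0.
    by exists x'; [apply: SB => //; apply: SZ|rewrite tx' gez0_abs].
  move=> /(_ isT); apply/negP; rewrite -ltnNge -ltz_nat gez0_abs //.
  by rewrite ltz_pmod.
exists (g :: s) => [x [<-//|/sS[]//]|x Sx].
have /dvdzP[d dE] := gP x Sx.
have [|c [[Sy ty] tauy]] := sP (x - g *~ d).
  by split; [apply: SB => //; apply: SZ|rewrite tB tZ dE mulrC subrr].
exists (fun i => if unlift ord0 i is Some j then c j else d).
have -> : x - \sum_(i < size (g :: s)) (g :: s)`_i *~ (if unlift ord0 i is Some j then c j else d)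
   = x - g *~ d - \sum_(i < size s) s`_i *~ c i.
  rewrite big_ord_recl unlift_none /= opprD addrA; congr (_ - _).
  by apply: eq_bigr => i _; rewrite liftK.
by split=> // u [<-//|]; apply: tauy.
Qed.

Section Truncation.
Variables (n : nat) (R : nzRingType) (d : nat).
Implicit Types p q : {mpoly R[n]}.

(* Membership in the ideal generated by the [d]-th powers of the first [i] variables *)
Definition in_powers i p := forall m : 'X_{1..n}, (forall j : 'I_n, (j < i)%N -> (m j < d)%N) -> p@_m = 0.

Lemma in_powers0 p : in_powers 0 p -> p = 0.
Proof. by move=> p0; apply/mpolyP => m; rewrite mcoeff0; apply: p0. Qed.

Lemma in_powers_zero i : in_powers i 0.
Proof. by move=> m _; rewrite mcoeff0. Qed.

Lemma in_powersD i p q : in_powers i p -> in_powers i q -> in_powers i (p + q).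
Proof. by move=> hp hq m mi; rewrite mcoeffD hp // hq // addr0. Qed.

Lemma in_powersN i p : in_powers i p -> in_powers i (- p).
Proof. by move=> hp m mi; rewrite mcoeffN hp // oppr0. Qed.

Lemma in_powersM i p q : in_powers i p -> in_powers i (p * q).
Proof.
move=> hp m mi; rewrite mcoeffM big1 // => -[b1 b2] /=; move: (bmnm b1) (bmnm b2) => m1 m2 /eqP mE.
rewrite hp ?mul0r // => j /mi; rewrite mE mnmDE; apply: leq_ltn_trans; exact: leq_addr.
Qed.

Lemma in_powers_sum i (I : finType) (F : I -> {mpoly R[n]}) :
  (forall k, in_powers i (F k)) -> in_powers i (\sum_k F k).
Proof. by move=> hF; elim/big_ind: _ => //; [exact: in_powers_zero|exact: in_powersD]. Qed.

Lemma in_powers_cancel (i : 'I_n) p : in_powers i (p * 'X_i ^+ d) -> in_powers i p.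
Proof.
move=> hp m mi; rewrite -(mcoeffMX p (U_(i) *+ d) m) -mpolyXn; apply: hp => j ji.
rewrite mnmDE mulmnE mnm1E; have /negPf-> : i != j by apply: contraTneq ji => ->; rewrite ltnn.
by rewrite mul0n add0n; apply: mi.
Qed.

Lemma in_powersS (i : 'I_n) p : in_powers i.+1 p ->
  exists q c, p = q * 'X_i ^+ d + c /\ in_powers i c.
Proof.
move=> hp; pose q := \sum_(m <- msupp p | (d <= m i)%N) p@_m *: 'X_[m - U_(i) *+ d].
pose c := \sum_(m <- msupp p | ~~ (d <= m i)%N) p@_m *: 'X_[m].
exists q, c; split.
  rewrite {1}[p]mpolyE (bigID (fun m : 'X_{1..n} => (d <= m i)%N)) /=; congr (_ + _).
  rewrite /q mulr_suml; apply: eq_bigr => m dm; rewrite -scalerAl mpolyXn -mpolyXD submK //.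
  apply/mnm_lepP => j; rewrite mulmnE mnm1E; case: eqVneq => [<-|_]; by rewrite ?mul1n.
move=> m mi; rewrite /c raddf_sum /= big1_seq // => k /andP[dk kp]; rewrite mcoeffZ mcoeffX.
case: eqVneq => [km|]; last by rewrite mulr0.
rewrite hp ?mul0r // => j; rewrite ltnS leq_eqVlt => /predU1P[ji|ji].
  by rewrite (_ : j = i) ?ltnNge //; apply: val_inj.
by rewrite km; apply: mi.
Qed.

End Truncation.

Section CycleBoundary.
Variables (n : nat) (R : comNzRingType) (C : complex {mpoly R[n]}) (d : nat).
Hypothesis null : forall i : 'I_n, homotopic0 C ('X_i ^+ d).

Let bdry (z : basis C -> {mpoly R[n]}) (b : basis C) := \sum_a z a * diff a b.

Lemma bdryD y z b : bdry (fun a => y a + z a) b = bdry y b + bdry z b.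
Proof. by rewrite /bdry -big_split; apply: eq_bigr => a _; rewrite mulrDl. Qed.

Lemma bdry_bdry z b : bdry (bdry z) b = 0.
Proof.
rewrite /bdry; under eq_bigr do rewrite mulr_suml.
rewrite exchange_big big1 // => a _; under eq_bigr do rewrite -mulrA.
by rewrite -mulr_sumr diff_diff mulr0.
Qed.

(* The variables are removed one at a time: [x ^+ d] is a non-zero-divisor
   modulo the powers of the previous variables, and acts on the homology as zero. *)
Lemma cycle_in_powers_boundary (z : basis C -> {mpoly R[n]}) :
  (forall b, bdry z b = 0) -> (forall b, in_powers d n (z b)) ->
  exists y, forall b, bdry y b = z b.
Proof.
move=> zc zn.
suff gen i : (i <= n)%N -> (exists y r, (forall b, z b = bdry y b + r b) /\ forall b, in_powers d i (r b)) ->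
    exists y, forall b, bdry y b = z b.
  apply: (gen n (leqnn n)); exists (fun=> 0), z; split => // b.
  by rewrite /bdry big1 ?add0r // => a _; rewrite mul0r.
elim: i => [_ [y [r [zE r0]]]|i IHi lin [y [r [zE rn]]]].
  by exists y => b; rewrite zE (in_powers0 (r0 b)) addr0.
apply: (IHi (ltnW lin)); pose x := Ordinal lin.
have [q qP] := choice (fun b => @in_powersS n _ d x (r b) (rn b)).
have [c cP] := choice qP.
have [h hE] := null x.
have rE b : r b = q b * 'X_x ^+ d + c b by case: (cP b).
have ci b : in_powers d i (c b) by case: (cP b).
(* Both [z] and [bdry y] are cycles, hence so is [r]. Thus the boundary of [q], times the power of
   the variable, is minus the boundary of [c], and the power cancels modulo the previous ones. *)
have bq b : in_powers d i (bdry q b).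
  apply: (@in_powers_cancel n _ d x).
  have -> : bdry q b * 'X_x ^+ d = - bdry c b.
    apply/eqP; rewrite -addr_eq0; have := zc b.
    have -> : bdry z b = bdry (fun a => bdry y a + r a) b by apply: eq_bigr => a _; rewrite zE.
    rewrite bdryD bdry_bdry add0r => <-; apply/eqP.
    rewrite /bdry mulr_suml -big_split /=; apply: eq_bigr => a _; rewrite rE; ring.
  by apply/in_powersN/in_powers_sum => a; apply: in_powersM.
(* The homotopy splits [q] times the power into the boundary of [h q], which goes into [y], and [h]
   applied to the boundary of [q], which joins the remainder. *)
exists (fun a => y a + \sum_b q b * h b a), (fun b => \sum_a bdry q a * h a b + c b).
split=> [b|b]; last first.
  by apply: in_powersD => //; apply: in_powers_sum => a; apply: in_powersM.
rewrite zE bdryD rE -[RHS]addrA; congr (_ + _); rewrite [RHS]addrA; congr (_ + _).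
have -> : q b * 'X_x ^+ d = \sum_a q a * ('X_x ^+ d * (a == b)%:R).
  by rewrite (bigD1 b) //= eqxx mulr1 big1 ?addr0 // => a /negPf->; rewrite !mulr0.
under eq_bigr do rewrite -hE mulrDr !mulr_sumr.
rewrite big_split /=; congr (_ + _).
  rewrite /bdry exchange_big /=; apply: eq_bigr => a _; rewrite mulr_suml.
  by apply: eq_bigr => a' _; rewrite mulrA.
rewrite /bdry exchange_big /=; apply: eq_bigr => a _; rewrite mulr_suml.
by apply: eq_bigr => a' _; rewrite mulrA.
Qed.

End CycleBoundary.

Lemma in_map_List (T1 T2 : Type) (f : T1 -> T2) (s : seq T1) y :
  List.In y (map f s) -> exists x, y = f x.
Proof. by elim: s => //= x s IHs [<-|/IHs//]; exists x. Qed.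

Lemma map_In_List (T1 : eqType) (T2 : Type) (f : T1 -> T2) (s : seq T1) x :
  x \in s -> List.In (f x) (map f s).
Proof. by elim: s => //= y s IHs; rewrite inE => /predU1P[->|/IHs]; [left|right]. Qed.

Lemma additive_ext (U V : zmodType) (f : U -> V) : {morph f : x y / x - y} ->
  exists g : {additive U -> V}, g =1 f.
Proof.
move=> fB; pose f1 := GRing.isZmodMorphism.Build _ _ f fB.
by exists (HB.pack_for {additive U -> V} f f1).
Qed.

Lemma quot_pi_additive (R : pzRingType) (V : lmodType R) (U : {pred V}) (subU : submod_closed U) :
  exists pi : {additive V -> quot_mod subU}, pi =1 quot_pi subU.
Proof.
by apply: additive_ext => x y; apply: (addIr (quot_pi subU y)); rewrite subrK -quot_piD subrK.
Qed.

Lemma fg_Zmodule_surj (M N : zmodType) (f : M -> N) : {morph f : x y / x - y} ->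
  (forall y, exists x, f x = y) -> fg_Zmodule M -> fg_Zmodule N.
Proof.
move=> /additive_ext[g gf] fsurj [s sP]; exists (map g s) => y.
have [x <-] := fsurj y; have [c xE] := sP x; rewrite size_map; exists c.
rewrite -gf {1}xE raddf_sum; apply: eq_bigr => i _.
by rewrite raddfMz (nth_map 0).
Qed.

Section TotalHomology.
Variables (n : nat) (C : complex {mpoly int[n]}) (d : nat).
Hypothesis null : forall i : 'I_n, homotopic0 C ('X_i ^+ d).
Local Notation A := {mpoly int[n]}.
Local Notation dd := (@boundary A C predT predT).

Lemma chainT_sum (F : basis C -> A) :
  \sum_(a : {b : basis C | predT (hdeg b)}) F (val a) = \sum_a F a.
Proof. exact: (sum_sig (fun a : basis C => predT (hdeg a))). Qed.

Definition lift_chain (z : chain C predT) (b : basis C) : A := z (exist _ b isT).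

Lemma lift_chain_val z (a : {b : basis C | predT (hdeg b)}) : lift_chain z (val a) = z a.
Proof. by rewrite /lift_chain; congr (z _); apply: val_inj. Qed.

Lemma boundary_lift z b : dd z b = \sum_a lift_chain z a * diff a (val b).
Proof.
rewrite ffunE -(chainT_sum (fun a => lift_chain z a * diff a (val b))).
by apply: eq_bigr => a _; rewrite lift_chain_val.
Qed.

(** The coefficients with all exponents below [d] are finitely many integral coordinates on the
    cycles. A cycle on which they vanish is a boundary, so cycles generating the image of the
    coordinates generate the homology. *)
Lemma fg_total_homology : fg_Zmodule (total_homology C).
Proof.
pose Z := ker dd.
pose coord (p : basis C * {ffun 'I_n -> 'I_d}) (z : Z) : int :=
  (lift_chain (ker_val z) p.1)@_[multinom (p.2 i : nat) | i < n].
have coordB p : forall x y : Z, coord p (x - y) = coord p x - coord p y.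
  by move=> x y; rewrite /coord /lift_chain /= !ffunE mcoeffB.
have inm := @in_map_List _ _ coord (enum {: basis C * {ffun 'I_n -> 'I_d}}).
have [|||s _ sP] := @subgroup_fg Z (map coord (enum {: basis C * {ffun 'I_n -> 'I_d}})) (fun=> True) => //.
  by move=> t /inm[p ->]; apply: coordB.
have [pi piE] := quot_pi_additive (im_submod dd dd).
exists (map pi s) => x; have [c [_ cP]] := sP (quot_repr x) I.
rewrite size_map; exists c.
set u := _ - _ in cP.
have u_im : u \in @im_pred _ _ _ _ dd dd.
  have [||y yE] := @cycle_in_powers_boundary n int C d null (lift_chain (ker_val u)).
  - move=> b; have /eqP/ffunP/(_ (exist _ b isT)) := valP u.
    by rewrite -[LHS]/(dd (ker_val u) (exist _ b isT)) boundary_lift ffunE.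
  - move=> b m mlow; have mlow' (i : 'I_n) : (m i < d)%N by apply: mlow.
    pose p := (b, [ffun i => Ordinal (mlow' i)]).
    have := cP (coord p) (map_In_List _ (mem_enum _ p)); rewrite /coord.
    have -> : [multinom (p.2 i : nat) | i < n] = m by apply/mnmP => i; rewrite mnmE ffunE.
    by [].
  apply/asboolP; exists [ffun a => y (val a)]; apply/ffunP => b.
  rewrite boundary_lift -[RHS]lift_chain_val -yE; apply: eq_bigr => a _.
  by rewrite /lift_chain ffunE.
rewrite -[LHS](quot_reprK x) -piE; have : pi u = 0.
  by rewrite piE -(quot_pi0 (im_submod dd dd)); apply/quot_piP; rewrite subr0.
rewrite /u raddfB /= raddf_sum => /eqP; rewrite subr_eq0 => /eqP->.
by apply: eq_bigr => i _; rewrite raddfMz /= (nth_map 0).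
Qed.

End TotalHomology.

Section DegreeZeroPart.
Variables (R : comNzRingType) (C : complex R) (b0 : basis C).
Hypothesis deg0 : forall b : basis C, (hdeg b == 0) = (b == b0).
Hypothesis degN1 : forall b : basis C, hdeg b != -1.
Local Notation dd := (@boundary R C predT predT).
Local Notation cls := (@class0 R C degN1).

Let at0 (z : ker dd) : R := ker_val z (exist _ b0 isT).

(** The coordinate at [b0] induces a map from the total homology. It is onto because every chain
    supported at [b0] is a cycle, degree -1 being empty. *)
Lemma fg_homology0 : fg_Zmodule (total_homology C) -> fg_Zmodule (homology C 0).
Proof.
have clsB r r' : cls (r - r') = cls r - cls r' := @class0_is_additive R C degN1 r r'.
have im0 z : z \in @im_pred _ _ _ _ dd dd -> cls (at0 z) = 0.
  move=> /asboolP[y yz]; apply/(@class0_eq0 R C b0 deg0 degN1); exists (fun a => y (exist _ a isT)).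
  rewrite /at0 -yz ffunE -(sum_sig (fun a : basis C => predT (hdeg a)) (fun a => y (exist _ a isT) * diff a b0)).
  by apply: eq_bigr => a _; congr (y _ * _); apply: val_inj.
have at0B z z' : at0 (z - z') = at0 z - at0 z' by rewrite /at0 !ffunE.
have cls_repr z : cls (at0 (quot_repr (quot_pi (im_submod dd dd) z))) = cls (at0 z).
  apply/eqP; rewrite -subr_eq0 -clsB -at0B; apply/eqP/im0.
  by apply/(quot_piP (im_submod dd dd)); apply: quot_reprK.
apply: (@fg_Zmodule_surj _ _ (fun x : total_homology C => cls (at0 (quot_repr x)))) => [x y|h].
  have [pi piE] := quot_pi_additive (im_submod dd dd).
  rewrite -[x in LHS](quot_reprK x) -[y in LHS](quot_reprK y) -!piE -raddfB piE cls_repr.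
  by rewrite at0B clsB.
have [r ->] := @class0_surj R C b0 deg0 degN1 h.
pose z : chain C predT := [ffun b => if val b == b0 then r else 0].
have zker : z \in ker_pred dd.
  apply/eqP/ffunP => b; rewrite !ffunE big1 // => a _; rewrite ffunE.
  case: eqP => [->|_]; last by rewrite mul0r.
  rewrite diff_deg0 ?mulr0 // hdeg_bot // => e; have := degN1 (val b).
  by rewrite -(addrK 1 (hdeg _)) -e sub0r eqxx.
exists (quot_pi _ (Ker zker)); rewrite cls_repr; congr (cls _).
by rewrite /at0 /= ffunE /= eqxx.
Qed.

End DegreeZeroPart.

(** * Acyclicity and nilpotency modulo I(G) *)

Section InIdeal.
Variables (A : comNzRingType) (s : seq A).

Lemma in_ideal0 : in_ideal s 0.
Proof. by exists (fun=> 0); rewrite big1 // => i _; rewrite mul0r. Qed.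

Lemma in_idealD x y : in_ideal s x -> in_ideal s y -> in_ideal s (x + y).
Proof.
move=> [c ->] [c' ->]; exists (fun i => c i + c' i).
by rewrite -big_split; apply: eq_bigr => i _; rewrite mulrDl.
Qed.

Lemma in_idealM a x : in_ideal s x -> in_ideal s (a * x).
Proof.
move=> [c ->]; exists (fun i => a * c i); rewrite mulr_sumr.
by apply: eq_bigr => i _; rewrite mulrA.
Qed.

Lemma in_ideal_mem x : x \in s -> in_ideal s x.
Proof.
move=> xs; have ix : (index x s < size s)%N by rewrite index_mem.
exists (fun i => (i == Ordinal ix)%:R); rewrite (bigD1 (Ordinal ix)) //= eqxx mul1r nth_index //.
by rewrite big1 ?addr0 // => i /negPf->; rewrite mul0r.
Qed.

Lemma in_ideal_sum (I : Type) (r : seq I) (P : pred I) (F : I -> A) :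
  (forall i, P i -> in_ideal s (F i)) -> in_ideal s (\sum_(i <- r | P i) F i).
Proof. by move=> hF; elim/big_ind: _ => //; [exact: in_ideal0|exact: in_idealD]. Qed.

Definition radical x := exists n, in_ideal s (x ^+ n).

Lemma in_ideal_expn x n m : (n <= m)%N -> in_ideal s (x ^+ n) -> in_ideal s (x ^+ m).
Proof. by move=> nm; rewrite -(subnK nm) exprD; apply: in_idealM. Qed.

Lemma radicalM a x : radical x -> radical (a * x).
Proof. by move=> [n xn]; exists n; rewrite exprMn; apply: in_idealM. Qed.

Lemma radicalN x : radical x -> radical (- x).
Proof. by rewrite -mulN1r; apply: radicalM. Qed.

Lemma radicalD x y : radical x -> radical y -> radical (x + y).
Proof.
move=> [n xn] [m ym]; exists (n + m)%N; rewrite exprDn; apply: in_ideal_sum => i _.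
rewrite -mulr_natl; apply: in_idealM; have [im|im] := leqP m i.
  by apply: in_idealM; apply: in_ideal_expn ym.
by rewrite mulrC; apply: in_idealM; apply: in_ideal_expn xn; lia.
Qed.

Lemma radical_mem x : in_ideal s x -> radical x.
Proof. by exists 1%N; rewrite expr1. Qed.

Lemma radical_sum (I : Type) (r : seq I) (P : pred I) (F : I -> A) :
  (forall i, P i -> radical (F i)) -> radical (\sum_(i <- r | P i) F i).
Proof.
by move=> hF; elim/big_ind: _ => //; [apply/radical_mem/in_ideal0|exact: radicalD].
Qed.

Lemma radical_expn x n : radical (x ^+ n) -> radical x.
Proof. by move=> [m]; rewrite -exprM; exists (n * m)%N. Qed.

End InIdeal.

Section Nilpotency.
Variable G : digraph.
Local Notation x_ := (@var G int).
Local Notation rad := (radical (Delta G)).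

(* Modulo I(G), [x_ e] is a root of the monic polynomial whose lower coefficients
   are the elementary symmetric functions of the edges leaving [tgt e]. *)
Lemma radical_in_edge e :
  (forall f, src f = tgt e -> rad (x_ f)) -> rad (x_ e).
Proof.
move=> hout; set v := tgt e in hout; pose N := #|in_edges v|.
have eI : e \in in_edges v by rewrite inE.
have := @prod_sub_esum _ _ x_ (in_edges v) N (x_ e) (leqnn _).
rewrite (bigD1 e) //= subrr mul0r mulr0 big_ord_recl /= expr0 mul1r subn0 esum0 mulr1.
move=> /ssrfun.esym/eqP; rewrite addr_eq0 => /eqP xN; apply: (@radical_expn _ _ _ N).
rewrite xN; apply: radicalN; apply: radical_sum => l _; apply: radicalM.
rewrite /bump /= add1n -(subKr (esum x_ (out_edges v) l.+1) (esum x_ (in_edges v) l.+1)).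
apply: radicalD; last first.
  apply/radicalN/radical_mem.
  exact: ((mem_DeltaP (P := in_ideal (Delta G)) (in_ideal0 _)).1 (fun d => @in_ideal_mem _ _ d)).
apply: radical_sum => B /andP[BS /eqP Bl].
have /card_gt0P[f fB] : (0 < #|B|)%N by rewrite Bl.
rewrite (bigD1 f) //= mulrC; apply: radicalM; apply: hout.
by have := fintype.subsetP BS f fB; rewrite inE => /eqP.
Qed.

(** By [radical_in_edge], an edge that is not nilpotent modulo I(G) is followed by another such
    edge, so these edges would contain a directed cycle. *)
Lemma acyclic_nilpotent : acyclic G ->
  exists n : nat, (1 <= n)%N /\ forall x : edge G, I_of (x_ x ^+ n).
Proof.
move=> ac.
have all_rad e : rad (x_ e).
  apply: contrapT => nr; pose S := [set e | ~~ `[< rad (x_ e) >]]%SET.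
  have [|e' e'S|p cp _] := @exists_dicycle G S.
  - by apply/finset.set0Pn; exists e; rewrite inE; apply/asboolPn.
  - move: e'S; rewrite inE => /asboolPn nr'; apply: contrapT => nf; apply: nr'.
    apply: radical_in_edge => f sf; apply: contrapT => nrf; apply: nf.
    by exists f => //; rewrite inE; apply/asboolPn.
  - by have := ac p; rewrite cp.
have [n nP] := choice all_rad.
exists (\sum_e n e).+1; split => // e; apply: in_ideal_expn (nP e).
by rewrite (bigD1 e) //= -addnS leq_addr.
Qed.

Lemma nilpotent_fg (n : nat) : (forall x : edge G, I_of (x_ x ^+ n)) ->
  fg_Zmodule (total_homology (KR G)).
Proof.
move=> nil; apply: (@fg_total_homology _ (KR G) n) => i.
have -> : 'X_i = x_ (enum_val i) by rewrite /var enum_valK.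
have [c ->] := nil (enum_val i); apply: homotopic0_lin => j.
by apply: koszul_homotopic0; apply: mem_nth.
Qed.

(** [theta] kills I(G) and turns powers of an edge on a cycle of the packing into powers of a
    variable, of unbounded degree, while integral combinations of finitely many generators have
    bounded degree. *)
Lemma fg_alpha0 : fg_Zmodule (homology (KR G) 0) -> alpha G = 0%N.
Proof.
case=> s sP; apply/eqP; rewrite -leqn0 leqNgt; apply/negP => a0.
pose deg0 := @koszul_hdeg_eq0 _ (Delta G); pose degN1 := @koszul_hdegN1 _ (Delta G).
pose cls := @class0 _ (KR G) degN1.
have clsB r r' : cls (r - r') = cls r - cls r' := @class0_is_additive _ (KR G) degN1 r r'.
have [g gE] := additive_ext clsB.
have [f fP] := choice (@class0_surj _ (KR G) (kbot (Delta G)) deg0 degN1).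
pose theta := cycle_map G int 0.
have thetaI r : cls r = 0 -> theta r = 0.
  move=> /(@class0_eq0 _ (KR G) _ deg0 degN1)[c ->]; rewrite rmorph_sum big1 // => b _; rewrite rmorphM.
  have [->|dD] := koszul_diff_kbot b; first by rewrite rmorph0 mulr0.
  have D0 : forall d, d \in Delta G -> theta d = 0.
    apply/(mem_DeltaP (P := fun d => theta d = 0)); first exact: rmorph0.
    by move=> v l; rewrite rmorphB cycle_map_esum subrr.
  by rewrite [theta (diff _ _)]D0 ?mulr0.
pose i0 := Ordinal a0.
have [e ei] : exists e, e \in cyc i0 by apply/finset.set0Pn/dicycle_neq0/cyc_dicycle.
(* [msize] is the degree plus one for a nonzero polynomial, so the [N]-th power of the variable
   occurs in none of the images of the generators. *)
pose N := (\sum_(i < size s) msize (theta (f (s`_i)%R)))%N.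
have [c xE] := sP (cls (x_ e ^+ N)).
have : theta (x_ e ^+ N - \sum_(i < size s) f s`_i *~ c i) = 0.
  apply: thetaI; rewrite clsB -[X in _ - X]gE raddf_sum xE; apply/eqP; rewrite subr_eq0; apply/eqP.
  by apply: eq_bigr => i _; rewrite raddfMz; congr (_ *~ _); rewrite /= gE; apply: fP.
rewrite rmorphB rmorphXn rmorph_sum /= => /(congr1 (mcoeff (U_(i0) *+ N))).
rewrite mcoeffB mcoeff0 raddf_sum /= big1 => [|i _].
  rewrite subr0 /theta cycle_map_var (cycle_varE _ 0 ei) leq0n mpolyXn mcoeffX eqxx => /eqP.
  by rewrite oner_eq0.
rewrite rmorphMz raddfMz /= memN_msupp_eq0 ?mul0rz //; apply: msize_mdeg_ge.
rewrite mdegMn mdeg1 mul1n /N (bigD1 i) //= leq_addr //.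
Qed.

End Nilpotency.

Theorem theorem1p11 (R : realType) (G : digraph) :
  [<-> acyclic G;
       fg_Zmodule (homology (KR G) 0);
       fg_Zmodule (total_homology (KR G));
       exists n : nat, (1 <= n)%N /\ forall x : edge G, I_of (var int x ^+ n);
       Kdim R (homology (KR G) 0) = 1%:E;
       Kdim R (homology (KRQ G) 0) = 0%:E]
  /\ [/\ ((alpha G)%:R)%:E = Kdim R (homology (KRQ G) 0),
         (Kdim R (homology (KRQ G) 0) <= Kdim R (homology (KR G) 0) - 1)%E,
         (Kdim R (homology (KR G) 0) - 1 <= ((beta G)%:R)%:E)%E
       & planar G R ->
         [/\ ((alpha G)%:R)%:E = Kdim R (homology (KRQ G) 0),
             Kdim R (homology (KRQ G) 0) = (Kdim R (homology (KR G) 0) - 1)%E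
           & (Kdim R (homology (KR G) 0) - 1)%E = ((beta G)%:R)%:E]].
Proof.
have ac_nil := @acyclic_nilpotent G.
have nil_fg : (exists n : nat, (1 <= n)%N /\ forall x : edge G, I_of (var int x ^+ n)) ->
    fg_Zmodule (total_homology (KR G)) by case=> n [_ /nilpotent_fg].
have fg_fg0 : fg_Zmodule (total_homology (KR G)) -> fg_Zmodule (homology (KR G) 0).
  exact: (fg_homology0 (@koszul_hdeg_eq0 _ (Delta G)) (@koszul_hdegN1 _ (Delta G))).
have fg0_ac : fg_Zmodule (homology (KR G) 0) -> acyclic G by move=> /fg_alpha0/alpha_eq0.
have KZ1 : (Kdim R (homology (KR G) 0) - 1 = ((alpha G)%:R)%:E)%E.
  by rewrite KdimZ -EFinB -addn1 natrD addrK.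
split; last first.
  rewrite KZ1 KdimQ; split=> // [|/planar_alpha_beta <-//].
  by rewrite lee_fin ler_nat alpha_le_beta.
(* The first four conditions are linked from acyclicity to nilpotency, to the total homology, to
   degree 0 and back; the last two become [alpha G = 0] by the values of the dimensions. *)
tfae.
- by move=> /ac_nil/nil_fg/fg_fg0.
- by move=> /fg0_ac/ac_nil/nil_fg.
- by move=> /fg_fg0/fg0_ac/ac_nil.
- by move=> /nil_fg/fg_fg0/fg_alpha0 a0; rewrite KdimZ a0.
- by rewrite KdimZ KdimQ => /eqP; rewrite eqe (eqr_nat R _ 1) => /eqP[->].
- by rewrite KdimQ => /eqP; rewrite eqe pnatr_eq0 => /eqP/alpha_eq0.
Qed.
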